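(* Let $n\ge2$, $0\le l<k\le n$ and $\theta\in(0,\pi)$. Suppose $h$ is an admissible solution of $$\frac{\sigma_k(\nabla^2h+h\sigma)}{\sigma_l(\nabla^2h+h\sigma)}=\frac{\binom{n}{k}}{\binom{n}{l}}\ \text{ in }\mathcal{C}_\theta,$$ with $\nabla_\mu h=\cot\theta\,h$ on $\partial\mathcal{C}_\theta$. Then $$h(\xi)=\ell(\xi)+\sum_{\alpha=1}^n a_\alpha\langle\xi,E_\alpha\rangle,\qquad \xi\in\mathcal{C}_\theta,$$ for some constants $a_1,\dots,a_n\in\mathbb{R}$.
   Context: $E_1,\dots,E_{n+1}$ is the standard basis of $\mathbb{R}^{n+1}$ ($E_1,\dots,E_n$ horizontal), $e=-E_{n+1}$, $\overline{\mathbb{R}^{n+1}_+}=\{x_{n+1}\ge0\}$. $\mathcal{C}_\theta=\{\xi\in\overline{\mathbb{R}^{n+1}_+}:|\xi-\cos\theta\,e|=1\}$ with round metric $\sigma$, connection $\nabla$, unit outward conormal $\mu$ of $\partial\mathcal{C}_\theta$; $\ell(\xi)=\sin^2\theta+\cos\theta\langle\xi,e\rangle$. $\sigma_j(W)$ is the $j$-th elementary symmetric function of the eigenvalues of $W$ ($\sigma_0=1$); $\Gamma_k=\{\lambda\in\mathbb{R}^n:\sigma_i(\lambda)>0,1\le i\le k\}$; $h\in C^2(\mathcal{C}_\theta)$ is admissible if the eigenvalues of $\nabla^2h+h\sigma$ lie in $\Gamma_k$ everywhere. *)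

(* Defs.v *)
From HB Require Import structures.
From mathcomp Require Import all_boot all_order all_algebra.
From mathcomp Require Import all_classical all_reals all_analysis.
Set Implicit Arguments. Unset Strict Implicit. Unset Printing Implicit Defensive.
Import Order.TTheory GRing.Theory Num.Theory.
Import numFieldNormedType.Exports.
Local Open Scope classical_set_scope.
Local Open Scope ring_scope.

(* Points of R^{n+1} are row vectors 'rV[R]_n.+1; index ord_max is the
   (n+1)-th (vertical) coordinate. *)

Definition Ebasis (R : realType) (n : nat) (i : 'I_n.+1) : 'rV[R]_n.+1 :=
  delta_mx 0 i.

Definition edir (R : realType) (n : nat) : 'rV[R]_n.+1 := - Ebasis R ord_max.
Arguments edir R n : clear implicits.
Arguments Ebasis R {n} i.

Definition dotv (R : realType) (n : nat) (u v : 'rV[R]_n.+1) : R :=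
  \sum_(i < n.+1) u 0 i * v 0 i.

(* y = xi - cos(theta) e : position relative to the centre of the unit sphere *)
Definition relpos (R : realType) (n : nat) (theta : R) (xi : 'rV[R]_n.+1) :=
  xi - cos theta *: edir R n.

Definition cap (R : realType) (n : nat) (theta : R) : set 'rV[R]_n.+1 :=
  [set xi : 'rV[R]_n.+1 | 0 <= xi 0 ord_max /\
            dotv (relpos theta xi) (relpos theta xi) = 1].
Arguments cap {R} n theta.

Definition cap_bd (R : realType) (n : nat) (theta : R) : set 'rV[R]_n.+1 :=
  [set xi : 'rV[R]_n.+1 | cap n theta xi /\ xi 0 ord_max = 0].
Arguments cap_bd {R} n theta.

Definition ell (R : realType) (n : nat) (theta : R) (xi : 'rV[R]_n.+1) : R :=
  sin theta ^+ 2 + cos theta * dotv xi (edir R n).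

(* unit outward conormal of the boundary of C_theta: normalized projection
   of e (the outward direction, x_{n+1} decreasing) onto the tangent space
   of the sphere at xi *)
Definition conormal (R : realType) (n : nat) (theta : R) (xi : 'rV[R]_n.+1)
  : 'rV[R]_n.+1 :=
  let y := relpos theta xi in
  let w := edir R n - dotv (edir R n) y *: y in
  (Num.sqrt (dotv w w))^-1 *: w.

Definition pd (R : realType) (n : nat) (i : 'I_n.+1)
  (f : 'rV[R]_n.+1 -> R) (x : 'rV[R]_n.+1) : R :=
  derive f x (Ebasis R i).

Definition grad (R : realType) (n : nat) (f : 'rV[R]_n.+1 -> R)
  (x : 'rV[R]_n.+1) : 'rV[R]_n.+1 := \row_i pd i f x.

Definition hess (R : realType) (n : nat) (f : 'rV[R]_n.+1 -> R)
  (x : 'rV[R]_n.+1) : 'M[R]_n.+1 := \matrix_(i, j) pd i (pd j f) x.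

Definition C2_on (R : realType) (n : nat) (U : set 'rV[R]_n.+1)
  (f : 'rV[R]_n.+1 -> R) : Prop :=
  (forall x, U x -> differentiable f x) /\
  (forall i x, U x -> differentiable (pd i f) x) /\
  (forall i j x, U x -> {for x, continuous (pd i (pd j f))}).

(* The tensor W = nabla^2 h + h sigma at xi, as the (n+1)x(n+1) matrix
   P (D^2 H - <DH, y> I + H I) P, where P = I - y^T y is the orthogonal
   projection onto the tangent space T_xi = y^perp of the unit sphere
   |xi - cos(theta) e| = 1 (Gauss formula).  On y^perp it is the matrix of
   W in ambient coordinates, and it vanishes on y; hence its eigenvalues are
   those of W together with one extra 0. *)
Definition Wmat (R : realType) (n : nat) (theta : R) (f : 'rV[R]_n.+1 -> R)
  (xi : 'rV[R]_n.+1) : 'M[R]_n.+1 :=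
  let y := relpos theta xi in
  let P := 1%:M - y^T *m y in
  P *m (hess f xi + (f xi - dotv (grad f xi) y)%:M) *m P.

(* sigma_j(A): j-th elementary symmetric function of the eigenvalues of A
   (counted with multiplicity, as roots of the characteristic polynomial),
   i.e. (-1)^j times the coefficient of X^(N-j) in char_poly A (Vieta).
   An extra zero eigenvalue does not change sigma_j. *)
Definition sigmaj (R : realType) (N : nat) (j : nat) (A : 'M[R]_N) : R :=
  (-1) ^+ j * (char_poly A)`_(N - j).

Definition admissible (R : realType) (n k : nat) (theta : R)
  (h : 'rV[R]_n.+1 -> R) : Prop :=
  forall xi, cap n theta xi ->
    forall i : nat, (1 <= i <= k)%N -> 0 < sigmaj i (Wmat theta h xi).

(* Main.v *)
(* Centre the cap at the origin: put f(y) = h(y + cos(theta) e) on {|y| = 1, y_{n+1} >= tau},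
   tau = cos(theta).  For a horizontal unit vector nu let R be the reflection in nu^perp and
   v = (f - f o R) / <y, nu> on the half cap <y, nu> >= 0, with v = 2 <Df, nu> on the wall
   <y, nu> = 0.  Since f and f o R solve the same equation and sigma_k / sigma_l is strictly
   monotone on Gamma_k (real-rootedness of characteristic polynomials and Newton's
   inequalities along rank-one perturbations), v obeys a strong maximum principle; explicit
   barriers exclude a maximum attained only on the wall, also at the corner, so v is constant.
   Hence f(y) - f(R y) = 2 <Df(pole), nu> <y, nu> for every nu, i.e. f minus a horizontal linear
   function depends on t = y_{n+1} only.  The Hessian tensor then has eigenvalues p (n - 1 times)
   and lambda, the equation makes (1 - t^2)^n (p^k - p^l)^2 constant, and this constant
   vanishes at the pole.  So p = lambda = 1, f is affine in t, and the boundary condition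
   gives f = 1 - tau t. *)
Require Import Defs.
From HB Require Import structures.
From mathcomp Require Import all_boot all_order all_algebra.
From mathcomp Require Import all_classical all_reals all_analysis.
From mathcomp Require Import complex sesquilinear spectral ring lra zify.
Set Implicit Arguments. Unset Strict Implicit. Unset Printing Implicit Defensive.
Import Order.TTheory GRing.Theory Num.Theory.
Import numFieldNormedType.Exports.
Local Open Scope classical_set_scope.
Local Open Scope ring_scope.

(** * Real-rooted polynomials and Newton's inequalities *)

(** The operator [nabla^2 + sigma] has a zeroth-order term of unfavourable sign, and the boundary
    coefficient can have either sign, so [f - f o R] has no maximum principle of its own. Dividing
    by [z = <y, nu>] cures both: [z] is linear, so its tensor [nabla^2 z + z sigma] vanishes, and
    being horizontal it satisfies the same homogeneous boundary condition as [f]. Subtracting [M z]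
    at a touching point therefore changes neither the tensor nor the boundary condition. The price
    is that the quotient degenerates at [z = 0], whence the separate barriers for the wall and the
    corner. The equation is never differentiated, as [f] is only C^2: two matrices on one level set
    of [sigma_k / sigma_l] are compared through finite rank-one increments, along which every
    [sigma_j] is affine. Strict monotonicity along them comes from the factor below 1 in Newton's
    inequalities. *)

Definition split_real (R : rcfType) (p : {poly R}) :=
  exists c (s : seq R), p = c *: \prod_(z <- s) ('X - z%:P).

(** The logarithmic derivative is the sum of the [1 / (z - r)], and each term has imaginary part of
    sign opposite to [Im z]. Off the real axis the sum thus vanishes only for the empty product. *)
Lemma im_log_deriv (R : rcfType) (s : seq R) (z : R[i]) :
  complex.Im z != 0 ->
  let q := map_poly (real_complex R) (\prod_(r <- s) ('X - r%:P)) in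
  q.[z] != 0 /\
  (complex.Im z * complex.Im (q^`().[z] / q.[z]) <= 0 ?= iff (s == [::])).
Proof.
move=> z0 /=; elim: s => [|r s [IH1 IH2]].
  rewrite !big_nil rmorph1 hornerC oner_neq0 derivC horner0 mul0r /= mulr0 eqxx.
  by split=> //; apply/leifP; rewrite eqxx.
rewrite !big_cons rmorphM /= rmorphB /= map_polyX map_polyC /=.
set q := map_poly _ _ in IH1 IH2 *.
have zr : z - (real_complex R r) != 0.
  by apply: contraNneq z0 => /eqP; rewrite subr_eq0 => /eqP ->.
have -> : (('X - (real_complex R r)%:P) * q).[z] = (z - real_complex R r) * q.[z].
  by rewrite !hornerE.
split; first by rewrite mulf_neq0.
have -> : (('X - (real_complex R r)%:P) * q)^`().[z] /
   ((z - real_complex R r) * q.[z]) = (z - real_complex R r)^-1 + q^`().[z] / q.[z].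
  rewrite derivM !poly.derivE !hornerE; field.
  by rewrite IH1 zr.
rewrite raddfD /= mulrDr.
have H : complex.Im z * complex.Im ((z - real_complex R r)^-1) < 0.
  case: (z) z0 => a b /= b0; rewrite oppr0 addr0.
  rewrite mulrN oppr_lt0 mulrA -expr2 divr_gt0 //.
    by rewrite exprn_even_gt0 //= b0.
  by rewrite ltr_wpDl ?sqr_ge0 // exprn_even_gt0 //= b0.
apply/leifP; rewrite eqE /=.
by rewrite -[ltRHS]addr0; exact: ltr_leD H (leif_le IH2).
Qed.

(** Gauss-Lucas on the real line: a nonreal root of the derivative would annihilate the logarithmic
    derivative, against its strict sign. Factoring over [R[i]] takes care of multiplicities. *)
Lemma split_real_deriv (R : rcfType) (p : {poly R}) :
  split_real p -> split_real p^`().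
Proof.
case=> c [s ->]; set q := \prod_(z <- s) _.
have [->|c0] := eqVneq c 0.
  by exists 0, [::]; rewrite !scale0r deriv0.
case: (eqVneq s [::]) => [s0|s0].
  by exists 0, [::]; rewrite /q s0 big_nil scale0r derivZ derivC scaler0.
rewrite derivZ; pose Q := map_poly (real_complex R) q.
have [rs Ers] := closed_field_poly_normal (Q^`()).
have rreal z : z \in rs -> complex.Im z = 0.
  move=> zrs; apply/eqP/negPn/negP => z0.
  have [q0 [H1 H2]] := im_log_deriv s z0.
  have rt : root Q^`() z.
    have /rootP rz : root (\prod_(x <- rs) ('X - x%:P)) z by rewrite root_prod_XsubC.
    by rewrite Ers rootE hornerZ rz mulr0.
  move/rootP: rt H1 H2; rewrite -/q -/Q => -> _.
  by rewrite mul0r /= mulr0 eqxx (negPf s0).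
exists (c * complex.Re (lead_coef Q^`())), (map (@complex.Re R) rs).
rewrite -scalerA; congr (_ *: _).
apply: (map_poly_inj (real_complex R)).
rewrite -deriv_map -/Q map_polyZ big_map rmorph_prod /=.
have -> : real_complex R (complex.Re (lead_coef (Q^`()))) = lead_coef Q^`().
  by rewrite /Q deriv_map lead_coef_map /=.
rewrite {1}Ers; congr (_ *: _); apply: eq_big_seq => z zrs.
rewrite rmorphB /= map_polyX map_polyC /=; congr (_ - _%:P).
by have := rreal z zrs; case: (z) => a b /= ->.
Qed.

(** Laguerre's inequality. A further factor ['X - r] turns [q'^2 - q q''] into
    [q^2 + (x - r)^2 (q'^2 - q q'')], so the expression remains a sum of squares. *)
Lemma split_real_laguerre (R : rcfType) (p : {poly R}) x :
  split_real p -> p.[x] * p^`()^`().[x] <= p^`().[x] ^+ 2.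
Proof.
case=> c [s ->]; rewrite !derivZ !hornerZ.
suff : let q := \prod_(z <- s) ('X - z%:P) in
  0 <= q^`().[x] ^+ 2 - q.[x] * q^`()^`().[x].
  move=> /=; set q := \prod_(z <- s) _ => H.
  rewrite -subr_ge0.
  have -> : (c * q^`().[x]) ^+ 2 - c * q.[x] * (c * q^`()^`().[x]) =
     c ^+ 2 * (q^`().[x] ^+ 2 - q.[x] * q^`()^`().[x]) by ring.
  by rewrite mulr_ge0 ?sqr_ge0.
elim: s => [|r s IH] /=; first by rewrite big_nil derivC deriv0 !horner0 mulr0 subr0 sqr_ge0.
rewrite big_cons; set q := \prod_(z <- s) _ in IH *.
have D u : (('X - r%:P) * u)^`() = u + ('X - r%:P) * u^`().
  by rewrite derivM derivB derivX derivC subr0 mul1r.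
rewrite D derivD D !(hornerD, hornerM) hornerX hornerN hornerC.
set a := q.[x] in IH *; set b := q^`().[x] in IH *; set d := q^`()^`().[x] in IH *.
rewrite [leRHS](_ : _ = a ^+ 2 + (x - r) ^+ 2 * (b ^+ 2 - a * d)); last by ring.
by rewrite addr_ge0 ?sqr_ge0 // mulr_ge0 ?sqr_ge0.
Qed.

Lemma scaled_ineq (R : realDomainType) (a b c F G K : R) : 0 < F -> 0 < G ->
  a * F * (c * (K * G * F)) <= (b * (G * F)) ^+ 2 -> K * (a * c) <= G * b ^+ 2.
Proof.
move=> F0 G0 H; rewrite -(ler_pM2l (mulr_gt0 G0 (mulr_gt0 F0 F0))).
have -> : G * (F * F) * (K * (a * c)) = a * F * (c * (K * G * F)) by ring.
by have -> : G * (F * F) * (G * b ^+ 2) = (b * (G * F)) ^+ 2 by ring.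
Qed.

(** Laguerre's inequality at 0 for the [r]-th derivative, whose first Taylor data are [r! p_r],
    [(r+1)! p_(r+1)], [(r+2)! p_(r+2)]. This is weaker than the sharp Newton inequality, but its
    ratio is already strict. *)
Lemma split_real_newton (R : rcfType) (p : {poly R}) r : split_real p ->
  r.+2%:R * (p`_r * p`_r.+2) <= r.+1%:R * p`_r.+1 ^+ 2.
Proof.
move=> sp.
have spd : split_real p^`(r).
  by elim: r => [|r IH]; rewrite ?derivn0 // derivnS; exact: split_real_deriv.
have := split_real_laguerre 0 spd.
rewrite !horner_coef0 !coef_deriv !coef_derivn addn0 addn1 addn2.
rewrite ffactnn !mulr1n -!mulrnA.
have -> : (r.+1 ^_ r = r.+1 * r`!)%N by rewrite -factS -[RHS]ffactnn ffactnSr subSnn muln1.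
have -> : (r.+2 ^_ r * 2 = r.+2 * r.+1 * r`!)%N.
  by rewrite -mulnA -!factS -[RHS]ffactnn !ffactnSr subSnn muln1 (_ : r.+2 - r = 2)%N //; lia.
rewrite -(mulr_natr p`_r) -(mulr_natr p`_r.+1) -(mulr_natr p`_r.+2) !natrM.
by apply: (@scaled_ineq _ _ _ _ (r`!)%:R); rewrite ltr0n ?fact_gt0.
Qed.

(** Coefficient form, to match [sigmaj]. For [j > size s] the truncated subtraction returns the
    constant coefficient up to sign and not 0, hence the bounds on [j] in the lemmas below. *)
Definition elsym (R : rcfType) (s : seq R) (j : nat) : R :=
  (-1) ^+ j * (\prod_(z <- s) ('X - z%:P))`_(size s - j).

(** Strictness sits in a factor [c < 1], because a plain [<] fails when the terms vanish, for
    instance for a sequence of zeros. *)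
Definition strictly_log_concave (R : rcfType) (d : nat) (m : nat -> R) :=
  forall j, (j.+2 <= d)%N ->
    exists2 c, 0 <= c < 1 & m j * m j.+2 <= c * m j.+1 ^+ 2.

Lemma elsym0 (R : rcfType) (s : seq R) : elsym s 0 = 1.
Proof.
have /monicP := monic_prod_XsubC s xpredT id.
by rewrite lead_coefE size_prod_XsubC /elsym subn0 mul1r.
Qed.

Lemma elsym_log_concave (R : rcfType) (s : seq R) : strictly_log_concave (size s) (elsym s).
Proof.
move=> j jd; set p := \prod_(z <- s) ('X - z%:P).
have sp : split_real p by exists 1, s; rewrite scale1r.
have := split_real_newton (size s - j.+2) sp.
rewrite /elsym -/p (_ : (size s - j.+2).+1 = size s - j.+1)%N; last by lia.
rewrite (_ : (size s - j.+1).+1 = size s - j)%N; last by lia.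
set a := p`_(_ - j.+2); set c := p`_(_ - j.+1); set b := p`_(_ - j).
have G0 : 0 < (size s - j)%:R :> R by rewrite ltr0n subn_gt0; lia.
have -> : (size s - j.+1)%:R = (size s - j)%:R - 1 :> R.
  by rewrite -(@natrB _ _ 1%N) ?subn_gt0 //; [congr _%:R; lia|lia].
have : 1 <= (size s - j)%:R :> R by rewrite ler1n subn_gt0; lia.
move: (size s - j)%:R G0 => G G0 G1 H.
(* With [G = size s - j], Newton's inequality at index [size s - j.+2] reads
   [G (a b) <= (G - 1) c^2]. *)
exists ((G - 1) / G).
  by rewrite divr_ge0 ?subr_ge0 ?(ltW G0) //= ltr_pdivrMr // mul1r ltrBlDr ltrDl.
have -> : ((-1) ^+ j.+1 * c) ^+ 2 = c ^+ 2.
  by rewrite exprMn sqrr_sign mul1r.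
have -> : (-1) ^+ j * b * ((-1) ^+ j.+2 * a) = ((-1) ^+ j) ^+ 2 * (a * b).
  by rewrite !exprS; ring.
by rewrite sqrr_sign mul1r mulrAC ler_pdivlMr // mulrC.
Qed.

Lemma elsym_cons (R : rcfType) (a : R) (s : seq R) j : (j < size s)%N ->
  elsym (a :: s) j.+1 = elsym s j.+1 + a * elsym s j.
Proof.
move=> js; rewrite /elsym big_cons /= subSS.
rewrite mulrBl coefB coefXM coefCM !exprS.
case: ifP => [/eqP E|_]; first by lia.
by rewrite (_ : (size s - j).-1 = size s - j.+1)%N; [ring|lia].
Qed.

Section CoefficientsOfProduct.
Variables (R : rcfType) (d k : nat) (a : R) (m s : nat -> R).
Hypotheses (m0 : m 0%N = 1) (Hm : strictly_log_concave d m) (kd : (k <= d)%N).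
Hypothesis Hs : forall j, (j < k)%N -> s j.+1 = m j.+1 + a * m j.
Hypothesis s_gt0 : forall j, (0 < j <= k)%N -> 0 < s j.

(** Removing one entry from a point of [Gamma_k] leaves a point of [Gamma_(k-1)]. If
    [m_j > 0 >= m_(j+1)], then log-concavity gives [m_j s_(j+2) <= m_(j+1) s_(j+1) <= 0], a
    contradiction. *)
Lemma coef_factor_gt0 j : (j < k)%N -> 0 < m j.
Proof.
elim: j => [_|j IH jk]; first by rewrite m0.
have mj := IH (ltnW jk); rewrite ltNge; apply/negP => mj1.
have [c /andP[c0 c1] H] := Hm (leq_trans jk kd).
have s1 := s_gt0 (j := j.+1) (ltnW jk).
have s2 := s_gt0 (j := j.+2) jk.
rewrite Hs in s1; last exact: ltnW.
rewrite Hs in s2 => //.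
have H1 : m j * (m j.+2 + a * m j.+1) > 0 by rewrite mulr_gt0.
have H2 : 0 <= (m j.+1 + a * m j) * (- m j.+1).
  by rewrite mulr_ge0 ?oppr_ge0 // ltW.
have H3 : c * m j.+1 ^+ 2 <= m j.+1 ^+ 2.
  by rewrite ler_piMl ?sqr_ge0 // ltW.
nra.
Qed.

(** If [m] belongs to the entries other than [a], this is the partial derivative of [s j] with
    respect to [a]. *)
Definition shift_seq j := if j is j'.+1 then m j' else 0.

(** Positivity of the numerator of the [a]-derivative of [s_k / s_l]. Substituting
    [s_j = m_j + a m_(j-1)] cancels [a] and leaves [m_(k-1) m_l - m_k m_(l-1)], which is positive
    because the ratios of a strictly log-concave sequence decrease. *)
Lemma coef_factor_cross l : s 0%N = 1 -> (l < k)%N ->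
  0 < shift_seq k * s l - s k * shift_seq l.
Proof.
move=> s0 lk.
have D : forall k', (l <= k')%N -> (k' < k)%N ->
    m k'.+1 * shift_seq l < m k' * m l.
  case: l {lk} => [|l] /= k' lk' k'k.
    by rewrite mulr0 m0 mulr1 coef_factor_gt0.
  elim: k' lk' k'k => [//|k' IH] lk' k'k.
  have [c /andP[c0 c1] H] := Hm (leq_trans k'k kd).
  have m1 := coef_factor_gt0 k'k.
  have ml : 0 < m l by apply: coef_factor_gt0; lia.
  have ml1 : 0 < m l.+1 by apply: coef_factor_gt0; lia.
  have H3 : c * m k'.+1 ^+ 2 < m k'.+1 ^+ 2.
    by rewrite gtr_pMl // exprn_gt0.
  have [E|lk''] := eqVneq l k'; first by subst l; nra.
  have {}IH := IH ltac:(lia) (ltnW k'k).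
  have mk : 0 < m k' by apply: coef_factor_gt0; lia.
  (* The index may be [k] itself, the first one at which the sign of [m] is not controlled. *)
  have [m2|m2] := leP (m k'.+2) 0.
    by apply: le_lt_trans (_ : 0 < _); [rewrite mulr_le0_ge0 // ltW|rewrite mulr_gt0].
  rewrite -(ltr_pM2l mk).
  have : m k' * m k'.+2 * m l < m k'.+1 ^+ 2 * m l.
    by rewrite ltr_pM2r //; apply: le_lt_trans H H3.
  have : m k'.+1 * (m k'.+1 * m l) < m k'.+1 * (m k' * m l.+1) by rewrite ltr_pM2l.
  by nra.
have := D k.-1; case: k lk Hs => [//|k'] lk Hs' /= /(_ lk (leqnn _)).
rewrite Hs' //.
case: l lk {D} => [|l] lk /=; rewrite ?s0 ?m0; first by nra.
rewrite Hs' //; last exact: ltnW.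
by nra.
Qed.

End CoefficientsOfProduct.

(** * Rank-one perturbations of symmetric matrices *)

(** Induction on the size: the first row is [d_0] times a basis vector plus [u_0 v], and the
    determinant is linear in it. No diagonal entry is inverted, so the formula applies to polynomial
    entries. *)
Lemma det_diag_rank1 (K : comNzRingType) n (d : 'rV[K]_n) (u : 'cV[K]_n) (v : 'rV[K]_n) :
  \det (diag_mx d + u *m v) =
  \prod_i d 0 i + \sum_i u i 0 * v 0 i * \prod_(j | j != i) d 0 j.
Proof.
elim: n d u v => [|n IH].
  by move=> d u v; rewrite det_mx00 !big_ord0 addr0.
rewrite -[n.+1]/(1 + n)%N => d u v.
have I0 : 0 = lshift n 0 :> 'I_(1 + n) by exact: val_inj.
have Il (i : 'I_n) : lift 0 i = rshift 1 i :> 'I_(1 + n) by exact: val_inj.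
pose d' := rsubmx d; pose u' := dsubmx u; pose v' := rsubmx v.
pose B : 'M[K]_(1 + n) := block_mx (d 0 0)%:M 0 (u' *m (v 0 0)%:M) (diag_mx d' + u' *m v').
pose C : 'M[K]_(1 + n) := block_mx (v 0 0)%:M v' (u' *m (v 0 0)%:M) (diag_mx d' + u' *m v').
have dE i : d' 0 i = d 0 (rshift 1 i) by rewrite mxE.
have vE i : v' 0 i = v 0 (rshift 1 i) by rewrite mxE.
have uE i : u' i 0 = u (rshift 1 i) 0 by rewrite mxE.
have R0 (b : 'rV[K]_n) (c : K) i j :
    row' 0 (block_mx c%:M b (u' *m (v 0 0)%:M) (diag_mx d' + u' *m v') : 'M[K]_(1 + n)) i j
    = row' 0 (diag_mx d + u *m v) i j.
  rewrite ![row' _ _ _ _]mxE Il.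
  case: (split_ordP j) => {}j ->.
    rewrite [LHS](block_mxEdl c%:M b) !mxE !big_ord1 (ord1 j) -I0 !mxE eqxx mulr1n.
    by rewrite (_ : (_ == _) = false) ?add0r //; apply/negP => /eqP.
  rewrite [LHS](block_mxEdr c%:M b) !mxE !big_ord1 !mxE.
  by rewrite (inj_eq (@rshift_inj _ _)).
have Rl (b : 'rV[K]_n) (c : K) X Y (j : 'I_1) :
  (block_mx c%:M b X Y : 'M[K]_(1 + n)) 0 (lshift n j) = c by rewrite I0 block_mxEul mxE (ord1 j).
have Rr (b : 'rV[K]_n) (c : K) X Y j :
  (block_mx c%:M b X Y : 'M[K]_(1 + n)) 0 (rshift 1 j) = b 0 j by rewrite I0; exact: block_mxEur.
have -> : \det (diag_mx d + u *m v) = 1 * \det B + u 0 0 * \det C.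
  apply: (@determinant_multilinear _ _ _ _ _ 0).
  - apply/rowP => j; rewrite scale1r; transitivity (B 0 j + u 0 0 * C 0 j); last first.
      by rewrite [RHS]mxE [X in _ = X + _]mxE [X in _ = _ + X]mxE [X in _ = _ + _ * X]mxE.
    rewrite mxE /B /C; case: (split_ordP (j : 'I_(1 + n))) => {}j ->.
      by rewrite !Rl !mxE big_ord1 (ord1 j) -I0 ?mxE ?eqxx mulr1n; ring.
    rewrite !Rr !mxE big_ord1 (_ : (_ == _) = false) ?mulr0n ?add0r //.

  - by apply/matrixP => i j; rewrite R0.
  - by apply/matrixP => i j; rewrite R0.
(* The first row of [C] is [v], so subtracting [u'] times it from the other rows removes the
   rank-one part. *)
have -> : C = (block_mx 1%:M 0 u' 1%:M : 'M[K]_(1 + n)) *m block_mx (v 0 0)%:M v' 0 (diag_mx d').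
  by rewrite mulmx_block !mul1mx !mul0mx ?mulmx0 !addr0 addrC.
rewrite det_mulmx /B !det_lblock det_ublock !det1 !mul1r !det_scalar1.
rewrite IH det_diag !big_ord_recl mulrDr -addrA; congr (_ + _).
  congr (_ * _); apply: eq_bigr => i _; rewrite dE Il //.
rewrite [in RHS]addrC; congr (_ + _).
  rewrite big_distrr /=; apply: eq_bigr => i _.
  have -> : \prod_(j | j != lift 0 i) d 0 j =
      d 0 0 * \prod_(j < n | j != i) d' 0 j.
    rewrite big_mkcond [LHS](@big_ord_recl _ _ _ n) /= ?mul1r; congr (_ * _).
    rewrite [RHS]big_mkcond; apply: eq_bigr => j _.
    by rewrite (inj_eq (@lift_inj _ _)) dE Il.
  by rewrite uE vE Il mulrCA.
rewrite mulrA; congr (_ * _).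
rewrite [RHS]big_mkcond [RHS](@big_ord_recl _ _ _ n) /= mul1r; apply: eq_bigr => i _.
by rewrite dE Il.
Qed.

Lemma conjmx_outer (F : fieldType) n (P : 'M[F]_n) (u : 'cV[F]_n) (v : 'rV[F]_n) :
  P \in unitmx -> invmx P *m (P *m u *m (v *m invmx P)) *m P = u *m v.
Proof. by move=> Pu; rewrite -!mulmxA mulKmx // mulVmx // mulmx1. Qed.

Lemma char_poly_conj (K : fieldType) n (P A : 'M[K]_n) : P \in unitmx ->
  char_poly (P *m A *m invmx P) = char_poly A.
Proof.
move=> Pu; rewrite /char_poly /char_poly_mx.
pose L := map_mx (@polyC K).
have -> : 'X%:M - L _ _ (P *m A *m invmx P) = L _ _ P *m ('X%:M - L _ _ A) *m L _ _ (invmx P).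
  rewrite mulmxBr mulmxBl -!map_mxM; congr (_ - _).
  by rewrite scalar_mxC -mulmxA -map_mxM mulmxV // map_mx1 mulmx1.
rewrite !det_mulmx mulrAC -det_mulmx -map_mxM mulmxV // map_mx1 det1 mul1r //.
Qed.

Lemma char_poly_diag_rank1 (K : fieldType) n (d : 'rV[K]_n) (u : 'cV[K]_n) (v : 'rV[K]_n) :
  char_poly (diag_mx d + u *m v) =
  \prod_i ('X - (d 0 i)%:P) - \sum_i (u i 0 * v 0 i) *: \prod_(j | j != i) ('X - (d 0 j)%:P).
Proof.
rewrite /char_poly /char_poly_mx.
have -> : 'X%:M - map_mx (@polyC K) (diag_mx d + u *m v) =
   diag_mx (\row_i ('X - (d 0 i)%:P)) + map_mx (@polyC K) (- u) *m map_mx (@polyC K) v.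
  rewrite -map_mxM mulNmx; apply/matrixP => i j; rewrite !mxE.
  rewrite polyCD rmorphN /=; case: eqP => [->|_]; rewrite ?mulr1n ?mulr0n; first by ring.
  by rewrite polyC0 !add0r.
rewrite det_diag_rank1 -sumrN; congr (_ + _).
  by apply: eq_bigr => i _; rewrite mxE.
apply: eq_bigr => i _; rewrite !mxE -polyCM mul_polyC mulNr scaleNr; congr (- (_ *: _)).
by apply: eq_bigr => j _; rewrite mxE.
Qed.

Lemma normCRe (R : rcfType) (z : R[i]) :
  (z * Num.conj z)  = real_complex R (complex.Re z ^+ 2 + complex.Im z ^+ 2).
Proof. by case: z => a b; rewrite /Num.conj /= /mul /=; congr (_ +i* _)%C; ring. Qed.

Section RealSpectral.
Variables (R : rcfType) (n : nat) (A : 'M[R]_n).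
Hypothesis As : A^T = A.
Let C : numClosedFieldType := R[i].
Local Notation rc := (real_complex R).
Let AC : 'M[C]_n := map_mx rc A.
Let P := spectralmx AC.
Let D := spectral_diag AC.

Let rcreal (x : R) : rc x \is Num.real.
Proof. by rewrite complex_real. Qed.

Let ACherm : AC \is hermsymmx.
Proof.
apply: realsym_hermsym.
  apply/is_hermitianmxP; rewrite expr0 scale1r.
  by apply/matrixP => i j; rewrite !mxE /=; have := congr1 (fun M : 'M[R]_n => M j i) As; rewrite mxE => ->.
by apply/mxOverP => i j; rewrite mxE rcreal.
Qed.

Let ACE : AC = invmx P *m diag_mx D *m P.
Proof. exact/orthomx_spectralP/hermitian_normalmx. Qed.

Let Dreal i : rc (complex.Re (D 0 i)) = D 0 i.
Proof.
by have /mxOverP /(_ 0 i) /RRe_real := hermitian_spectral_diag_real ACherm.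
Qed.

(** Complexify and diagonalise by a unitary matrix. There [v^T v] becomes [x x^*], the weights are
    [w_i = |x_i|^2], and the determinant formula is affine in [t]. *)
Lemma sym_rank1_char_poly (v : 'rV[R]_n) : exists lam w : 'I_n -> R,
  [/\ forall i, 0 <= w i, \sum_i w i = (v *m v^T) 0 0 &
   forall t, char_poly (A + t *: (v^T *m v)) =
     \prod_i ('X - (lam i)%:P) - t *: \sum_i w i *: \prod_(j | j != i) ('X - (lam j)%:P)].
Proof.
pose vC := map_mx rc v; pose x := P *m vC^T.
have Pu : P \in unitmx by exact: spectral_unit.
have PU : P \is unitarymx by exact: spectral_unitarymx.
have xE : vC *m invmx P = map_mx Num.conj x^T.
  rewrite invmx_unitary // /x trmx_mul map_mxM trmxK; congr (_ *m _).
  by apply/matrixP => i j; rewrite !mxE; symmetry; exact: (conj_Creal (rcreal _)).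
exists (fun i => complex.Re (D 0 i)), (fun i => complex.Re (x i 0) ^+ 2 + complex.Im (x i 0) ^+ 2).
split=> [i||t]; first by rewrite addr_ge0 ?sqr_ge0.
  apply: (fmorph_inj rc); rewrite rmorph_sum /=.
  transitivity ((vC *m vC^T) 0 0); last by rewrite /vC map_trmx -map_mxM mxE.
  have -> : vC *m vC^T = (vC *m invmx P) *m x by rewrite -mulmxA mulKmx.
  rewrite xE !mxE; apply: eq_bigr => i _.
  by rewrite !mxE mulrC normCRe.
apply: (map_poly_inj rc); rewrite map_char_poly.
have -> : map_mx rc (A + t *: (v^T *m v)) =
   invmx P *m (diag_mx D + (rc t *: x) *m (vC *m invmx P)) *m invmx (invmx P).
  rewrite invmxK mulmxDr mulmxDl -ACE map_mxD map_mxZ map_mxM; congr (_ + _).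
  rewrite -scalemxAl -scalemxAr -scalemxAl; congr (_ *: _).
  by rewrite /x (conjmx_outer _ _ Pu) /vC map_trmx.
rewrite char_poly_conj ?unitmx_inv // char_poly_diag_rank1 rmorphB /=; congr (_ - _).
  rewrite rmorph_prod /=; apply: eq_bigr => i _.
  by rewrite rmorphB /= map_polyX map_polyC /= Dreal.
rewrite map_polyZ rmorph_sum scaler_sumr; apply: eq_bigr => i _ /=.
rewrite map_polyZ scalerA xE !mxE -mulrA; congr (_ *: _).
  by congr (_ * _); exact: normCRe.
rewrite rmorph_prod /=; apply: eq_bigr => j _.
by rewrite rmorphB /= map_polyX map_polyC /= Dreal.
Qed.

(** The real part of the complex spectral decomposition: an eigenvector [a + i b] contributes
    [d (a^T a + b^T b)]. Its eigenvalue is [a A a^T + b A b^T], so nonnegativity on real vectors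
    suffices. *)
Lemma psd_sum_rank1 : (forall v : 'rV[R]_n, 0 <= (v *m A *m v^T) 0 0) ->
  exists s : seq 'rV[R]_n, A = \sum_(v <- s) v^T *m v.
Proof.
move=> Apsd.
have Pu : P \in unitmx by exact: spectral_unit.
have PU : P \is unitarymx by exact: spectral_unitarymx.
have invP : invmx P = map_mx Num.conj P^T by rewrite invmx_unitary.
pose a i := map_mx (@complex.Re R) (row i P).
pose b i := map_mx (@complex.Im R) (row i P).
pose d i := complex.Re (D 0 i).
have AE i j : A i j = \sum_k d k * (a k 0 i * a k 0 j + b k 0 i * b k 0 j).
  have : rc (A i j) = \sum_k rc (d k) * (Num.conj (P k i) * P k j).
    have -> : rc (A i j) = AC i j by rewrite mxE.
    rewrite ACE invP mxE; apply: eq_bigr => k _.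
    rewrite mul_mx_diag !mxE /d Dreal; ring.
  move/(congr1 (@complex.Re R)); rewrite /= => ->.
  rewrite raddf_sum; apply: eq_bigr => k _ /=; rewrite !mxE.
  by case: (P k i) => ? ?; case: (P k j) => ? ?; rewrite /= mul0r subr0; congr (_ * _); ring.
have d0 k : 0 <= d k.
  have : d k = (a k *m A *m (a k)^T) 0 0 + (b k *m A *m (b k)^T) 0 0.
    have DE : D 0 k = (P *m AC *m invmx P) k k.
      by rewrite ACE !mulmxA mulmxV // mul1mx mulmxK // !mxE eqxx mulr1n.
    have := congr1 (@complex.Re R) DE; rewrite -/(d k) => ->.
    rewrite invP !mxE raddf_sum -big_split /=; apply: eq_bigr => j _.
    rewrite !mxE !big_distrl /= raddf_sum -big_split /=; apply: eq_bigr => i _.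
    rewrite !mxE; case: (P k i) => ? ?; case: (P k j) => ? ? /=.
    by rewrite /=; ring.
  by move=> ->; rewrite addr_ge0.
exists ([seq Num.sqrt (d k) *: a k | k <- index_enum 'I_n] ++ [seq Num.sqrt (d k) *: b k | k <- index_enum 'I_n]).
rewrite big_cat /= !big_map -big_split /=.
apply/matrixP => i j; rewrite AE summxE; apply: eq_bigr => k _.
rewrite !linearZ /= -!scalemxAl !scalerA -expr2 sqr_sqrtr // !mxE !big_ord1 !mxE; ring.
Qed.
End RealSpectral.

(** * Monotonicity of the quotient of elementary symmetric functions *)

Definition quad (R : realType) N (A : 'M[R]_N) (v : 'rV[R]_N) : R := (v *m A *m v^T) 0 0.

Lemma quadD (R : realType) N (A B : 'M[R]_N) v : quad (A + B) v = quad A v + quad B v.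
Proof. by rewrite /quad mulmxDr mulmxDl mxE. Qed.

Lemma quadZ (R : realType) N c (A : 'M[R]_N) v : quad (c *: A) v = c * quad A v.
Proof. by rewrite /quad -scalemxAr -scalemxAl mxE. Qed.

Lemma quad_rank1 (R : realType) N (m v : 'rV[R]_N) :
  quad (m^T *m m) v = (v *m m^T) 0 0 ^+ 2.
Proof.
rewrite /quad mulmxA -mulmxA -[m *m _]trmxK trmx_mul trmxK mxE big_ord1 expr2.
by congr (_ * _); rewrite mxE.
Qed.

Section Garding.
Variables (R : realType) (N : nat).
Implicit Types (A B : 'M[R]_N) (v : 'rV[R]_N).

Definition garding k A := forall j, (0 < j <= k)%N -> 0 < sigmaj j A.

(** For symmetric [A] this finite increment is also the exact derivative in the direction [v^T v],
    since [sigma_j] is affine along it. *)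
Definition dsig j A v := sigmaj j (A + v^T *m v) - sigmaj j A.

Lemma sigmaj0 A : sigmaj 0 A = 1.
Proof.
rewrite /sigmaj mul1r subn0; have /monicP := char_poly_monic A.
by rewrite lead_coefE size_char_poly.
Qed.

Lemma garding_gt0 k A j : garding k A -> (j <= k)%N -> 0 < sigmaj j A.
Proof. by move=> gA; case: j => [|j] jk; rewrite ?sigmaj0 // gA. Qed.

(** The derivative of [sigma_j] in a rank-one direction is the weighted mean of the [sigma_(j-1)] of
    the spectrum with one eigenvalue removed. Sign questions about matrices thereby become
    statements about sequences. *)
Lemma sigmaj_rank1 A v : A^T = A -> exists (w : 'I_N -> R) (a : 'I_N -> R) (s : 'I_N -> seq R),
  [/\ forall i, 0 <= w i, \sum_i w i = (v *m v^T) 0 0, forall i, size (s i) = N.-1,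
   forall i j, sigmaj j A = elsym (a i :: s i) j &
   forall t j, sigmaj j (A + t *: (v^T *m v)) =
     sigmaj j A + t * \sum_i w i * shift_seq (elsym (s i)) j].
Proof.
move=> As; have [lam [w [w0 ws H]]] := sym_rank1_char_poly As v.
pose s i := [seq lam j | j <- index_enum 'I_N & j != i].
have sE i : \prod_(j | j != i) ('X - (lam j)%:P) = \prod_(z <- s i) ('X - z%:P).
  by rewrite big_map big_filter.
have A0 : char_poly A = \prod_i ('X - (lam i)%:P).
  by have := H 0; rewrite !scale0r addr0 subr0.
have ss i : size (s i) = N.-1.
  rewrite size_map size_filter -sum1_count; transitivity #|predC1 i|; last by rewrite cardC1 card_ord.
  by rewrite -sum1_card.
have sA i j : sigmaj j A = elsym (lam i :: s i) j.
  rewrite /sigmaj /elsym A0 (bigD1 i) //= big_cons sE; congr (_ * _`__).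
  by rewrite ss prednK // (leq_ltn_trans _ (ltn_ord i)).
exists w, lam, s; split => // t j.
rewrite {1}/sigmaj H -A0 coefB mulrBr -/(sigmaj j A); congr (_ + _).
rewrite coefZ coef_sum mulrCA -mulrN; congr (_ * _).
rewrite mulr_sumr -sumrN; apply: eq_bigr => i _.
rewrite coefZ sE mulrCA -mulrN; congr (_ * _).
case: j => [|j] /=.
  rewrite subn0 nth_default ?mulr0 ?oppr0 // size_prod_XsubC ss.
  by rewrite prednK // (leq_ltn_trans _ (ltn_ord i)).
rewrite exprS mulN1r mulNr opprK /elsym ss; congr (_ * _`__).
by lia.
Qed.

Lemma sigmaj_rank1_lin A v t j : A^T = A ->
  sigmaj j (A + t *: (v^T *m v)) = sigmaj j A + t * dsig j A v.
Proof.
move=> As; have [w [a [s [_ _ _ _ H]]]] := sigmaj_rank1 v As.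
by rewrite /dsig -{2}[v^T *m v]scale1r !H; ring.
Qed.

Lemma sum_weights_gt0 (w : 'I_N -> R) (x : 'I_N -> R) :
  (forall i, 0 <= w i) -> 0 < \sum_i w i -> (forall i, 0 < x i) -> 0 < \sum_i w i * x i.
Proof.
move=> w0 sw x0; rewrite lt0r sumr_ge0 ?andbT => [|i _]; last first.
  by rewrite mulr_ge0 // ltW.
rewrite psumr_neq0 => [|i _]; last by rewrite mulr_ge0 // ltW.
apply/hasP; move: sw; rewrite lt0r psumr_neq0 // => /andP[/hasP[i i1 /= i0] _].
by exists i => //=; rewrite mulr_gt0.
Qed.

Lemma dotmx_gt0 v : v != 0 -> 0 < (v *m v^T) 0 0.
Proof.
move=> v0; rewrite mxE.
under eq_bigr do rewrite mxE -expr2.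
rewrite lt0r sumr_ge0 ?andbT => [|i _]; last by rewrite sqr_ge0.
rewrite psumr_neq0 => [|i _]; last by rewrite sqr_ge0.
have [i i0] : exists i, v 0 i != 0.
  by apply/existsP; apply: contraNT v0 => /existsPn H; apply/eqP/rowP => i;
    rewrite mxE; apply/eqP/negPn/H.
by apply/hasP; exists i; rewrite ?mem_index_enum //= exprn_even_gt0.
Qed.

(** The bound [k < N] keeps the needed indices within the [N - 1] remaining eigenvalues. It holds in
    the application because the ambient matrix has size [n + 1] and [k <= n]. *)
Lemma dsig_gt0 k A v j : A^T = A -> garding k A -> (k < N)%N -> v != 0 ->
  (0 < j <= k)%N -> 0 < dsig j A v.
Proof.
move=> As gA kN v0 /andP[j0 jk].
have [w [a [s [w0 ws ss sA H]]]] := sigmaj_rank1 v As.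
have := H 1 j; rewrite scale1r mul1r /dsig => ->; rewrite addrC addKr.
apply: sum_weights_gt0 => // [|i]; first by rewrite ws dotmx_gt0.
case: j j0 jk {H} => [//|j] _ jk /=.
apply: (@coef_factor_gt0 _ N.-1 k (a i) _ (fun j => sigmaj j A)) => //.
- exact: elsym0.
- by rewrite -(ss i); exact: elsym_log_concave.
- by lia.
- by move=> j' j'k; rewrite (sA i) elsym_cons // ss; lia.
Qed.

Lemma dsig_cross_gt0 k l A v : A^T = A -> garding k A -> (k < N)%N -> v != 0 ->
  (l < k)%N -> 0 < dsig k A v * sigmaj l A - sigmaj k A * dsig l A v.
Proof.
move=> As gA kN v0 lk.
have [w [a [s [w0 ws ss sA H]]]] := sigmaj_rank1 v As.
have E j : dsig j A v = \sum_i w i * shift_seq (elsym (s i)) j.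
  by have := H 1 j; rewrite scale1r mul1r /dsig => ->; rewrite addrC addKr.
rewrite !E mulr_suml mulr_sumr -sumrB.
under eq_bigr do rewrite -mulrA (mulrCA (sigmaj k A)) -mulrBr.
apply: sum_weights_gt0 => // [|i]; first by rewrite ws dotmx_gt0.
apply: (@coef_factor_cross _ N.-1 k (a i) _ (fun j => sigmaj j A)) => //.
- exact: elsym0.
- by rewrite -(ss i); exact: elsym_log_concave.
- by lia.
- by move=> j' j'k; rewrite (sA i) elsym_cons // ss; lia.
- exact: sigmaj0.
Qed.

(** Write [B - A] as a sum of rank-one squares and add them one at a time; each keeps the matrix in
    [Gamma_k] and does not lower the quotient. Convexity of the cone is thereby avoided. *)
Lemma garding_mono k l A B : A^T = A -> B^T = B -> garding k A -> (k < N)%N -> (l < k)%N ->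
  (forall v, quad A v <= quad B v) ->
  garding k B /\ sigmaj k A / sigmaj l A <= sigmaj k B / sigmaj l B.
Proof.
move=> As Bs gA kN lk AB.
have [s Es] : exists s : seq 'rV_N, B - A = \sum_(v <- s) v^T *m v.
  apply: psd_sum_rank1; first by rewrite linearB /= As Bs.
  by move=> v; rewrite -[leRHS]/(quad (B - A) v) quadD -scaleN1r quadZ mulN1r subr_ge0.
have -> : B = A + \sum_(v <- s) v^T *m v by rewrite -Es addrC subrK.
elim: s A As gA {B Bs AB Es} => [|v s IH] A As gA.
  by rewrite big_nil addr0.
rewrite big_cons addrA.
have [->|v0] := eqVneq v 0; first by rewrite trmx0 mul0mx addr0; exact: IH.
have As' : (A + v^T *m v)^T = A + v^T *m v by rewrite linearD /= trmx_mul trmxK As.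
have D j : sigmaj j (A + v^T *m v) = sigmaj j A + dsig j A v.
  by rewrite /dsig [RHS]addrC subrK.
have gA' : garding k (A + v^T *m v).
  by move=> j jk; rewrite D addr_gt0 ?gA // (dsig_gt0 As gA).
have [g' le'] := IH _ As' gA'; split => //; apply: le_trans le'.
have l1 := garding_gt0 gA (ltnW lk); have l2 := garding_gt0 gA' (ltnW lk).
rewrite ler_pdivrMr // mulrAC ler_pdivlMr // !D.
by have := dsig_cross_gt0 As gA kN v0 lk; nra.
Qed.

End Garding.

(** * Continuity of [sigma_j] in the matrix entries *)

Section CvgSigma.
Variables (R : realType) (T : Type) (F : set_system T).
Context {FF : Filter F}.

Lemma cvg_big_sum (I : Type) (s : seq I) (P : pred I) (f : I -> T -> R) (l : I -> R) :
  (forall i, P i -> f i x @[x --> F] --> l i) ->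
  (\sum_(i <- s | P i) f i x) @[x --> F] --> \sum_(i <- s | P i) l i.
Proof.
move=> H; elim: s => [|i s IH].
  by under eq_fun do rewrite big_nil; rewrite big_nil; exact: cvg_cst.
under eq_fun do rewrite big_cons; rewrite big_cons.
case Pi : (P i) => //; apply: cvgD => //; exact: H.
Qed.

Definition mx_cvg m n (A : T -> 'M[R]_(m, n)) (A0 : 'M[R]_(m, n)) :=
  forall i j, A x i j @[x --> F] --> A0 i j.

Lemma mx_cvg_cst m n (A : 'M[R]_(m, n)) : mx_cvg (fun=> A) A.
Proof. by move=> i j; exact: cvg_cst. Qed.

Lemma mx_cvgD m n A A0 B B0 : @mx_cvg m n A A0 -> mx_cvg B B0 ->
  mx_cvg (fun x => A x + B x) (A0 + B0).
Proof.
move=> HA HB i j; under eq_fun do rewrite mxE; rewrite mxE.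
exact: cvgD (HA i j) (HB i j).
Qed.

Lemma mx_cvgZ m n (c : T -> R) (c0 : R) A A0 : c x @[x --> F] --> c0 -> @mx_cvg m n A A0 ->
  mx_cvg (fun x => c x *: A x) (c0 *: A0).
Proof.
move=> Hc HA i j; under eq_fun do rewrite mxE; rewrite mxE.
exact: cvgM Hc (HA i j).
Qed.

Lemma mx_cvgM m n p A A0 B B0 : @mx_cvg m n A A0 -> @mx_cvg n p B B0 ->
  mx_cvg (fun x => A x *m B x) (A0 *m B0).
Proof.
move=> HA HB i j; under eq_fun do rewrite mxE; rewrite mxE.
by apply: cvg_big_sum => k _; exact: cvgM (HA i k) (HB k j).
Qed.

Lemma mx_cvgT m n A A0 : @mx_cvg m n A A0 -> mx_cvg (fun x => (A x)^T) A0^T.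
Proof. by move=> HA i j; under eq_fun do rewrite mxE; rewrite mxE; exact: HA. Qed.

Let poly_cvg (P : T -> {poly R}) (Q : {poly R}) := forall i, (P x)`_i @[x --> F] --> Q`_i.

Let poly_cvgM P P0 Q Q0 : poly_cvg P P0 -> poly_cvg Q Q0 ->
  poly_cvg (fun x => P x * Q x) (P0 * Q0).
Proof.
move=> HP HQ i; under eq_fun do rewrite coefM; rewrite coefM.
by apply: cvg_big_sum => j _; exact: cvgM (HP j) (HQ _).
Qed.

Lemma sigmaj_cvg n j (A : T -> 'M[R]_n) A0 : mx_cvg A A0 ->
  sigmaj j (A x) @[x --> F] --> sigmaj j A0.
Proof.
move=> HA; apply: cvgM; first exact: cvg_cst.
suff : poly_cvg (fun x => char_poly (A x)) (char_poly A0) by exact.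
have H s : poly_cvg (fun x => \prod_i char_poly_mx (A x) i (s i))
    (\prod_i char_poly_mx A0 i (s i)).
  elim: (index_enum _) => [|i r IH] k.
    by under eq_fun do rewrite big_nil; rewrite big_nil; exact: cvg_cst.
  under eq_fun do rewrite big_cons; rewrite big_cons.
  move: k; apply: poly_cvgM => // k.
  under eq_fun do rewrite !mxE coefB coefC.
  rewrite !mxE coefB coefC; apply: cvgB; first exact: cvg_cst.
  by case: eqP => _; [exact: HA | exact: cvg_cst].
move=> k; rewrite /char_poly /determinant.
under eq_fun do rewrite coef_sum.
rewrite coef_sum; apply: cvg_big_sum => s _.
by move: k; apply: poly_cvgM => // k; exact: cvg_cst.
Qed.

Lemma dsig_cvg n j (A : T -> 'M[R]_n) A0 v v0 : mx_cvg A A0 -> mx_cvg v v0 ->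
  dsig j (A x) (v x) @[x --> F] --> dsig j A0 v0.
Proof.
move=> HA Hv; apply: cvgB; apply: sigmaj_cvg => //.
by apply: mx_cvgD => //; apply: mx_cvgM => //; exact: mx_cvgT.
Qed.

End CvgSigma.

(** * Local ellipticity on a level set *)

Section Ellipticity.
Variables (R : realType) (N k l : nat) (c0 : R).
Hypotheses (kN : (k < N)%N) (lk : (l < k)%N).

(** The difference quotient of [sigma_j] when [r] times all the rank-one terms is added to [B],
    computed by telescoping. It depends continuously on [r] down to [r = 0]. *)
Fixpoint dsig_seq j (B : 'M[R]_N) (r : R) (s : seq 'rV[R]_N) : R :=
  if s is v :: s' then dsig j B v + dsig_seq j (B + r *: (v^T *m v)) r s' else 0.

Lemma sigmaj_sum_rank1 j (B : 'M[R]_N) r s : B^T = B ->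
  sigmaj j (B + r *: \sum_(v <- s) v^T *m v) = sigmaj j B + r * dsig_seq j B r s.
Proof.
elim: s B => [|v s IH] B Bs; first by rewrite big_nil scaler0 !addr0 mulr0 addr0.
rewrite big_cons scalerDr addrA IH; last first.
  by rewrite linearD linearZ /= trmx_mul trmxK Bs.
by rewrite sigmaj_rank1_lin //=; ring.
Qed.

Lemma dsig_seq_cvg (T : Type) (F : set_system T) {FF : Filter F} j (B : T -> _) B0 (r : T -> R) (r0 : R) s :
  mx_cvg F B B0 -> r x @[x --> F] --> r0 ->
  dsig_seq j (B x) (r x) s @[x --> F] --> dsig_seq j B0 r0 s.
Proof.
elim: s B B0 => [|v s IH] B B0 HB Hr /=; first exact: cvg_cst.
apply: cvgD; first by apply: dsig_cvg => //; exact: mx_cvg_cst.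
by apply: IH => //; apply: mx_cvgD => //; apply: mx_cvgZ => //; exact: mx_cvg_cst.
Qed.

Lemma sum_unit_rank1 : exists s : seq 'rV[R]_N, \sum_(v <- s) v^T *m v = 1%:M.
Proof.
exists [seq delta_mx 0 i | i <- index_enum 'I_N]; rewrite big_map mx1_sum_delta.
by apply: eq_bigr => i _; rewrite trmx_delta mul_delta_mx.
Qed.

Definition level (A : 'M[R]_N) := [/\ A^T = A, garding k A & sigmaj k A = c0 * sigmaj l A].

Lemma local_ellipticity (T : Type) (F : set_system T) {FF : Filter F}
    (A B : T -> 'M[R]_N) (m : T -> 'rV[R]_N) (A0 B0 : 'M[R]_N) (m0 : 'rV[R]_N) :
  mx_cvg F A A0 -> mx_cvg F B B0 -> mx_cvg F m m0 -> m0 != 0 ->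
  level A0 -> level B0 -> (\forall x \near F, level (A x) /\ level (B x)) ->
  exists2 eta : R, 0 < eta & exists2 e0 : R, 0 < e0 & \forall x \near F,
    forall e : R, 0 < e < e0 ->
    ~ (forall v : 'rV[R]_N, e * ((v *m (m x)^T) 0 0 ^+ 2 - eta * (v *m v^T) 0 0) <=
        quad (B x) v - quad (A x) v).
Proof.
(* Under the negated inequality [A + e m^T m <= B + e eta I], and [A], [B] lie on the same
   level set of the monotone quotient; the first-order gain [dd] of the rank-one term
   exceeds the gain [eta qq] of the scalar one once [eta] is small. *)
have aux1 (a b c d e eta : R) : e * (c - eta * d) <= b - a -> a + e * c <= b + e * eta * d by lra.
have aux2 (a b d q e eta : R) : (c0 * a + e * d) * b <= (c0 * b + e * eta * q) * a ->
  e * (d * b) <= e * (eta * q * a) by lra.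
move=> HA HB Hm m00 [A0s gA0 EA0] [B0s gB0 EB0] HAB.
have [s Es] := sum_unit_rank1.
(* Limits are taken jointly in the point and in [e], so that one threshold [e0] serves all nearby
   points. *)
pose G := filter_prod F (nbhs (0 : R)).
have FG : Filter G by exact: filter_prod_filter.
have c1 : (fun z : T * R => z.1) @ G --> F by exact: cvg_fst.
have c2 : (fun z : T * R => z.2) @ G --> (0 : R) by exact: cvg_snd.
have HA' : mx_cvg G (fun z => A z.1) A0 by move=> i j; exact: cvg_comp c1 (HA i j).
have HB' : mx_cvg G (fun z => B z.1) B0 by move=> i j; exact: cvg_comp c1 (HB i j).
have Hm' : mx_cvg G (fun z => m z.1) m0 by move=> i j; exact: cvg_comp c1 (Hm i j).
pose dd (A : 'M[R]_N) (v : 'rV[R]_N) := dsig k A v - c0 * dsig l A v.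
pose qq (B : 'M[R]_N) (r : R) := dsig_seq k B r s - c0 * dsig_seq l B r s.
have lA0 := garding_gt0 gA0 (ltnW lk); have lB0 := garding_gt0 gB0 (ltnW lk).
have dd0 : 0 < dd A0 m0.
  have := dsig_cross_gt0 A0s gA0 kN m00 lk; rewrite EA0 /dd.
  by rewrite mulrAC -mulrBl pmulr_lgt0.
(* Chosen so that the scalar term uses up at most half of the limiting rank-one gain; the [+ 1]
   guards against [qq B0 0 = 0]. *)
pose eta := dd A0 m0 * sigmaj l B0 / (2 * (`|qq B0 0| + 1) * sigmaj l A0).
have q1 : 0 < `|qq B0 0| + 1 by rewrite ltr_pwDr.
have eta0 : 0 < eta by apply: divr_gt0; [exact: mulr_gt0|apply: mulr_gt0 => //; exact: mulr_gt0].
exists eta => //.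
pose A' (z : T * R) := A z.1 + z.2 *: ((m z.1)^T *m m z.1).
pose B' (z : T * R) := B z.1 + (z.2 * eta) *: \sum_(v <- s) v^T *m v.
have cA' : mx_cvg G A' A0.
  suff : mx_cvg G A' (A0 + 0 *: (m0^T *m m0)) by rewrite scale0r addr0.
  apply: mx_cvgD => //; apply: mx_cvgZ => //; apply: mx_cvgM => //; exact: mx_cvgT.
have ce : (fun z : T * R => z.2 * eta) @ G --> (0 : R).
  by rewrite -[X in _ --> X](mul0r eta); apply: cvgM c2 _; exact: cvg_cst.
have cB' : mx_cvg G B' B0.
  suff : mx_cvg G B' (B0 + 0 *: \sum_(v <- s) v^T *m v) by rewrite scale0r addr0.
  apply: mx_cvgD => //; apply: mx_cvgZ => //; exact: mx_cvg_cst.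
(* Cross-multiplying the two quotients and using the level equations, the terms with [c0] cancel and
   a factor [e] comes out. What is left is [Th <= 0], so a positive limit of [Th] is the
   contradiction. *)
pose Th (z : T * R) := dd (A z.1) (m z.1) * sigmaj l (B' z) - eta * qq (B z.1) (z.2 * eta) * sigmaj l (A' z).
have cTh : Th @ G --> dd A0 m0 * sigmaj l B0 - eta * qq B0 0 * sigmaj l A0.
  have cst (c : R) : (fun=> c) @ G --> c by exact: cvg_cst.
  apply: cvgB; apply: cvgM.
  - by apply: cvgB; [exact: dsig_cvg|apply: cvgM => //; exact: dsig_cvg].
  - exact: sigmaj_cvg.
  - apply: cvgM => //; apply: cvgB; first exact: dsig_seq_cvg.
    by apply: cvgM => //; exact: dsig_seq_cvg.
  - exact: sigmaj_cvg.
have Th0 : 0 < dd A0 m0 * sigmaj l B0 - eta * qq B0 0 * sigmaj l A0.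
  rewrite subr_gt0; apply: (@le_lt_trans _ _ (eta * (`|qq B0 0| + 1) * sigmaj l A0)).
    rewrite ler_wpM2r ?(ltW lA0) // ler_wpM2l ?(ltW eta0) //.
    by rewrite (le_trans (ler_norm _)) // lerDl.
  have -> : eta * (`|qq B0 0| + 1) * sigmaj l A0 = dd A0 m0 * sigmaj l B0 / 2.
    by rewrite /eta; field; rewrite !gt_eqF.
  have : 0 < dd A0 m0 * sigmaj l B0 by exact: mulr_gt0.
  by move: (_ * _) => y; lra.
have [[P Q] /= [FP /nbhs_ballP[e0 /= e00 e0Q]] PQ] := cvgr_gt _ cTh _ Th0.
exists e0 => //; near=> x => e /andP[e1 e2] H.
have Px : P x by near: x.
have [[As gA EA] [Bs gB EB]] : level (A x) /\ level (B x) by near: x.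
have /= := PQ (x, e); rewrite /Th /=.
have Qe : Q e by apply: e0Q; rewrite /ball /= sub0r normrN gtr0_norm.
move=> /(_ (conj Px Qe)).
set A1 := A' (x, e); set B1 := B' (x, e).
have A1s : A1^T = A1 by rewrite /A1 /A' linearD linearZ /= trmx_mul trmxK As.
have B1s : B1^T = B1 by rewrite /B1 /B' linearD linearZ /= Es trmx1 Bs.
have E1 j : sigmaj j A1 = sigmaj j (A x) + e * dsig j (A x) (m x).
  exact: sigmaj_rank1_lin.
have E2 j : sigmaj j B1 = sigmaj j (B x) + e * eta * dsig_seq j (B x) (e * eta) s.
  exact: sigmaj_sum_rank1.
have gA1 : garding k A1.
  move=> j /andP[j0 jk]; rewrite E1.
  have [->|mx0] := eqVneq (m x) 0.
    by rewrite /dsig trmx0 mul0mx addr0 subrr mulr0 addr0 gA // j0.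
  by apply: addr_gt0; [|apply: mulr_gt0 => //; apply: dsig_gt0 As gA _ _ _ => //]; rewrite ?gA ?j0.
have AB1 v : quad A1 v <= quad B1 v.
  have := H v; rewrite /A1 /B1 /A' /B' /= Es !quadD !quadZ quad_rank1.
  have -> : quad 1%:M v = (v *m v^T) 0 0 by rewrite /quad mulmx1.
  exact: aux1.
have [gB1 le] := garding_mono A1s B1s gA1 kN lk AB1.
have a1 := garding_gt0 gA1 (ltnW lk); have b1 := garding_gt0 gB1 (ltnW lk).
move: le; rewrite ler_pdivrMr // mulrAC ler_pdivlMr // => le.
rewrite subr_gt0; apply/negP; rewrite -leNgt.
have F1 : sigmaj k A1 = c0 * sigmaj l A1 + e * dd (A x) (m x).
  by rewrite !E1 EA /dd; ring.
have F2 : sigmaj k B1 = c0 * sigmaj l B1 + e * eta * qq (B x) (e * eta).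
  by rewrite !E2 EB /qq; ring.
rewrite F1 F2 in le.
rewrite -(ler_pM2l e1); exact: aux2 le.
Unshelve. all: by end_near.
Qed.

End Ellipticity.

(** * Second-order expansions along curves *)

Section Jets.
Variable R : realType.
Implicit Types (f g : R -> R) (a b c : R).

(** [b] and [c] are the first two derivatives at 0. The second is asked only at the point itself,
    which is all that a C^2 function composed with a curve has to supply. *)
Definition jet f b c := exists2 f1 : R -> R,
  (\forall s \near (0 : R), is_derive s (1 : R) f (f1 s)) & f1 0 = b /\ is_derive (0 : R) (1 : R) f1 c.

Lemma is_derive_continuous f b s : is_derive s (1 : R) f b -> {for s, continuous f}.
Proof. by case=> + _ => /derivable1_diffP /differentiable_continuous. Qed.

Lemma jet_continuous f b c : jet f b c -> {for 0, continuous f}.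
Proof. by case=> f1 /nbhs_singleton /is_derive_continuous. Qed.

Lemma jet_eq f b c b' c' : jet f b c -> b = b' -> c = c' -> jet f b' c'.
Proof. by move=> ? <- <-. Qed.

Lemma jet_cst a : jet (fun=> a) 0 0.
Proof.
exists (fun=> 0); last by split=> //; exact: is_derive_cst.
by apply: (@filterE _ (nbhs (0 : R))) => s; exact: is_derive_cst.
Qed.

Lemma jetD f b c g b' c' : jet f b c -> jet g b' c' ->
  jet (fun s => f s + g s) (b + b') (c + c').
Proof.
move=> [f1 nf [<- df]] [g1 ng [<- dg]]; exists (fun s => f1 s + g1 s).
  by apply: filterS2 nf ng => s Hf Hg; exact: is_deriveD.
by split=> //; exact: is_deriveD.
Qed.

Lemma jetM f b c g b' c' : jet f b c -> jet g b' c' ->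
  jet (fun s => f s * g s) (b * g 0 + f 0 * b') (c * g 0 + 2 * (b * b') + f 0 * c').
Proof.
move=> [f1 nf [<- df]] [g1 ng [<- dg]]; exists (fun s => f1 s * g s + f s * g1 s).
  apply: filterS2 nf ng => s Hf Hg.
  by apply: is_derive_eq (is_deriveM Hf Hg) _; rewrite /GRing.scale /=; ring.
split=> //; have f0 := nbhs_singleton nf; have g0 := nbhs_singleton ng.
apply: is_derive_eq (is_deriveD (is_deriveM df g0) (is_deriveM f0 dg)) _.
by rewrite /GRing.scale /=; ring.
Qed.

Lemma jetZ a g b' c' : jet g b' c' -> jet (fun s => a * g s) (a * b') (a * c').
Proof.
by move=> H; apply: jet_eq (jetM (jet_cst a) H) _ _; ring.
Qed.

Lemma jetN g b' c' : jet g b' c' -> jet (fun s => - g s) (- b') (- c').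
Proof.
move=> H; have := jetZ (-1) H; rewrite !mulN1r.
by congr jet; apply/funext => s; rewrite mulN1r.
Qed.

Lemma jetB f b c g b' c' : jet f b c -> jet g b' c' ->
  jet (fun s => f s - g s) (b - b') (c - c').
Proof. by move=> Hf Hg; apply: jetD => //; exact: jetN. Qed.

Lemma jetV f b c : f 0 != 0 -> jet f b c ->
  jet (fun s => (f s)^-1) (- b / f 0 ^+ 2) (2 * b ^+ 2 / f 0 ^+ 3 - c / f 0 ^+ 2).
Proof.
move=> f0 Jf; have cf := jet_continuous Jf; move: Jf => [f1 nf [fb df]].
have nf0 : \forall s \near 0, f s != 0.
  exact: (cvgr_neq0 _ cf f0).
exists (fun s => - f1 s * ((f s)^-1 * (f s)^-1)).
  apply: filterS2 nf nf0 => s Hf fs0.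
  apply: is_derive_eq (is_deriveV fs0 Hf) _.
  by rewrite /GRing.scale /= invfM; ring.
split; first by rewrite fb invfM.
have Df := nbhs_singleton nf.
have DV := is_deriveV f0 Df.
apply: is_derive_eq (is_deriveM (is_deriveN df) (is_deriveM DV DV)) _.
by rewrite /GRing.scale /= !fctE /= fb; field.
Qed.

Lemma jet_sin a : jet (fun s => a * sin s) a 0.
Proof.
apply: jet_eq (jetZ a (_ : jet _ 1 0)) _ _; rewrite ?mulr1 ?mulr0 //.
exists cos; first by apply: (@filterE _ (nbhs (0 : R))) => s; exact: is_derive_sin.
by split; rewrite ?cos0 //; apply: is_derive_eq (is_derive_cos 0) _; rewrite sin0 oppr0.
Qed.

Lemma jet_cos a : jet (fun s => a * cos s) 0 (- a).
Proof.
apply: jet_eq (jetZ a (_ : jet _ 0 (-1))) _ _; rewrite ?mulr0 ?mulrN1 //.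
exists (fun s => - sin s); first by apply: (@filterE _ (nbhs (0 : R))) => s; exact: is_derive_cos.
by split; rewrite ?sin0 ?oppr0 //; apply: is_derive_eq (is_deriveN (is_derive_sin 0)) _; rewrite cos0.
Qed.

Lemma derive_gt0_right f d : f 0 = 0 -> is_derive (0 : R) (1 : R) f d -> 0 < d ->
  exists2 e : R, 0 < e & forall s, 0 < s < e -> 0 < f s.
Proof.
move=> f0 [df Df] d0.
have : (fun h => h^-1 *: (f (h *: 1 + 0) - f 0)) @ 0^' --> d by rewrite -Df; exact: df.
move=> /cvgr_gt /(_ _ d0) /nbhs_ballP[e /= e0 H]; exists e => // s /andP[s0 se].
have := H s; rewrite /ball /= sub0r normrN gtr0_norm // => /(_ se).
rewrite gt_eqF // => /(_ isT).
by rewrite f0 subr0 addr0 /GRing.scale /= mulr1 pmulr_rgt0 // invr_gt0.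
Qed.

(** One-sided on purpose: at the rim of the cap a curve can be followed only inwards. If
    [f'(0) = 0 < f''(0)], then [f' > 0] just to the right and the mean value theorem makes [f]
    positive there. *)
Lemma jet_le0 f b c : jet f b c -> f 0 = 0 ->
  (\forall s \near (0 : R), 0 <= s -> f s <= 0) -> b <= 0 /\ (b = 0 -> c <= 0).
Proof.
move=> [f1 nf [<- df]] f0 /nbhs_ballP[e /= e0 He].
have fle s : 0 < s < e -> f s <= 0.
  move=> /andP[s0 se]; apply: He (ltW s0).
  by rewrite /ball /= sub0r normrN gtr0_norm.
have D0 := nbhs_singleton nf.
split=> [|f10].
  rewrite leNgt; apply/negP => /(derive_gt0_right f0 D0)[e' e'0 H].
  have s0 : 0 < Num.min e e' / 2 by rewrite divr_gt0 // lt_min e0.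
  have sm : Num.min e e' / 2 < Num.min e e' by rewrite ltr_pdivrMr // ltr_pMr ?lt_min ?e0 // ltr1n.
  move: sm; rewrite lt_min => /andP[s1 s2].
  have := H _ (introT andP (conj s0 s2)).
  by rewrite ltNge fle // s0.
rewrite leNgt; apply/negP => /(derive_gt0_right f10 df)[e' e'0 H].
move: nf => /nbhs_ballP[e'' /= e''0 nf].
pose s := Num.min e (Num.min e' e'') / 2.
have m0 : 0 < Num.min e (Num.min e' e'') by rewrite !lt_min e0 e'0.
have s0 : 0 < s by rewrite divr_gt0.
have sm : s < Num.min e (Num.min e' e'').
  by rewrite ltr_pdivrMr // ltr_pMr // ltr1n.
move: sm; rewrite !lt_min => /and3P[s1 s2 s3].
have nf' x : 0 <= x <= s -> is_derive x 1 f (f1 x).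
  move=> /andP[x0 xs]; apply: nf; rewrite /ball /= sub0r normrN ger0_norm //.
  exact: le_lt_trans s3.
have H1 x : x \in `]0, s[ -> is_derive x 1 f (f1 x).
  by rewrite in_itv /= => /andP[x0 xs]; apply: nf'; rewrite !ltW.
have H2 : {within `[0, s], continuous f}.
  apply: continuous_in_subspaceT => x; rewrite inE /= in_itv /= => xs.
  exact: is_derive_continuous (nf' _ xs).
have [x] := MVT s0 H1 H2.
rewrite in_itv /= => /andP[x0 xs]; rewrite f0 !subr0 => E.
have : 0 < f s by rewrite E mulr_gt0 // H // x0 (lt_trans xs).
by rewrite ltNge fle // s0.
Qed.

End Jets.

Section Chain.
Variables (R : realType) (n : nat).
Implicit Types (f : 'rV[R]_n.+1 -> R) (x v : 'rV[R]_n.+1) (U : set 'rV[R]_n.+1).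

Lemma diff_grad f x v : differentiable f x -> 'd f x v = dotv (grad f x) v.
Proof.
move=> df; rewrite {1}[v]row_sum_delta linear_sum /dotv; apply: eq_bigr => i _.
by rewrite linearZ /= mxE /pd deriveE // mulrC.
Qed.

Lemma is_derive_curve f (g : R -> 'rV[R]_n.+1) (s : R) (g1 : 'rV[R]_n.+1) : differentiable f (g s) ->
  (forall i, is_derive s (1 : R) (fun s => g s 0 i) (g1 0 i)) ->
  is_derive s (1 : R) (fun s => f (g s)) (dotv (grad f (g s)) g1).
Proof.
move=> df dg.
have Dg : derivable g s 1.
  by apply/derivable_mxP => i j; rewrite (ord1 i); case: (dg j).
have dg1 : differentiable g s by exact/derivable1_diffP.
have dfg : differentiable (f \o g) s by exact: differentiable_comp.
apply: DeriveDef; first exact/derivable1_diffP.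
rewrite deriveE // diff_comp //= diff_grad //; congr (dotv _ _).
rewrite -deriveE // derive_mx //; apply/rowP => i; rewrite mxE.
by case: (dg i).
Qed.

Definition vjet (g : R -> 'rV[R]_n.+1) (g1 g2 : 'rV[R]_n.+1) :=
  forall i, jet (fun s => g s 0 i) (g1 0 i) (g2 0 i).

Lemma vjet_continuous g g1 g2 : vjet g g1 g2 -> {for 0, continuous g}.
Proof.
move=> H; apply/differentiable_continuous/derivable1_diffP/derivable_mxP => i j.
by rewrite (ord1 i); have [f1 /nbhs_singleton [+ _] _] := H j.
Qed.

Lemma jet_comp f U (g : R -> 'rV[R]_n.+1) (g1 g2 : 'rV[R]_n.+1) : open U -> C2_on U f -> U (g 0) -> vjet g g1 g2 ->
  jet (fun s => f (g s)) (dotv (grad f (g 0)) g1)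
    (quad (hess f (g 0)) g1 + dotv (grad f (g 0)) g2).
Proof.
move=> oU [C0 [C1 _]] Ug Jg; have cg := vjet_continuous Jg.
have [h Hh] : {h : 'I_n.+1 -> R -> R & forall i,
    (\forall s \near (0 : R), is_derive s (1 : R) (fun s => g s 0 i) (h i s)) /\
    h i 0 = g1 0 i /\ is_derive (0 : R) (1 : R) (h i) (g2 0 i)}.
  apply: (@choice _ _ (fun i (h : R -> R) => (\forall s \near (0 : R), is_derive s (1 : R) (fun s => g s 0 i) (h s)) /\
    h 0 = g1 0 i /\ is_derive (0 : R) (1 : R) h (g2 0 i))) => i.
  by have [h ? ?] := Jg i; exists h.
have nU : \forall s \near (0 : R), U (g s).
  by apply: cg; exact: open_nbhs_nbhs.
have nh : \forall s \near (0 : R), forall i, is_derive s (1 : R) (fun s => g s 0 i) (h i s).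
  exact: (@filter_forall _ _ (fun i s => is_derive s (1 : R) (fun s => g s 0 i) (h i s)) (nbhs (0 : R)) _ (fun i => (Hh i).1)).
have H0 i : h i 0 = g1 0 i by have [_ []] := Hh i.
exists (fun s => \sum_i pd i f (g s) * h i s).
  apply: filterS2 nU nh => s Us hs.
  have := @is_derive_curve f g s (\row_i h i s) (C0 _ Us).
  have -> : dotv (grad f (g s)) (\row_i h i s) = \sum_i pd i f (g s) * h i s.
    by apply: eq_bigr => i _; rewrite !mxE.
  by apply=> i; rewrite mxE.
split; first by apply: eq_bigr => i _; rewrite mxE H0.
have D i : is_derive (0 : R) (1 : R) (fun s => pd i f (g s) * h i s)
    (dotv (grad (pd i f) (g 0)) g1 * g1 0 i + pd i f (g 0) * g2 0 i).
  have D1 : is_derive (0 : R) (1 : R) (fun s => pd i f (g s)) (dotv (grad (pd i f) (g 0)) g1).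
    apply: is_derive_curve; first exact: C1.
    by move=> j; have /nbhs_singleton := (Hh j).1; rewrite H0.
  apply: is_derive_eq (is_deriveM D1 (Hh i).2.2) _.
  by rewrite /GRing.scale /= H0; ring.
rewrite (_ : (fun s => _) = \sum_i (fun s => pd i f (g s) * h i s)); last first.
  by apply/funext => s; rewrite fct_sumE.
apply: is_derive_eq (is_derive_sum D) _.
rewrite big_split /=; congr (_ + _); last by apply: eq_bigr => i _; rewrite mxE.
rewrite /quad mxE; apply: eq_bigr => i _; rewrite !mxE; congr (_ * _).
by apply: eq_bigr => j _; rewrite !mxE mulrC.
Qed.

Lemma dotv_Ebasis (u : 'rV[R]_n.+1) i : dotv u (Ebasis R i) = u 0 i.
Proof.
rewrite /dotv (bigD1 i) //= mxE !eqxx mulr1 big1 ?addr0 // => j ji.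
by rewrite mxE (negPf ji) andbF mulr0.
Qed.

Lemma is_derive_line f x i (s : R) : differentiable f (x + s *: Ebasis R i) ->
  is_derive s (1 : R) (fun s => f (x + s *: Ebasis R i)) (pd i f (x + s *: Ebasis R i)).
Proof.
move=> df; have -> : pd i f (x + s *: Ebasis R i) = dotv (grad f (x + s *: Ebasis R i)) (Ebasis R i).
  by rewrite dotv_Ebasis mxE.
apply: (@is_derive_curve f (fun s => x + s *: Ebasis R i)) => // j.
rewrite (_ : (fun s => _) = cst (x 0 j) + (Ebasis R i 0 j *: (id : R -> R))); last first.
  by apply/funext => t; rewrite !mxE /= !fctE /= mulrC.
apply: is_derive_eq (is_deriveD (is_derive_cst _ _ _) (is_deriveZ _ (is_derive_id _ _))) _.
by rewrite add0r /GRing.scale /= mulr1.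
Qed.

(** Two applications of the mean value theorem, in direction [i] and then [j]. The set [P] records
    that the intermediate point can be forced into any neighbourhood of [x]. *)
Lemma second_difference f U x (P : set 'rV[R]_n.+1) i j : open U -> C2_on U f -> U x ->
  nbhs x P -> exists2 r : R, 0 < r & forall s, 0 < s < r -> exists2 q, P q &
    f (x + s *: Ebasis R i + s *: Ebasis R j) - f (x + s *: Ebasis R i)
     - f (x + s *: Ebasis R j) + f x = s ^+ 2 * pd j (pd i f) q.
Proof.
move=> oU [C0 [C1 _]] Ux nP.
have /nbhs_ballP[r0 /= r00 H] : nbhs x (U `&` P) by apply: filterI => //; exact: open_nbhs_nbhs.
pose C := `|Ebasis R i| + `|Ebasis R j| + 1.
have C0' : 0 < C by rewrite ltr_wpDl ?addr_ge0.
exists (r0 / C); first exact: divr_gt0.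
move=> s /andP[s0 sr].
have box a b : 0 <= a <= s -> 0 <= b <= s ->
    (U `&` P) (x + a *: Ebasis R i + b *: Ebasis R j).
  move=> /andP[a0 a1] /andP[b0 b1]; apply: H; rewrite -ball_normE /ball_ /=.
  rewrite -addrA opprD addrA subrr add0r normrN.
  apply: le_lt_trans (ler_normD _ _) _; rewrite !normrZ !ger0_norm //.
  apply: (@le_lt_trans _ _ (s * C)); last by rewrite -ltr_pdivlMr.
  have := normr_ge0 (Ebasis R i); have := normr_ge0 (Ebasis R j).
  rewrite /C; move: `|Ebasis R i| `|Ebasis R j| => p q q0 p0.
  have h1 : a * p <= s * p by rewrite ler_wpM2r.
  have h2 : b * q <= s * q by rewrite ler_wpM2r.
  by nra.
have ss : 0 <= s <= s by rewrite lexx ltW.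
have s00 : 0 <= (0 : R) <= s by rewrite lexx ltW.
have ioc a : a \in `]0, s[ -> 0 <= a <= s.
  by rewrite in_itv /= => /andP[? ?]; rewrite !ltW.
have icc a : a \in `[0, s] -> 0 <= a <= s by rewrite in_itv.
pose phi a := f (x + s *: Ebasis R j + a *: Ebasis R i) - f (x + a *: Ebasis R i).
have Dphi a : 0 <= a <= s -> is_derive a (1 : R) phi
   (pd i f (x + s *: Ebasis R j + a *: Ebasis R i) - pd i f (x + a *: Ebasis R i)).
  move=> ha; apply: is_deriveB; apply: is_derive_line; apply: C0.
    by rewrite addrAC; exact: (box _ _ ha ss).1.
  by have [] := box _ _ ha s00; rewrite scale0r addr0.
have cphi : {within `[0, s], continuous phi}.
  apply: continuous_in_subspaceT => a; rewrite inE /= in_itv /= => ha.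
  exact: is_derive_continuous (Dphi _ ha).
have [a /ioc ha Ea] := MVT s0 (fun a ha => Dphi a (ioc a ha)) cphi.
pose psi b := pd i f (x + a *: Ebasis R i + b *: Ebasis R j).
have Dpsi b : 0 <= b <= s -> is_derive b (1 : R) psi
   (pd j (pd i f) (x + a *: Ebasis R i + b *: Ebasis R j)).
  by move=> hb; apply: is_derive_line; apply: C1; exact: (box _ _ ha hb).1.
have cpsi : {within `[0, s], continuous psi}.
  apply: continuous_in_subspaceT => b; rewrite inE /= in_itv /= => hb.
  exact: is_derive_continuous (Dpsi _ hb).
have [b /ioc hb Eb] := MVT s0 (fun b hb => Dpsi b (ioc b hb)) cpsi.
exists (x + a *: Ebasis R i + b *: Ebasis R j); first exact: (box _ _ ha hb).2.
move: Ea Eb; rewrite /phi /psi !scale0r !addr0 subr0 => Ea Eb.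
rewrite expr2 -mulrA (mulrC s (pd _ _ _)) -Eb [X in pd i f X - _]addrAC mulrC -Ea.
by rewrite [x + s *: Ebasis R j + _]addrAC; ring.
Qed.

(** The mixed second difference does not depend on the order of [i] and [j]. Evaluated both ways it
    equates the two mixed partials at points near [x], and continuity does the rest. *)
Lemma hess_sym f U x : open U -> C2_on U f -> U x -> (hess f x)^T = hess f x.
Proof.
move=> oU Cf Ux; apply/matrixP => i j; rewrite !mxE; apply/eqP/negPn/negP => neq.
have [_ [_ C2]] := Cf.
pose e := `|pd j (pd i f) x - pd i (pd j f) x| / 2.
have e0 : 0 < e by rewrite divr_gt0 // normr_gt0 subr_eq0.
pose P i j := [set q | `|pd j (pd i f) x - pd j (pd i f) q| < e].
have nP i' j' : nbhs x (P i' j').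
  by have /cvgrPdist_lt := C2 j' i' x Ux; exact.
have [r r0 Hr] := second_difference i j oU Cf Ux (nP i j).
have [r' r'0 Hr'] := second_difference j i oU Cf Ux (nP j i).
pose s := Num.min r r' / 2.
have m0 : 0 < Num.min r r' by rewrite lt_min r0.
have s0 : 0 < s by rewrite divr_gt0.
have : s < Num.min r r' by rewrite ltr_pdivrMr // ltr_pMr // ltr1n.
rewrite lt_min => /andP[sr sr'].
have [q Pq Eq] := Hr s (introT andP (conj s0 sr)).
have [q' Pq' Eq'] := Hr' s (introT andP (conj s0 sr')).
have E : pd j (pd i f) q = pd i (pd j f) q'.
  apply: (mulfI (_ : s ^+ 2 != 0)); first by rewrite expf_neq0 // gt_eqF.
  rewrite -[LHS]Eq -[RHS]Eq' (_ : x + s *: _ + s *: Ebasis R i = x + s *: Ebasis R i + s *: Ebasis R j).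
    by move: (f _) (f _) (f _) (f _) => a b c d; ring.
  by rewrite addrAC.
have : `|pd j (pd i f) x - pd i (pd j f) x| < e + e.
  rewrite -(subrKA (pd j (pd i f) q)); apply: le_lt_trans (ler_normD _ _) _.
  by apply: ltrD; [exact: Pq|rewrite E distrC; exact: Pq'].
by rewrite /e -splitr ltxx.
Qed.

End Chain.

(** * The spherical cap and its great circles *)

Section Dot.
Variables (R : realType) (n : nat).
Implicit Types (u v w x y : 'rV[R]_n.+1).

Lemma dotvE u v : dotv u v = (u *m v^T) 0 0.
Proof. by rewrite mxE; apply: eq_bigr => i _; rewrite mxE. Qed.

Lemma dotvC u v : dotv u v = dotv v u.
Proof. by apply: eq_bigr => i _; rewrite mulrC. Qed.

Lemma dotvDl u v w : dotv (u + v) w = dotv u w + dotv v w.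
Proof. by rewrite !dotvE mulmxDl mxE. Qed.

Lemma dotvDr u v w : dotv w (u + v) = dotv w u + dotv w v.
Proof. by rewrite dotvC dotvDl !(dotvC w). Qed.

Lemma dotvZl a u v : dotv (a *: u) v = a * dotv u v.
Proof. by rewrite !dotvE -scalemxAl mxE. Qed.

Lemma dotvZr a u v : dotv u (a *: v) = a * dotv u v.
Proof. by rewrite dotvC dotvZl dotvC. Qed.

Lemma dotvNl u v : dotv (- u) v = - dotv u v.
Proof. by rewrite -scaleN1r dotvZl mulN1r. Qed.

Lemma dotvNr u v : dotv u (- v) = - dotv u v.
Proof. by rewrite dotvC dotvNl dotvC. Qed.

Lemma dotv0l u : dotv 0 u = 0.
Proof. by rewrite -(scale0r (0 : 'rV[R]_n.+1)) dotvZl mul0r. Qed.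

Lemma dotv0r u : dotv u 0 = 0.
Proof. by rewrite dotvC dotv0l. Qed.

Definition dotvL := (dotvDl, dotvDr, dotvZl, dotvZr, dotvNl, dotvNr).

Lemma dotv_ge0 u : 0 <= dotv u u.
Proof. by apply: sumr_ge0 => i _; rewrite -expr2 sqr_ge0. Qed.

Lemma dotv_gt0 u : (0 < dotv u u) = (u != 0).
Proof.
apply/idP/idP => [|u0]; last by rewrite dotvE dotmx_gt0.
by apply: contraTneq => ->; rewrite dotv0l ltxx.
Qed.

Lemma dotv_eq0 u : dotv u u = 0 -> u = 0.
Proof. by move=> u0; apply/eqP; rewrite -[_ == _]negbK -dotv_gt0 u0 ltxx. Qed.

Lemma dotv_cauchy_schwarz u v : dotv u v ^+ 2 <= dotv u u * dotv v v.
Proof.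
have [->|v0] := eqVneq v 0.
  by rewrite !dotv0r mulr0 expr0n.
have v1 : 0 < dotv v v by rewrite dotv_gt0.
have := dotv_ge0 (dotv v v *: u - dotv u v *: v).
rewrite (_ : dotv _ _ = dotv v v * (dotv u u * dotv v v - dotv u v ^+ 2)).
  by rewrite pmulr_rge0 // subr_ge0.
by rewrite !dotvL (dotvC v u); ring.
Qed.

Lemma quad_scale (A : 'M[R]_n.+1) a x : quad A (a *: x) = a ^+ 2 * quad A x.
Proof. by rewrite /quad linearZ /= -!scalemxAl -scalemxAr !mxE; ring. Qed.

Lemma quadN (A : 'M[R]_n.+1) x : quad A (- x) = quad A x.
Proof. by rewrite -scaleN1r quad_scale sqrrN expr1n mul1r. Qed.

Lemma quad_parallelogram (A : 'M[R]_n.+1) x y :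
  quad A (x + y) + quad A (x - y) = 2 * (quad A x + quad A y).
Proof.
have T u v : (u + v)^T = u^T + v^T :> 'cV[R]_n.+1 by apply/colP => i; rewrite !mxE.
have N u : (- u)^T = - u^T :> 'cV[R]_n.+1 by apply/colP => i; rewrite !mxE.
rewrite /quad !T N !mulmxDl !mulmxDr !mulNmx !mulmxN.
have E (a b : 'M[R]_1) : (a + b) 0 0 = a 0 0 + b 0 0 by rewrite mxE.
have E' (a : 'M[R]_1) : (- a) 0 0 = - a 0 0 by rewrite mxE.
by rewrite !(E, E'); ring.
Qed.

Lemma quad_scalar a x : quad (a%:M : 'M[R]_n.+1) x = a * dotv x x.
Proof. by rewrite /quad mul_mx_scalar -scalemxAl mxE dotvE. Qed.

End Dot.

Section GreatCircles.
Variables (R : realType) (n : nat).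
Implicit Types (u v x y : 'rV[R]_n.+1) (f : 'rV[R]_n.+1 -> R).

Local Notation E := (Ebasis R (@ord_max n)).

Definition scap (tau : R) : set 'rV[R]_n.+1 := [set y | dotv y y = 1 /\ tau <= y 0 ord_max].

Definition great_circle y v (s : R) : 'rV[R]_n.+1 := cos s *: y + sin s *: v.

Lemma great_circle0 y v : great_circle y v 0 = y.
Proof. by rewrite /great_circle cos0 sin0 scale1r scale0r addr0. Qed.

Lemma great_circle_vjet y v : vjet (great_circle y v) v (- y).
Proof.
move=> i; rewrite mxE (_ : (fun s => _) = fun s => y 0 i * cos s + v 0 i * sin s).
  apply: jet_eq (jetD (jet_cos (y 0 i)) (jet_sin (v 0 i))) _ _; first by rewrite add0r.
  by rewrite addr0.
by apply/funext => s; rewrite /great_circle !mxE mulrC; congr (_ + _); rewrite mulrC.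
Qed.

Lemma great_circle_unit y v s : dotv y y = 1 -> dotv v v = 1 -> dotv y v = 0 ->
  dotv (great_circle y v s) (great_circle y v s) = 1.
Proof.
move=> y1 v1 yv; rewrite !dotvL y1 v1 yv (dotvC v y) yv.
by rewrite !(mulr0, mulr1, addr0, add0r) -!expr2 cos2Dsin2.
Qed.

Lemma great_circle_dotv y v u s :
  dotv (great_circle y v s) u = dotv y u * cos s + dotv v u * sin s.
Proof. by rewrite !dotvL; ring. Qed.

Lemma jet_great_circle_dotv y v u :
  jet (fun s => dotv (great_circle y v s) u) (dotv v u) (- dotv y u).
Proof.
under eq_fun do rewrite great_circle_dotv.
apply: jet_eq (jetD (jet_cos _) (jet_sin _)) _ _; first by rewrite add0r.
by rewrite addr0.
Qed.

Definition tproj y : 'M[R]_n.+1 := 1%:M - y^T *m y.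

Definition Wtensor f y : 'M[R]_n.+1 :=
  tproj y *m (hess f y + (f y - dotv (grad f y) y)%:M) *m tproj y.

Lemma mul_tproj x y : x *m tproj y = x - dotv x y *: y.
Proof.
rewrite mulmxBr mulmx1 mulmxA; congr (_ - _); apply/rowP => i.
by rewrite [RHS]mxE dotvE [LHS]mxE big_ord1.
Qed.

Lemma tproj_sym y : (tproj y)^T = tproj y.
Proof. by rewrite linearB /= trmx1 trmx_mul trmxK. Qed.

Lemma dotv_tproj x y u : dotv (x *m tproj y) u = dotv x (u *m tproj y).
Proof. by rewrite !mul_tproj !dotvL (dotvC y u); ring. Qed.

Lemma tproj_orth x y : dotv y y = 1 -> dotv (x *m tproj y) y = 0.
Proof. by move=> y1; rewrite mul_tproj !dotvL y1; ring. Qed.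

Lemma tproj_id x y : dotv x y = 0 -> x *m tproj y = x.
Proof. by move=> xy; rewrite mul_tproj xy scale0r subr0. Qed.

Lemma quad_Wtensor f y x :
  quad (Wtensor f y) x = quad (hess f y) (x *m tproj y) +
     (f y - dotv (grad f y) y) * dotv (x *m tproj y) (x *m tproj y).
Proof.
rewrite -quad_scalar -quadD /quad /Wtensor trmx_mul tproj_sym !mulmxA //.
Qed.

Lemma Wtensor_sym f U y : open U -> C2_on U f -> U y -> (Wtensor f y)^T = Wtensor f y.
Proof.
move=> oU Cf Uy; rewrite /Wtensor; set c := _%:M.
have T : (hess f y + c)^T = hess f y + c.
  by rewrite linearD /= (hess_sym oU Cf Uy) tr_scalar_mx.
by rewrite !trmx_mul tproj_sym T mulmxA.
Qed.

Lemma quad_Wtensor_tproj f y x : dotv y y = 1 ->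
  quad (Wtensor f y) (x *m tproj y) = quad (Wtensor f y) x.
Proof. by move=> y1; rewrite !quad_Wtensor [in LHS](tproj_id (tproj_orth _ y1)). Qed.

(** The acceleration of the circle is [-y], and this produces the normal-derivative term of the
    Gauss formula. So [f'' = W(v, v) - f] along unit-speed geodesics, which is how the tensor enters
    every later argument. *)
Lemma jet_great_circle f U y v : open U -> C2_on U f -> U y -> dotv v v = 1 -> dotv v y = 0 ->
  jet (fun s => f (great_circle y v s)) (dotv (grad f y) v) (quad (Wtensor f y) v - f y).
Proof.
move=> oU Cf Uy v1 vy; have := jet_comp oU Cf _ (great_circle_vjet y v).
rewrite great_circle0 => /(_ Uy) J; apply: jet_eq J _ _ => //.
by rewrite quad_Wtensor tproj_id // v1 dotvNr; ring.
Qed.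

End GreatCircles.

(** * Necessary conditions at a maximum on the cap *)

Section CapMax.
Variables (R : realType) (n : nat) (tau : R).
Hypothesis tau1 : tau ^+ 2 < 1.
Implicit Types (u v x y : 'rV[R]_n.+1).

Local Notation E := (Ebasis R (@ord_max n)).
Local Notation scap := (@scap R n tau).

Lemma great_circle_feasible y v : scap y -> dotv v v = 1 -> dotv v y = 0 ->
  tau < y 0 ord_max \/ 0 < v 0 ord_max ->
  \forall s \near (0 : R), 0 <= s -> scap (great_circle y v s).
Proof.
move=> [y1 yt] v1 vy feas.
have U s : dotv (great_circle y v s) (great_circle y v s) = 1.
  by rewrite great_circle_unit // dotvC.
have J := jetB (jet_great_circle_dotv y v E) (jet_cst tau).
have g0 : dotv (great_circle y v 0) E - tau = y 0 ord_max - tau.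
  by rewrite great_circle0 dotv_Ebasis.
have [yt'|yt'] := ltP tau (y 0 ord_max).
  have : \forall s \near (0 : R), 0 < dotv (great_circle y v s) E - tau.
    by apply: (cvgr_gt _ (jet_continuous J)); rewrite g0 subr_gt0.
  apply: filterS => s; rewrite dotv_Ebasis subr_gt0 => /ltW sp _.
  by split.
have {}feas : 0 < v 0 ord_max by case: feas => //; rewrite ltNge yt'.
have [f1 /nbhs_singleton D0 [f10 _]] := J.
have g00 : dotv (great_circle y v 0) E - tau = 0.
  by rewrite g0; apply/eqP; rewrite subr_eq0 eq_le yt' yt.
have d0 : 0 < f1 0 by rewrite f10 subr0 dotv_Ebasis.
have [e e0 H] := derive_gt0_right g00 D0 d0.
apply/nbhs_ballP; exists e => //= s.
rewrite /ball /= sub0r normrN => se s0; split => //.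
move: s0; rewrite le_eqVlt => /orP[/eqP <-|s0]; first by rewrite great_circle0.
have := H s; rewrite s0 (ltr_normlW se) => /(_ isT).
by rewrite dotv_Ebasis subr_gt0 => /ltW.
Qed.

(** At a rim point only inward curves are admissible. The boundary inequality supplies the missing
    sign of the conormal derivative, so the whole tangential gradient vanishes and the second-order
    condition becomes available. *)
Lemma cap_second_order (G : 'rV[R]_n.+1 -> R) (g1 : 'rV[R]_n.+1) (Q : 'M[R]_n.+1) y :
  scap y ->
  (forall v, dotv v v = 1 -> dotv v y = 0 ->
     jet (fun s => G (great_circle y v s)) (dotv g1 v) (quad Q v)) ->
  G y = 0 -> (\forall x \near y, scap x -> G x <= 0) ->
  (y 0 ord_max = tau -> dotv g1 (tau *: y - E) <= 0) ->
  forall v, dotv v y = 0 -> quad Q v <= 0.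
Proof.
move=> sy HJ G0 nG Rob.
have [y1 yt] := sy.
have L v : dotv v y = 0 -> v != 0 -> tau < y 0 ord_max \/ 0 < v 0 ord_max ->
    dotv g1 v <= 0 /\ (dotv g1 v = 0 -> quad Q v <= 0).
  move=> vy v0 feas.
  pose r := Num.sqrt (dotv v v).
  have r0 : 0 < r by rewrite sqrtr_gt0 dotv_gt0.
  pose w := r^-1 *: v.
  have vE : v = r *: w by rewrite scalerA divff ?scale1r // gt_eqF.
  have w1 : dotv w w = 1.
    rewrite !dotvL mulrA -expr2 -(sqr_sqrtr (dotv_ge0 v)) -exprMn mulVf ?expr1n //.
    by rewrite gt_eqF.
  have wy : dotv w y = 0 by rewrite dotvZl vy mulr0.
  have wf : tau < y 0 ord_max \/ 0 < w 0 ord_max.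
    by case: feas; [left|right; rewrite mxE mulr_gt0 ?invr_gt0].
  have [] := jet_le0 (HJ w w1 wy).
  - by rewrite great_circle0.
  - have cg := vjet_continuous (great_circle_vjet y w).
    have : \forall s \near (0 : R), scap (great_circle y w s) -> G (great_circle y w s) <= 0.
      have nG' : nbhs (great_circle y w 0) [set x | scap x -> G x <= 0] by rewrite great_circle0.
      exact: (cg _ nG').
    apply: filterS2 (great_circle_feasible sy w1 wy wf) => s H1 H2 s0.
    exact/H2/H1.
  move=> H1 H2; rewrite vE dotvZr quad_scale; split; first by rewrite pmulr_rle0.
  move/eqP; rewrite mulf_eq0 gt_eqF //= => /eqP /H2 H3.
  by rewrite pmulr_rle0 // exprn_gt0.
have q0 : quad Q 0 = 0 by rewrite /quad mul0mx mul0mx mxE.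
have [yt'|yt'] := ltP tau (y 0 ord_max).
  move=> v vy; have [->|v0] := eqVneq v 0; first by rewrite q0.
  have [h1 H] := L v vy v0 (or_introl yt').
  have vy' : dotv (- v) y = 0 by rewrite dotvNl vy oppr0.
  have v0' : - v != 0 by rewrite oppr_eq0.
  have [h2 _] := L _ vy' v0' (or_introl yt').
  by apply: H; apply/eqP; rewrite eq_le h1 -oppr_le0 -dotvNr.
have {yt'}yt : y 0 ord_max = tau by apply/eqP; rewrite eq_le yt' yt.
(* The inward conormal at a rim point, not normalised. Maximality and the boundary inequality give
   opposite signs for the derivative along it. *)
pose mu := E - tau *: y.
have muN : mu 0 ord_max = 1 - tau ^+ 2 by rewrite !mxE !eqxx yt.
have muN0 : 0 < mu 0 ord_max by rewrite muN subr_gt0.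
have muy : dotv mu y = 0 by rewrite !dotvL (dotvC _ y) dotv_Ebasis yt y1; ring.
have mu0 : mu != 0 by apply: contraTneq muN0 => ->; rewrite mxE ltxx.
have [g1mu _] := L mu muy mu0 (or_intror muN0).
have g1mu0 : dotv g1 mu = 0.
  by apply/eqP; rewrite eq_le g1mu -oppr_le0 -dotvNr opprB Rob.
clearbody mu.
have Lg v : dotv v y = 0 -> dotv g1 v <= 0.
  (* Adding this multiple of [mu] makes any tangent vector point inwards and leaves its pairing with
     [g1] unchanged. *)
  move=> vy; pose k := (1 + `|v 0 ord_max|) / mu 0 ord_max.
  have -> : dotv g1 v = dotv g1 (v + k *: mu) by rewrite !dotvL g1mu0 mulr0 addr0.
  have vk : 0 < (v + k *: mu) 0 ord_max.
    rewrite [X in 0 < X]mxE [X in _ + X]mxE divfK ?gt_eqF //.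
    by have := ler_norm (- v 0 ord_max); rewrite normrN; lra.
  apply: (L _ _ _ (or_intror vk)).1; first by rewrite !dotvL vy muy mulr0 addr0.
  by apply: contraTneq vk => ->; rewrite mxE ltxx.
have g10 v : dotv v y = 0 -> dotv g1 v = 0.
  move=> vy; apply/eqP; rewrite eq_le Lg //= -oppr_le0 -dotvNr Lg //.
  by rewrite dotvNl vy oppr0.
have Lq v : dotv v y = 0 -> 0 < v 0 ord_max -> quad Q v <= 0.
  move=> vy vN; apply: (L v vy _ (or_intror vN)).2; last exact: g10.
  by apply: contraTneq vN => ->; rewrite mxE ltxx.
move=> v vy; have [v0|vneg|vpos] := ltgtP (v 0 ord_max) 0.
- by rewrite -quadN Lq ?dotvNl ?vy ?oppr0 // mxE oppr_gt0.
- exact: Lq.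
rewrite leNgt; apply/negP => qv.
(* For [v] tangent to the rim, [v + k mu] and the opposite of [v - k mu] both point inwards. This
   [k] satisfies [k < 1] and [k |Q(mu)| < Q(v)], so the parallelogram identity contradicts
   [Q(v) > 0]. *)
pose k := quad Q v / (quad Q v + `|quad Q mu| + 1).
have d0 : 0 < quad Q v + `|quad Q mu| + 1 by rewrite addr_gt0 // ltr_wpDr.
have k0 : 0 < k by exact: divr_gt0.
have k1 : k < 1 by rewrite ltr_pdivrMr // mul1r -addrA ltrDl ltr_wpDl.
have h1 : quad Q (v + k *: mu) <= 0.
  apply: Lq; first by rewrite !dotvL vy muy mulr0 addr0.
  by rewrite [X in 0 < X]mxE [X in _ + X]mxE vpos add0r mulr_gt0.
have h2 : quad Q (v - k *: mu) <= 0.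
  rewrite -quadN opprB; apply: Lq; first by rewrite !dotvL vy muy mulr0 subr0.
  by rewrite [X in 0 < X]mxE [X in X + _]mxE [X in _ + X]mxE vpos subr0 mulr_gt0.
have := quad_parallelogram Q v (k *: mu); rewrite quad_scale.
have : k ^+ 2 * `|quad Q mu| <= k * `|quad Q mu|.
  by rewrite ler_wpM2r // expr2 ger_pMr // ltW.
have : k * `|quad Q mu| < quad Q v.
  rewrite /k mulrAC ltr_pdivrMr // mulrC [ltRHS]mulrC; have := normr_ge0 (quad Q mu); nra.
have := ler_norm (- quad Q mu); rewrite normrN => a b c d.
have : k ^+ 2 * - quad Q mu <= k ^+ 2 * `|quad Q mu| by rewrite ler_wpM2l ?sqr_ge0.
by lra.
Qed.

End CapMax.

(** * Reflections *)

Section Reflections.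
Variables (R : realType) (n : nat) (nu : 'rV[R]_n.+1).
Hypothesis nu1 : dotv nu nu = 1.
Implicit Types (u v x y : 'rV[R]_n.+1).

Definition reflmx : 'M[R]_n.+1 := 1%:M - 2 *: (nu^T *m nu).

Definition refl x : 'rV[R]_n.+1 := x - (2 * dotv x nu) *: nu.

Lemma mul_reflmx x : x *m reflmx = refl x.
Proof.
rewrite /reflmx mulmxBr mulmx1 -scalemxAr mulmxA /refl -scalerA; congr (_ - _ *: _).
by apply/rowP => i; rewrite [RHS]mxE dotvE [LHS]mxE big_ord1.
Qed.

Lemma reflD x y : refl (x + y) = refl x + refl y.
Proof. by rewrite -!mul_reflmx mulmxDl. Qed.

Lemma reflZ a x : refl (a *: x) = a *: refl x.
Proof. by rewrite -!mul_reflmx -scalemxAl. Qed.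

Lemma dotv_refl x y : dotv (refl x) (refl y) = dotv x y.
Proof. by rewrite !dotvL nu1 (dotvC nu y); ring. Qed.

Lemma reflK x : refl (refl x) = x.
Proof.
rewrite /refl !dotvL nu1.
rewrite (_ : 2 * (dotv x nu - 2 * dotv x nu * 1) = - (2 * dotv x nu)); last by ring.
by rewrite scaleNr opprK subrK.
Qed.

Lemma dotv_reflC x y : dotv (refl x) y = dotv x (refl y).
Proof. by rewrite -[y in LHS]reflK dotv_refl. Qed.

Lemma refl_nu x : dotv (refl x) nu = - dotv x nu.
Proof. by rewrite !dotvL nu1; ring. Qed.

Lemma refl_great_circle y v s : refl (great_circle y v s) = great_circle (refl y) (refl v) s.
Proof. by rewrite reflD !reflZ. Qed.

Lemma refl_tproj x y : refl (x *m tproj y) = refl x *m tproj (refl y).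
Proof. by rewrite !mul_tproj dotv_refl reflD -scaleNr reflZ scaleNr. Qed.

Lemma reflmx_sym : reflmx^T = reflmx.
Proof. by rewrite linearB linearZ /= trmx1 trmx_mul trmxK. Qed.

Lemma reflmx_invol : reflmx *m reflmx = 1%:M.
Proof.
apply/row_matrixP => i; rewrite !rowE mulmxA !mul_reflmx reflK.
by rewrite mulmx1.
Qed.

Lemma refl_unitmx : reflmx \in unitmx.
Proof. by have [] := mulmx1_unit reflmx_invol. Qed.

Lemma quad_refl (A : 'M[R]_n.+1) x : quad (reflmx *m A *m reflmx) x = quad A (refl x).
Proof.
rewrite /quad -(mul_reflmx x) trmx_mul reflmx_sym !mulmxA //.
Qed.

Lemma sigmaj_refl j (A : 'M[R]_n.+1) : sigmaj j (reflmx *m A *m reflmx) = sigmaj j A.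
Proof.
have invE : invmx reflmx = reflmx.
  by rewrite -[LHS]mulmx1 -reflmx_invol mulKmx ?refl_unitmx.
by rewrite /sigmaj -{2}invE char_poly_conj ?refl_unitmx.
Qed.

Lemma refl_last x : nu 0 ord_max = 0 -> refl x 0 ord_max = x 0 ord_max.
Proof. by move=> nuN; rewrite !mxE nuN mulr0 subr0. Qed.

Lemma refl_scap tau x : nu 0 ord_max = 0 -> scap tau x -> scap tau (refl x).
Proof. by move=> nuN [x1 xt]; split; rewrite ?dotv_refl ?refl_last. Qed.

End Reflections.

Section Contact.
Variables (R : realType) (n : nat) (tau : R) (U : set 'rV[R]_n.+1) (f : 'rV[R]_n.+1 -> R).
Hypothesis tau1 : tau ^+ 2 < 1.
Hypotheses (oU : open U) (capU : @scap R n tau `<=` U) (Cf : C2_on U f).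
Local Notation E := (Ebasis R (@ord_max n)).
Local Notation scap := (@scap R n tau).
Hypothesis Rob : forall y, scap y -> y 0 ord_max = tau ->
  dotv (grad f y) (tau *: y - E) = tau * f y.
Variable nu : 'rV[R]_n.+1.
Hypotheses (nu1 : dotv nu nu = 1) (nuN : nu 0 ord_max = 0).

(** The tensor of [f o R] at [y], written through that of [f] so that no composite is differentiated
    twice. *)
Definition reflW y := reflmx nu *m Wtensor f (refl nu y) *m reflmx nu.

(** [Q] plays the role of the tensor of the barrier [b]. The term [M <y, nu>] has zero tensor and
    satisfies the boundary condition exactly, so only [e Q] survives in the comparison of the two
    tensors. *)
Lemma contact_ineq y (b : 'rV[R]_n.+1 -> R) (b1 : 'rV[R]_n.+1) (Q : 'M[R]_n.+1) (e M : R) :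
  scap y ->
  (forall v, dotv v v = 1 -> dotv v y = 0 ->
     jet (fun s => b (great_circle y v s)) (dotv b1 v) (quad Q v - b y)) ->
  (y 0 ord_max = tau -> dotv b1 (tau *: y - E) <= tau * b y) -> 0 <= e ->
  f y - f (refl nu y) + e * b y - M * dotv y nu = 0 ->
  (\forall x \near y, scap x -> f x - f (refl nu x) + e * b x - M * dotv x nu <= 0) ->
  forall x, e * quad Q (x *m tproj y) <= quad (reflW y) x - quad (Wtensor f y) x.
Proof.
move=> sy Jb Rb e0 G0 nG x; have [y1 yt] := sy.
have sy' : scap (refl nu y) by exact: refl_scap.
pose G x := f x - f (refl nu x) + e * b x - M * dotv x nu.
pose g1 := grad f y - refl nu (grad f (refl nu y)) + e *: b1 - M *: nu.
pose q := Wtensor f y + (-1) *: reflW y + e *: Q.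
have qx v : quad q v = quad (Wtensor f y) v - quad (reflW y) v + e * quad Q v.
  by rewrite !quadD !quadZ mulN1r.
have Jq v : dotv v v = 1 -> dotv v y = 0 ->
     jet (fun s => G (great_circle y v s)) (dotv g1 v) (quad q v).
  move=> v1 vy.
  have J1 := jet_great_circle oU Cf (capU sy) v1 vy.
  have rv1 : dotv (refl nu v) (refl nu v) = 1 by rewrite dotv_refl.
  have rvy : dotv (refl nu v) (refl nu y) = 0 by rewrite dotv_refl.
  have J2 := jet_great_circle oU Cf (capU sy') rv1 rvy.
  have J3 := jet_great_circle_dotv y v nu.
  have := jetB (jetD (jetB J1 J2) (jetZ e (Jb _ v1 vy))) (jetZ M J3).
  under eq_fun do rewrite -refl_great_circle.
  move=> J; apply: jet_eq J _ _.
    by rewrite /g1 3!dotvDl !dotvNl !dotvZl (dotv_reflC nu1) (dotvC nu v).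
  rewrite qx /reflW quad_refl; move: G0; rewrite /G; lra.
have Rq : y 0 ord_max = tau -> dotv g1 (tau *: y - E) <= 0.
  move=> yN; have Hb := Rb yN; have H1 := Rob sy yN.
  have yN' : refl nu y 0 ord_max = tau by rewrite refl_last.
  have H2 := Rob sy' yN'.
  have rE : refl nu (tau *: y - E) = tau *: refl nu y - E.
    rewrite reflD reflZ; congr (_ + _); rewrite /refl dotvNl (dotvC E) dotv_Ebasis nuN.
    by rewrite oppr0 mulr0 scale0r subr0.
  have H3 : dotv nu (tau *: y - E) = tau * dotv y nu.
    by rewrite !dotvL dotv_Ebasis nuN subr0 (dotvC nu).
  have -> : dotv g1 (tau *: y - E) = tau * f y - tau * f (refl nu y)
      + e * dotv b1 (tau *: y - E) - M * (tau * dotv y nu).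
    by rewrite -H1 -H2 -H3 -rE -dotv_reflC // /g1 3!dotvDl !dotvNl !dotvZl.
  have : e * dotv b1 (tau *: y - E) <= e * (tau * b y) by rewrite ler_wpM2l.
  have : tau * (f y - f (refl nu y) + e * b y - M * dotv y nu) = 0 by rewrite G0 mulr0.
  by move: (f y) (f _) (dotv y nu) (dotv b1 _) (b y) => ? ? ? ? ?; lra.
have := @cap_second_order R n tau tau1 G g1 q y sy Jq G0 nG Rq (x *m tproj y).
rewrite tproj_orth // => /(_ erefl); rewrite qx quad_Wtensor_tproj //.
have -> : quad (reflW y) (x *m tproj y) = quad (reflW y) x.
  have [y1' _] := sy'.
  have qr z : quad (reflW y) z = quad (Wtensor f (refl nu y)) (refl nu z) by exact: quad_refl.
  rewrite 2!qr refl_tproj //.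
  exact: quad_Wtensor_tproj.
lra.
Qed.

End Contact.

(** * Compactness and perturbed maxima *)

Section Continuity.
Variables (R : realType) (n : nat).
Implicit Types (u v x y p : 'rV[R]_n.+1).

Lemma mx_cvg_id p : mx_cvg (nbhs p) id p.
Proof. by move=> i j; exact: coord_continuous. Qed.

Lemma dotv_cvg (T : Type) (F : set_system T) {FF : Filter F} (a b : T -> 'rV[R]_n.+1) a0 b0 :
  mx_cvg F a a0 -> mx_cvg F b b0 -> dotv (a x) (b x) @[x --> F] --> dotv a0 b0.
Proof. by move=> Ha Hb; apply: cvg_big_sum => i _; apply: cvgM; [exact: Ha|exact: Hb]. Qed.

Lemma dotv_continuous u : continuous (fun x => dotv x u).
Proof. move=> p; have H := (@dotv_cvg _ (nbhs p) _ id (fun=> u) p u (@mx_cvg_id p) (@mx_cvg_cst _ _ _ _ _ _ u)). exact: H. Qed.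

Lemma sqnorm_continuous : continuous (fun x => dotv x x).
Proof. by move=> p; exact: (@dotv_cvg _ (nbhs p) _ id id p p (@mx_cvg_id p) (@mx_cvg_id p)). Qed.

Lemma refl_continuous nu : continuous (@refl R n nu).
Proof.
move=> p; have H : (2 * dotv x nu) @[x --> p] --> 2 * dotv p nu.
  have H0 : (dotv x nu) @[x --> p] --> dotv p nu by exact: dotv_continuous.
  exact: (cvgM (cvg_cst (2 : R)) H0).
have H1 : x @[x --> p] --> p by exact: cvg_id.
have H2 := cvgB H1 (cvgZr_tmp (a := nu) H).
exact: H2.
Qed.

Lemma scap_compact tau (nu : 'rV[R]_n.+1) :
  compact (@scap R n tau `&` [set y | 0 <= dotv y nu]).
Proof.
apply: bounded_closed_compact.
  exists 1; split; first exact: num_real.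
  move=> M M1 y [[y1 _] _]; rewrite /= [leLHS]/Num.Def.normr/= mx_normrE; apply: bigmax_le => [|[i j] _] /=.
    by rewrite (le_trans _ (ltW M1)).
  rewrite (ord1 i); apply: le_trans (ltW M1).
  rewrite -(@ler_pXn2r _ 2) ?nnegrE // expr1n -normrX -y1 /dotv (bigD1 j) //=.
  rewrite ger0_norm ?sqr_ge0 // expr2 lerDl sumr_ge0 // => k _.
  by rewrite -expr2 sqr_ge0.
apply: closedI; last first.
  apply: (@closed_comp _ _ (fun y => dotv y nu) [set x | 0 <= x]); last exact: closed_ge.
  by move=> y _; exact: dotv_continuous.
rewrite (_ : scap tau = [set y | dotv y y = 1] `&` [set y | tau <= y 0 ord_max]) //.
apply: closedI.
  apply: (@closed_comp _ _ (fun y => dotv y y) [set x | x = 1]); last exact: closed_eq.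
  by move=> y _; exact: sqnorm_continuous.
apply: (@closed_comp _ _ (fun y : 'rV[R]_n.+1 => y 0 ord_max) [set x | tau <= x]); last exact: closed_ge.
by move=> y _; exact: coord_continuous.
Qed.

(* The penalisation [e * psi] moves the maximum of [v] off [p] by less than any
   given amount, because near [p] every other maximum of [v] has [psi < 0]. *)
Lemma penalized_max (D N : set 'rV[R]_n.+1) (v psi : 'rV[R]_n.+1 -> R) (M : R) p :
  compact D -> nbhs p N ->
  (forall x, D x -> {for x, continuous v}) ->
  (forall x, D x -> N x -> {for x, continuous psi}) ->
  (forall x, D x -> v x <= M) -> D p -> v p = M -> psi p = 0 ->
  (forall x, D x -> N x -> 0 <= psi x -> v x = M -> x = p) ->
  exists2 e1 : R, 0 < e1 & forall e, 0 < e < e1 -> exists y,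
    [/\ D y, N y & \forall x \near y, D x -> v x + e * psi x <= v y + e * psi y].
Proof.
move=> cD /nbhs_ballP[r /= r0 rN] cv cpsi vM Dp vp psip uniq.
have r2 : 0 < r / 2 by exact: divr_gt0.
have rr : r / 2 < r by rewrite ltr_pdivrMr // ltr_pMr // ltr1n.
pose K := D `&` [set x | `|p - x| <= r / 2].
pose S := K `&` [set x | r / 2 <= `|p - x|].
have cdist : continuous (fun x => `|p - x|).
  move=> x; have H : y @[y --> x] --> x by exact: cvg_id.
  exact: (cvg_norm (cvgB (cvg_cst p) H)).
have cK : compact K.
  apply: compact_closedI => //; apply: (@closed_comp _ _ (fun x => `|p - x|) [set z | z <= r / 2]).
    by move=> y _; exact: cdist.
  exact: closed_le.
have cS : compact S.
  apply: compact_closedI => //; apply: (@closed_comp _ _ (fun x => `|p - x|) [set z | r / 2 <= z]).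
    by move=> y _; exact: cdist.
  exact: closed_ge.
have KN x : K x -> N x.
  by move=> [_ /= h]; apply: rN; rewrite -ball_normE /ball_ /=; exact: le_lt_trans rr.
have Kp : K p by split => //=; rewrite subrr normr0 ltW.
have [e1 e10 He1] : exists2 e1 : R, 0 < e1 & forall e x, 0 < e < e1 -> S x -> v x + e * psi x < M.
  have [->|/set0P S0] := eqVneq S set0; first by exists 1 => // e x _ [].
  (* Positive on the sphere [S]: there either [v < M] or [psi < 0]. Its minimum over [S], divided by
     a bound for [psi], gives the threshold for [e]. *)
  pose m x := Num.max (M - v x) (- psi x).
  have cm : {within S, continuous m}.
    apply: continuous_in_subspaceT => x; rewrite inE => -[Kx _].
    have c1 : {for x, continuous (fun y => M - v y)} by exact: (cvgB (cvg_cst M) (cv _ Kx.1)).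
    have c2 : {for x, continuous (fun y => - psi y)} by exact: (cvgN (cpsi _ Kx.1 (KN _ Kx))).
    exact: (continuous_max c1 c2).
  have [x1 + Hmin] := EVT_min_rV S0 cS cm; rewrite inE => Sx1.
  have m0 : 0 < m x1.
    rewrite lt_max subr_gt0 oppr_gt0; have [[Dx1 ?] /= hx1] := Sx1.
    rewrite lt_neqAle vM // andbT; case: (ltP (psi x1) 0) => [|h]; rewrite ?orbT // orbF.
    apply/eqP => vx1; have xp := uniq _ Dx1 (KN _ Sx1.1) h vx1.
    by move: hx1; rewrite xp subrr normr0 leNgt r2.
  have cp : {within S, continuous psi}.
    apply: continuous_in_subspaceT => x; rewrite inE => -[Kx _].
    exact: cpsi Kx.1 (KN _ Kx).
  have [x2 _ Hmax] := EVT_max_rV S0 cS cp.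
  exists (m x1 / (`|psi x2| + 1)); first by rewrite divr_gt0 // ltr_wpDl.
  move=> e x /andP[e0 ee] Sx.
  have p1 : psi x <= psi x2 by apply: Hmax; rewrite inE.
  have hm : (m x1 <= M - v x) || (m x1 <= - psi x) by rewrite -le_max; apply: Hmin; rewrite inE.
  have vx := vM _ Sx.1.1.
  move: ee; rewrite ltr_pdivlMr ?ltr_wpDl // => ee.
  move/orP: hm => [h|h]; last first.
    have : e * psi x < 0 by rewrite pmulr_rlt0 //; lra.
    lra.
  have : e * psi x <= e * (`|psi x2| + 1).
    by rewrite ler_wpM2l ?(ltW e0) //; have := ler_norm (psi x2); lra.
  lra.
exists e1 => // e ee.
have cF : {within K, continuous (fun x => v x + e * psi x)}.
  apply: continuous_in_subspaceT => x; rewrite inE => Kx.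
  exact: (cvgD (cv _ Kx.1) (cvgM (cvg_cst e) (cpsi _ Kx.1 (KN _ Kx)))).
have [y + Hy] := EVT_max_rV (ex_intro _ p Kp) cK cF; rewrite inE => Ky.
exists y; split; [exact: Ky.1|exact: KN|].
have hy : `|p - y| < r / 2.
  rewrite ltNge; apply/negP => h.
  have h1 : v p + e * psi p <= v y + e * psi y by apply: Hy; rewrite inE.
  have := He1 e y ee (conj Ky h); rewrite ltNge.
  by move: h1; rewrite vp psip mulr0 addr0 => ->.
have nhy : \forall x \near y, `|p - x| < r / 2 by exact: (cvgr_lt _ (cdist y) _ hy).
apply: filterS nhy => x hx Dx.
by apply: Hy; rewrite inE; split => //=; exact: ltW.
Qed.

End Continuity.

Section Quotient.
Variables (R : realType) (n : nat) (U : set 'rV[R]_n.+1) (f : 'rV[R]_n.+1 -> R).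
Hypotheses (oU : open U) (Cf : C2_on U f).
Variable nu : 'rV[R]_n.+1.

Lemma C2_continuous x : U x -> {for x, continuous f}.
Proof. by case: Cf => C0 _ Ux; exact/differentiable_continuous/C0. Qed.

Lemma grad_cvg x : U x -> mx_cvg (nbhs x) (grad f) (grad f x).
Proof.
case: Cf => _ [C1 _] Ux i j; rewrite mxE; under eq_fun do rewrite mxE.
exact/differentiable_continuous/C1.
Qed.

Lemma hess_cvg x : U x -> mx_cvg (nbhs x) (hess f) (hess f x).
Proof.
case: Cf => _ [_ C2] Ux i j.
have E : (fun y => hess f y i j) = pd i (pd j f) by apply/funext => y; exact: mxE.
have H : {for x, continuous (fun y => hess f y i j)} by rewrite E; exact: C2.
exact: H.
Qed.

Definition rquot y := if dotv y nu == 0 then 2 * dotv (grad f y) nu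
  else (f y - f (refl nu y)) / dotv y nu.

Lemma refl_mean_value y : (forall t : R, 0 <= t <= 1 -> U (y - (2 * dotv y nu * t) *: nu)) ->
  dotv y nu != 0 -> exists2 t : R, 0 <= t <= 1 &
    rquot y = 2 * dotv (grad f (y - (2 * dotv y nu * t) *: nu)) nu.
Proof.
move=> Uy z0; rewrite /rquot (negPf z0).
pose a := - (2 * dotv y nu).
pose g (t : R) : 'rV[R]_n.+1 := y + (a * t) *: nu.
have gE (t : R) : g t = y - (2 * dotv y nu * t) *: nu by rewrite /g /a mulNr scaleNr.
have Dg (t : R) : 0 <= t <= 1 -> is_derive t (1 : R) (fun t => f (g t)) (dotv (grad f (g t)) (a *: nu)).
  move=> t01; apply: (@is_derive_curve R n f g t (a *: nu)).
    by case: Cf => C0 _; apply: C0; rewrite gE; exact: Uy.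
  move=> i; rewrite (_ : (fun t => _) = cst (y 0 i) + (a * nu 0 i *: (id : R -> R))).
    apply: is_derive_eq (is_deriveD (is_derive_cst _ _ _) (is_deriveZ _ (is_derive_id _ _))) _.
    by rewrite add0r /GRing.scale /= mulr1 mxE.
  by apply/funext => s; rewrite !mxE /= !fctE /GRing.scale /= mulrAC.
have cg : {within `[(0 : R), 1], continuous (fun t => f (g t))}.
  apply: continuous_in_subspaceT => t; rewrite inE /= in_itv /= => ht.
  exact: is_derive_continuous (Dg _ ht).
have ioc (t : R) : t \in `](0 : R), 1[ -> 0 <= t <= 1.
  by rewrite in_itv /= => /andP[? ?]; rewrite !ltW.
have [t /ioc t01 Et] := MVT (ltr01 : (0 : R) < 1) (fun t ht => Dg t (ioc t ht)) cg.
exists t => //.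
have g0 : g 0 = y by rewrite gE mulr0 scale0r subr0.
have g1 : g 1 = refl nu y by rewrite gE mulr1.
move: Et; rewrite g0 g1 subr0 mulr1 -gE dotvZr => Et.
rewrite -[f y - _]opprB Et /a; field.
by [].
Qed.

(** At a wall point both branches of the definition are values of [2 <Df, nu>] on the segment from
    [y] to its mirror image, by the mean value theorem. That segment shrinks to [p], and [grad f] is
    continuous. *)
Lemma rquot_continuous p : U p -> U (refl nu p) -> {for p, continuous rquot}.
Proof.
move=> Up Urp; have cz := @dotv_continuous R n nu p.
have [z0|z0] := eqVneq (dotv p nu) 0; last first.
  have nz : \forall y \near p, dotv y nu != 0 by exact: (cvgr_neq0 _ cz z0).
  have c1 : (f y - f (refl nu y)) / dotv y nu @[y --> p] --> (f p - f (refl nu p)) / dotv p nu.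
    have c2 : f (refl nu y) @[y --> p] --> f (refl nu p).
      exact: (cvg_comp _ _ (@refl_continuous R n nu p) (C2_continuous Urp)).
    exact: (cvgM (cvgB (C2_continuous Up) c2) (cvgV z0 cz)).
  rewrite /prop_for /continuous_at /rquot (negPf z0).
  have E : \forall y \near p, (f y - f (refl nu y)) / dotv y nu =
      (if dotv y nu == 0 then 2 * dotv (grad f y) nu else (f y - f (refl nu y)) / dotv y nu).
    by apply: filterS nz => y /negPf ->.
  exact: cvg_trans (near_eq_cvg E) c1.
have cG : (2 * dotv (grad f y) nu) @[y --> p] --> 2 * dotv (grad f p) nu.
  have H : dotv (grad f y) nu @[y --> p] --> dotv (grad f p) nu.
    have H := dotv_cvg (a := grad f) (b := fun=> nu) (grad_cvg Up) (fun i j => cvg_cst (nu i j)).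
    exact: H.
  exact: (cvgM (cvg_cst (2 : R)) H).
rewrite /prop_for /continuous_at.
have -> : rquot p = 2 * dotv (grad f p) nu by rewrite /rquot z0 eqxx.
apply: (@cvgrPdist_lt _ _ _ (nbhs p) _ rquot _).2 => e e0.
have /nbhs_ballP[r /= r0 H] : nbhs p (U `&` [set y | `|2 * dotv (grad f p) nu - 2 * dotv (grad f y) nu| < e]).
  apply: filterI; first exact: open_nbhs_nbhs.
  by move/cvgrPdist_lt : cG; exact.
(* Bounds the distance from [p] to every point of that segment. The segment leaves the sphere, which
   is one reason for working in the open set [U]. *)
have cd : `|p - y| + `|2 * dotv y nu| * `|nu| @[y --> p] --> (0 : R).
  have -> : (0 : R) = `|p - p| + `|2 * dotv p nu| * `|nu|.
    by rewrite subrr normr0 z0 mulr0 normr0 mul0r addr0.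
  have cid : y @[y --> p] --> p by exact: cvg_id.
  exact: (cvgD (cvg_norm (cvgB (cvg_cst p) cid)) (cvgM (cvg_norm (cvgM (cvg_cst (2 : R)) cz)) (cvg_cst _))).
have nd : \forall y \near p, `|p - y| + `|2 * dotv y nu| * `|nu| < r by exact: (cvgr_lt _ cd _ r0).
apply: filterS nd => y hy.
have box (t : R) : 0 <= t <= 1 -> (U `&` [set y | `|2 * dotv (grad f p) nu - 2 * dotv (grad f y) nu| < e])
    (y - (2 * dotv y nu * t) *: nu).
  move=> /andP[t0 t1]; apply: H; rewrite -ball_normE /ball_ /= opprB addrCA.
  rewrite addrC; apply: le_lt_trans hy; apply: le_trans (ler_normD _ _) _.
  rewrite lerD2l normrZ normrM (ger0_norm t0) ler_wpM2r //.
  by rewrite ler_piMr.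
have [yz|yz] := eqVneq (dotv y nu) 0.
  rewrite /rquot yz eqxx.
  have [|_] := box 0; first by rewrite lexx ler01.
  by rewrite mulr0 scale0r subr0.
have [|t /box[_ ht] ->] := refl_mean_value _ yz; last exact: ht.
by move=> t /box[].
Qed.

End Quotient.

(** * Maximum principle for the reflection quotient *)

Section NoTouching.
Variables (R : realType) (n k l : nat) (tau c0 : R) (U : set 'rV[R]_n.+1) (f : 'rV[R]_n.+1 -> R).
Hypothesis tau1 : tau ^+ 2 < 1.
Hypotheses (oU : open U) (capU : @scap R n tau `<=` U) (Cf : C2_on U f).
Local Notation E := (Ebasis R (@ord_max n)).
Local Notation scap := (@scap R n tau).
Hypothesis Rob : forall y, scap y -> y 0 ord_max = tau ->
  dotv (grad f y) (tau *: y - E) = tau * f y.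
Hypotheses (kn : (k < n.+1)%N) (lk : (l < k)%N).
Hypothesis lev : forall y, scap y -> level k l c0 (Wtensor f y).
Variable nu : 'rV[R]_n.+1.
Hypotheses (nu1 : dotv nu nu = 1) (nuN : nu 0 ord_max = 0).
Local Notation v := (rquot f nu).

Definition half_cap : set 'rV[R]_n.+1 := scap `&` [set y | 0 <= dotv y nu].

Lemma tproj_cvg p : mx_cvg (nbhs p) (@tproj R n) (tproj p).
Proof.
have H1 : mx_cvg (nbhs p) (fun x => x^T *m x) (p^T *m p).
  by apply: mx_cvgM; [apply: mx_cvgT|]; exact: mx_cvg_id.
move=> i j; rewrite !mxE; under eq_fun do rewrite !mxE.
have := H1 i j; rewrite mxE; under eq_fun do rewrite mxE.
exact: (cvgB (cvg_cst _)).
Qed.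

Lemma Wtensor_cvg p : U p -> mx_cvg (nbhs p) (Wtensor f) (Wtensor f p).
Proof.
move=> Up; apply: mx_cvgM; last exact: tproj_cvg.
apply: mx_cvgM; first exact: tproj_cvg.
apply: mx_cvgD; first exact: hess_cvg Up.
have c1 : f x - dotv (grad f x) x @[x --> p] --> f p - dotv (grad f p) p.
  exact: (cvgB (C2_continuous Cf Up) (dotv_cvg (a := grad f) (b := id) (grad_cvg Cf Up) (@mx_cvg_id R n p))).
move=> i j; rewrite mxE; under eq_fun do rewrite mxE.
by case: (i == j) => //=; exact: cvg_cst.
Qed.

Lemma mx_cvg_comp (T T' : Type) (F : set_system T) (G : set_system T') (g : T -> T')
  a b (A : T' -> 'M[R]_(a, b)) A0 :
  g @ F --> G -> mx_cvg G A A0 -> mx_cvg F (A \o g) A0.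
Proof. by move=> H HA i j; exact: cvg_comp H (HA i j). Qed.

Lemma reflW_cvg p : U (refl nu p) -> mx_cvg (nbhs p) (reflW f nu) (reflW f nu p).
Proof.
move=> Up; apply: mx_cvgM; last exact: mx_cvg_cst.
apply: mx_cvgM; first exact: mx_cvg_cst.
exact: mx_cvg_comp (@refl_continuous R n nu p) (Wtensor_cvg Up).
Qed.

Lemma level_reflW y : scap y -> level k l c0 (reflW f nu y).
Proof.
move=> sy; have [Ws gW EW] := lev (refl_scap nu1 nuN sy); split.
- rewrite /reflW; move: (Wtensor _ _) Ws => W Ws.
  by rewrite !trmx_mul reflmx_sym Ws mulmxA.
- by move=> j jk; rewrite sigmaj_refl // gW.
- by rewrite !(sigmaj_refl nu1); exact: EW.
Qed.

Lemma cap_ellipticity p (m : 'rV[R]_n.+1 -> 'rV[R]_n.+1) :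
  scap p -> mx_cvg (nbhs p) m (m p) -> m p != 0 ->
  exists2 eta : R, 0 < eta & exists2 e0 : R, 0 < e0 & \forall y \near p, scap y ->
    forall e : R, 0 < e < e0 ->
    ~ (forall x, e * (dotv x (m y) ^+ 2 - eta * dotv x x) <=
        quad (reflW f nu y) x - quad (Wtensor f y) x).
Proof.
move=> sp cm mp0.
have Fp : Filter (within scap (nbhs p)) by exact: within_filter.
have W1 a b (A : 'rV[R]_n.+1 -> 'M[R]_(a, b)) A0 :
    mx_cvg (nbhs p) A A0 -> mx_cvg (within scap (nbhs p)) A A0.
  by move=> H i j; apply: cvg_trans (H i j); apply: cvg_app; exact: cvg_within.
have H1 := W1 _ _ _ _ (Wtensor_cvg (capU sp)).
have H2 := W1 _ _ _ _ (reflW_cvg (capU (refl_scap nu1 nuN sp))).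
have H3 : \forall y \near within scap (nbhs p),
    level k l c0 (Wtensor f y) /\ level k l c0 (reflW f nu y).
  apply: (@filterE _ (nbhs p)) => y sy; split; [exact: lev|exact: level_reflW].
have [eta eta0 [e0 e00 H]] := @local_ellipticity R n.+1 k l c0 kn lk _ _ Fp _ _ m _ _ _
  H1 H2 (W1 _ _ _ _ cm) mp0 (lev sp) (level_reflW sp) H3.
exists eta => //; exists e0 => //.
apply: (@filterS _ (nbhs p) _ _ _ _ H) => y Hy sy e ee Hx.
apply: (Hy sy e ee) => x; rewrite -!dotvE; exact: Hx.
Qed.

Lemma half_cap_quotient y : 0 < dotv y nu -> f y - f (refl nu y) = v y * dotv y nu.
Proof. by move=> z0; rewrite /rquot gt_eqF // divfK // gt_eqF. Qed.

(** The part common to both barrier arguments. A perturbed maximum off the wall yields a contact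
    inequality that ellipticity forbids; one on the wall is left to the last hypothesis. The barrier
    for [f] is [z psi], because [z (v + e psi - M')] is [f - f o R + e z psi - M' z]. *)
Lemma no_touching p (M : R) (psi : 'rV[R]_n.+1 -> R) (m : 'rV[R]_n.+1 -> 'rV[R]_n.+1)
    (eta e0 s : R) (N : set 'rV[R]_n.+1) :
  half_cap p -> (forall x, half_cap x -> v x <= M) -> v p = M -> psi p = 0 ->
  nbhs p N -> 0 < s -> 0 < e0 ->
  (forall y, N y -> scap y -> forall e : R, 0 < e < e0 ->
    ~ (forall x, e * (dotv x (m y) ^+ 2 - eta * dotv x x) <=
        quad (reflW f nu y) x - quad (Wtensor f y) x)) ->
  (forall x, half_cap x -> N x -> {for x, continuous psi}) ->
  (forall x, half_cap x -> N x -> 0 <= psi x -> v x = M -> x = p) ->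
  (forall y, half_cap y -> N y -> 0 < dotv y nu -> exists b1 Q,
     [/\ forall w, dotv w w = 1 -> dotv w y = 0 ->
       jet (fun t => dotv (great_circle y w t) nu * psi (great_circle y w t))
         (dotv b1 w) (quad Q w - dotv y nu * psi y),
       y 0 ord_max = tau -> dotv b1 (tau *: y - E) <= tau * (dotv y nu * psi y) &
       forall x, s * (dotv x (m y) ^+ 2 - eta * dotv x x) <= quad Q (x *m tproj y)]) ->
  (forall y (e M' : R), half_cap y -> N y -> dotv y nu = 0 -> 0 < e -> v y + e * psi y = M' ->
     (\forall x \near y, half_cap x -> v x + e * psi x <= M') -> False) ->
  False.
Proof.
move=> Dp vM vp psip nN s0 e00 ell cpsi uniq inner wall.
have cv x : half_cap x -> {for x, continuous v}.
  by move=> [sx _]; apply: (rquot_continuous oU Cf); apply: capU => //; exact: refl_scap.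
have [e1 e10 He1] := penalized_max (@scap_compact R n tau nu) nN cv cpsi vM Dp vp psip uniq.
(* Below [e1] for the perturbed maximum, and below [e0 / s] because [e * s] is what enters the
   ellipticity statement. *)
pose e := Num.min e1 (e0 / s) / 2.
have e2 : 0 < Num.min e1 (e0 / s) by rewrite lt_min e10 divr_gt0.
have e_gt0 : 0 < e by rewrite divr_gt0.
have : e < Num.min e1 (e0 / s) by rewrite ltr_pdivrMr // ltr_pMr // ltr1n.
rewrite lt_min => /andP[ee1 ee0].
have [y [Dy Ny Hy]] := He1 e (introT andP (conj e_gt0 ee1)).
have [sy] := Dy; rewrite /= le_eqVlt => /orP[/eqP z0|z0].
  exact: (wall y e _ Dy Ny (esym z0) e_gt0 erefl Hy).
have [b1 [Q [HJ HR HQ]]] := inner y Dy Ny z0.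
have nz : \forall x \near y, 0 < dotv x nu.
  exact: (cvgr_gt _ (@dotv_continuous R n nu y) _ z0).
pose M' := v y + e * psi y.
apply: (ell y Ny sy (e * s)).
  by rewrite mulr_gt0 //= -ltr_pdivlMr.
move=> x; apply: (@le_trans _ _ (e * quad Q (x *m tproj y))).
  by rewrite -mulrA ler_wpM2l // ltW.
apply: (@contact_ineq R n tau U f tau1 oU capU Cf Rob nu nu1 nuN y
   (fun x => dotv x nu * psi x) b1 Q e M' sy HJ HR (ltW e_gt0)).
  by rewrite half_cap_quotient // /M'; ring.
apply: filterS2 Hy nz => x' Hx' zx sx.
rewrite half_cap_quotient //.
have -> : v x' * dotv x' nu + e * (dotv x' nu * psi x') - M' * dotv x' nu =
  dotv x' nu * (v x' + e * psi x' - M') by ring.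
rewrite pmulr_rle0 // subr_le0; apply: Hx'; split => //=; exact: ltW.
Qed.

End NoTouching.

Lemma unit_dotv_le1 (R : realType) n (x y : 'rV[R]_n.+1) :
  dotv x x = 1 -> dotv y y = 1 -> dotv x y <= 1.
Proof. by move=> x1 y1; have := dotv_ge0 (x - y); rewrite !dotvL x1 y1 (dotvC y x); lra. Qed.

Lemma unit_dotv_eq1 (R : realType) n (x y : 'rV[R]_n.+1) :
  dotv x x = 1 -> dotv y y = 1 -> 1 <= dotv x y -> x = y.
Proof.
move=> x1 y1 xy; apply/eqP; rewrite -subr_eq0; apply/eqP/dotv_eq0.
apply/eqP; rewrite eq_le dotv_ge0 andbT !dotvL x1 y1 (dotvC y x); lra.
Qed.

Lemma tproj_contract (R : realType) n (x y : 'rV[R]_n.+1) : dotv y y = 1 ->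
  dotv (x *m tproj y) (x *m tproj y) <= dotv x x.
Proof.
move=> y1; rewrite mul_tproj !dotvL y1 (dotvC y x).
by have := sqr_ge0 (dotv x y); rewrite expr2; lra.
Qed.

(** * Maxima off the wall *)

Section InteriorTouching.
Variables (R : realType) (n k l : nat) (tau c0 : R) (U : set 'rV[R]_n.+1) (f : 'rV[R]_n.+1 -> R).
Hypothesis tau1 : tau ^+ 2 < 1.
Hypotheses (oU : open U) (capU : @scap R n tau `<=` U) (Cf : C2_on U f).
Local Notation E := (Ebasis R (@ord_max n)).
Local Notation scap := (@scap R n tau).
Hypothesis Rob : forall y, scap y -> y 0 ord_max = tau ->
  dotv (grad f y) (tau *: y - E) = tau * f y.
Hypotheses (kn : (k < n.+1)%N) (lk : (l < k)%N).
Hypothesis lev : forall y, scap y -> level k l c0 (Wtensor f y).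
Variable nu : 'rV[R]_n.+1.
Hypotheses (nu1 : dotv nu nu = 1) (nuN : nu 0 ord_max = 0).
Local Notation v := (rquot f nu).
Local Notation half_cap := (half_cap tau nu).

Lemma rquot_continuous_cap x : half_cap x -> {for x, continuous v}.
Proof.
by move=> [sx _]; apply: (rquot_continuous oU Cf); apply: capU => //; exact: refl_scap.
Qed.

Lemma closed_max_set M : closed (half_cap `&` [set x | v x = M]).
Proof.
have cD : closed half_cap by apply: compact_closed; [exact: norm_hausdorff|exact: scap_compact].
move=> x clx.
have Dx : half_cap x by apply: cD => B nB; have [y [[Dy _] By]] := clx B nB; exists y.
split => //=; apply/eqP/negPn/negP => vx.
have cvM : {for x, continuous (fun y => v y - M)}.
  exact: (cvgB (rquot_continuous_cap Dx) (cvg_cst M)).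
have nv : \forall y \near x, v y - M != 0.
  by apply: (cvgr_neq0 _ cvM); rewrite subr_eq0.
have [y [[_ /= vy] /=]] := clx _ nv.
by rewrite vy subrr eqxx.
Qed.

(** The sets [1 - <x, q> <= g <x, nu>] are geodesic balls growing with [g] around [q], all away from
    the wall. The point [p] is where this family first meets the maximum set, as in the proof of
    Hopf's strong maximum principle. *)
Lemma closest_max_point M p0 q : half_cap p0 -> 0 < dotv p0 nu -> v p0 = M ->
  scap q -> 0 < dotv q nu -> v q != M ->
  exists p g, [/\ half_cap p, 0 < dotv p nu, v p = M, 0 < g &
    1 - dotv p q = g * dotv p nu /\ forall x, half_cap x -> 0 < dotv x nu -> v x = M -> g * dotv x nu <= 1 - dotv x q].
Proof.
move=> Dp0 zp0 vp0 sq zq vq.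
pose g0 := (1 - dotv p0 q) / dotv p0 nu.
(* A sublevel set of the ratio, written without division so that it is closed. A wall point in it
   would satisfy [<x, q> >= 1], hence equal [q], which lies off the wall. *)
pose S := (half_cap `&` [set x | v x = M]) `&` [set x | 0 <= g0 * dotv x nu - (1 - dotv x q)].
have cS : compact S.
  apply: (subclosed_compact _ (@scap_compact R n tau nu)) => [|x [[Dx _] _]]; last exact: Dx.
  apply: closedI; first exact: closed_max_set.
  apply: (@closed_comp _ _ (fun x => g0 * dotv x nu - (1 - dotv x q)) [set z | 0 <= z]); last exact: closed_ge.
  move=> x _.
  exact: (cvgB (cvgM (cvg_cst g0) (@dotv_continuous R n nu x))
    (cvgB (cvg_cst (1 : R)) (@dotv_continuous R n q x))).
have Sz x : S x -> 0 < dotv x nu.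
  move=> [[[sx /= zx] _] /= h]; rewrite lt_neqAle zx andbT; apply/negP => /eqP z0.
  move: h; rewrite -z0 mulr0 sub0r opprB subr_ge0 => h.
  by move: zq; rewrite -(unit_dotv_eq1 sx.1 sq.1 h) -z0 ltxx.
have Sp0 : S p0 by split => //=; rewrite /g0 divfK ?subrr // gt_eqF.
pose g x := (1 - dotv x q) / dotv x nu.
have cg : {within S, continuous g}.
  apply: continuous_in_subspaceT => x; rewrite inE => Sx.
  have z0 : dotv x nu != 0 by rewrite gt_eqF // Sz.
  exact: (cvgM (cvgB (cvg_cst (1 : R)) (@dotv_continuous R n q x)) (cvgV z0 (@dotv_continuous R n nu x))).
have [p + Hp] := EVT_min_rV (ex_intro _ p0 Sp0) cS cg; rewrite inE => Sp.
have zp := Sz _ Sp.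
have [[Dp /= vp] _] := Sp.
exists p, (g p); split => //.
- rewrite /g divr_gt0 // subr_gt0 lt_neqAle unit_dotv_le1 ?Dp.1.1 ?sq.1 // andbT.
  apply/negP => /eqP pq; move: vq; rewrite -(@unit_dotv_eq1 _ _ p q) ?vp ?eqxx ?pq //.
    exact: Dp.1.1.
  exact: sq.1.
split=> [|]; first by rewrite /g divfK // gt_eqF.
move=> x Dx zx vx; have [h|h] := leP 0 (g0 * dotv x nu - (1 - dotv x q)).
  have Sx : S x by split.
  by have := Hp x; rewrite inE => /(_ Sx); rewrite [leRHS]/g ler_pdivlMr.
have h1 : g p <= g0 by have := Hp p0; rewrite inE => /(_ Sp0).
apply: (@le_trans _ _ (g0 * dotv x nu)); first by rewrite ler_pM2r.
by rewrite ltW // -subr_lt0.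
Qed.

End InteriorTouching.

Section InteriorMaximum.
Variables (R : realType) (n k l : nat) (tau c0 : R) (U : set 'rV[R]_n.+1) (f : 'rV[R]_n.+1 -> R).
Hypothesis tau1 : tau ^+ 2 < 1.
Hypotheses (oU : open U) (capU : @scap R n tau `<=` U) (Cf : C2_on U f).
Local Notation E := (Ebasis R (@ord_max n)).
Local Notation scap := (@scap R n tau).
Hypothesis Rob : forall y, scap y -> y 0 ord_max = tau ->
  dotv (grad f y) (tau *: y - E) = tau * f y.
Hypotheses (kn : (k < n.+1)%N) (lk : (l < k)%N).
Hypothesis lev : forall y, scap y -> level k l c0 (Wtensor f y).
Variable nu : 'rV[R]_n.+1.
Hypotheses (nu1 : dotv nu nu = 1) (nuN : nu 0 ord_max = 0).
Local Notation v := (rquot f nu).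
Local Notation half_cap := (half_cap tau nu).

Lemma no_interior_max M p0 q : (forall x, half_cap x -> v x <= M) ->
  half_cap p0 -> 0 < dotv p0 nu -> v p0 = M ->
  scap q -> 0 < dotv q nu -> v q = M.
Proof.
move=> vM Dp0 zp0 vp0 sq zq; apply/eqP/negPn/negP => vq.
have [p [g [Dp zp vp g0 [gp gmin]]]] := closest_max_point oU capU Cf nu1 nuN Dp0 zp0 vp0 sq zq vq.
have sp := Dp.1; have [p1 pN] := sp; have [q1 qN] := sq.
(* [p] minimises [(1 - <x, q>) / z], with minimum [g] and [z = <x, nu>], over the contact
   set [v = M], so [G >= 0] there with equality only at [p].  The barrier is
   [z psi = - ut + (al / 2) ut^2 / z], whose Hessian is [(al / z) m^T m] up to a bounded form. *)
pose Q := q + p + g *: nu.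
pose ut x := 2 - dotv x Q.
pose G x := ut x / dotv x nu.
have utp : ut p = 0 by rewrite /ut !dotvL p1; lra.
have Gp : G p = 0 by rewrite /G utp mul0r.
have cG x : 0 < dotv x nu -> {for x, continuous G}.
  move=> zx; have z0 : dotv x nu != 0 by rewrite gt_eqF.
  exact: (cvgM (cvgB (cvg_cst (2 : R)) (@dotv_continuous R n Q x)) (cvgV z0 (@dotv_continuous R n nu x))).
(* This is [- z] times the tangential gradient of [G], the direction in which the barrier is
   strongly convex. *)
pose m x := (Q + G x *: nu) *m tproj x.
have cm : mx_cvg (nbhs p) m (m p).
  apply: mx_cvgM; last exact: tproj_cvg.
  apply: mx_cvgD; first exact: mx_cvg_cst.
  apply: mx_cvgZ; [exact: cG|exact: mx_cvg_cst].
have mp0 : m p != 0.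
  (* At [p] one has [<Q, p> = 2], so [m p = q + g nu - p], and its product with [q + g nu] is
     [2 g <q, nu> + g^2 > 0]. *)
  apply/eqP => /(congr1 (fun w => dotv w (q + g *: nu))).
  rewrite dotv0l /m Gp scale0r addr0 mul_tproj /Q !dotvL p1 q1 nu1 (dotvC q p) (dotvC nu p) (dotvC nu q).
  have -> : dotv p q = 1 - g * dotv p nu by lra.
  move: zp zq g0; move: (dotv p nu) (dotv q nu) => a b a0 b0 g0.
  have ab : 0 < g * b by rewrite mulr_gt0.
  have g2 : 0 < g * g by rewrite mulr_gt0.
  nra.
have dQ x : dotv x Q = dotv x q + dotv x p + g * dotv x nu by rewrite !dotvL.
have QN : Q 0 ord_max = q 0 ord_max + p 0 ord_max by rewrite !mxE nuN mulr0 addr0.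
clearbody Q.
have [eta eta0 [e0 e00 ell]] := cap_ellipticity capU Cf kn lk lev nu1 nuN sp cm mp0.
(* The scalar part of the barrier tensor is [2 (1 - al G)], at most 4 when [|al G| < 1]; hence
   [al eta = 4]. *)
pose al := 4 / eta.
have al0 : 0 < al by rewrite divr_gt0.
pose psi x := - G x + al / 2 * G x ^+ 2.
pose N := [set x | 0 < dotv x nu /\ `|G x| < al^-1] `&` [set y | scap y -> forall e : R, 0 < e < e0 ->
    ~ (forall x, e * (dotv x (m y) ^+ 2 - eta * dotv x x) <=
        quad (reflW f nu y) x - quad (Wtensor f y) x)].
have nN : nbhs p N.
  apply: filterI; last exact: ell.
  apply: filterI; first exact: (cvgr_gt _ (@dotv_continuous R n nu p) _ zp).
  have cnG : `|G x| @[x --> p] --> `|G p| by exact: (cvg_norm (cG p zp)).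
  by apply: (cvgr_lt _ cnG); rewrite Gp normr0 invr_gt0.
have GN x : N x -> `|al * G x| < 1.
  by move=> [[_ h] _]; rewrite normrM gtr0_norm // mulrC -ltr_pdivlMr // div1r.
apply: (@no_touching R n tau U f tau1 oU capU Cf Rob nu nu1 nuN p M psi m eta e0 al N) => //.
- by rewrite /psi Gp oppr0 expr0n mulr0 addr0.
- by move=> y [_ h] sy; exact: h.
- move=> x _ [[zx _] _].
  have c1 := cG x zx.
  exact: (cvgD (cvgN c1) (cvgM (cvg_cst (al / 2)) (cvgM c1 c1))).
- move=> x Dx Nx psi0 vx; have [[zx _] _] := Nx.
  have h := GN x Nx; have := gmin x Dx zx vx => gx.
  have up : 0 <= 1 - dotv x p by rewrite subr_ge0 unit_dotv_le1 // Dx.1.1.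
  have utE : ut x = (1 - dotv x q - g * dotv x nu) + (1 - dotv x p).
    by rewrite /ut dQ; ring.
  have G0 : 0 <= G x by rewrite divr_ge0 ?(ltW zx) // utE; lra.
  have G1 : G x <= 0.
    rewrite leNgt; apply/negP => Gpos; move: psi0; rewrite /psi leNgt => /negP; apply.
    have := ltr_normlW h; move: (G x) Gpos => a a0 aa.
    have : al * a * a < 1 * a by rewrite ltr_pM2r.
    by rewrite expr2; lra.
  have : ut x = 0 by rewrite -[ut x](@divfK _ (dotv x nu)) ?gt_eqF // -/(G x) (le_anti (introT andP (conj G1 G0))) mul0r.
  rewrite utE => h0; apply: unit_dotv_eq1; [exact: Dx.1.1|exact: p1|lra].
- move=> y [sy _] Ny z0; have h := GN y Ny; have [y1 yN] := sy.
  have zne : dotv y nu != 0 by rewrite gt_eqF.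
  pose w := Q + G y *: nu.
  exists ((1 - al * G y) *: Q - (al / 2 * G y ^+ 2) *: nu).
  exists ((al / dotv y nu) *: (w^T *m w) + (- (2 * (1 - al * G y)))%:M).
  split.
  + move=> x x1 xy.
    have Jz := jet_great_circle_dotv y x nu.
    have Ju := jetB (jet_cst (2 : R)) (jet_great_circle_dotv y x Q).
    have zne' : dotv (great_circle y x 0) nu != 0 by rewrite great_circle0.
    have JG := jetM Ju (jetV zne' Jz).
    have J := jetM Jz (jetD (jetN JG) (jetZ (al / 2) (jetM JG JG))).
    rewrite quadD quadZ quad_rank1 quad_scalar -dotvE x1.
    apply: jet_eq J _ _; rewrite ?great_circle0 /psi /w !dotvL /G /ut ?(dotvC Q x) ?(dotvC nu x).
      by field.
    by field.
  + move=> yt; rewrite /psi.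
    have muQ : dotv Q (tau *: y - E) = tau * (2 - ut y) - (q 0 ord_max + p 0 ord_max).
      by rewrite !dotvL dotv_Ebasis QN /ut (dotvC y); ring.
    have munu : dotv nu (tau *: y - E) = tau * dotv y nu.
      by rewrite !dotvL dotv_Ebasis nuN (dotvC nu y) subr0.
    rewrite dotvDl dotvNl !dotvZl muQ munu.
    have -> : ut y = G y * dotv y nu by rewrite /G divfK.
    have hG := ltr_normlW h.
    rewrite -subr_ge0.
    (* The boundary defect reduces to a multiple of [q_N + p_N - 2 tau], nonnegative since both
       points lie in the cap, whatever the sign of [tau]. *)
    have -> : tau * (dotv y nu * (- G y + al / 2 * G y ^+ 2)) -
      ((1 - al * G y) * (tau * (2 - G y * dotv y nu) - (q 0 ord_max + p 0 ord_max)) -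
       al / 2 * G y ^+ 2 * (tau * dotv y nu)) =
      (1 - al * G y) * (q 0 ord_max + p 0 ord_max - 2 * tau) by field.
    by rewrite mulr_ge0 // subr_ge0; lra.
  + move=> x; rewrite quadD quadZ quad_rank1 quad_scalar -dotvE dotv_tproj -/(m y).
    have hz : dotv y nu <= 1 by exact: unit_dotv_le1.
    have h1 : al * dotv x (m y) ^+ 2 <= al / dotv y nu * dotv x (m y) ^+ 2.
      by rewrite ler_wpM2r ?sqr_ge0 // ler_pdivlMr // ger_pMr.
    have h2 : 2 * (1 - al * G y) * dotv (x *m tproj y) (x *m tproj y) <= 4 * dotv x x.
      apply: ler_pM; rewrite ?dotv_ge0 ?tproj_contract //.
        by have := ltr_normlW h; lra.
      by move: h; rewrite -normrN => /ltr_normlW; lra.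
    have h3 : al * (eta * dotv x x) = 4 * dotv x x by rewrite mulrA /al divfK // gt_eqF.
    rewrite mulrBr h3 mulNr; lra.
- by move=> y e M' _ [[zy _] _] y0; move: zy; rewrite y0 ltxx.
Qed.

End InteriorMaximum.

(** * Maxima on the wall and at the corner *)

Section WallTouching.
Variables (R : realType) (n k l : nat) (tau c0 : R) (U : set 'rV[R]_n.+1) (f : 'rV[R]_n.+1 -> R).
Hypothesis tau1 : tau ^+ 2 < 1.
Hypotheses (oU : open U) (capU : @scap R n tau `<=` U) (Cf : C2_on U f).
Local Notation E := (Ebasis R (@ord_max n)).
Local Notation scap := (@scap R n tau).
Hypothesis Rob : forall y, scap y -> y 0 ord_max = tau ->
  dotv (grad f y) (tau *: y - E) = tau * f y.
Hypotheses (kn : (k < n.+1)%N) (lk : (l < k)%N).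
Hypothesis lev : forall y, scap y -> level k l c0 (Wtensor f y).
Variable nu : 'rV[R]_n.+1.
Hypotheses (nu1 : dotv nu nu = 1) (nuN : nu 0 ord_max = 0).
Local Notation v := (rquot f nu).
Local Notation half_cap := (half_cap tau nu).

(** A circle about [y0] leaving the wall along [nu]. The centre is free so that both a great circle
    and a circle of latitude are covered. *)
Definition arc y0 x (r : R) (s : R) : 'rV[R]_n.+1 := y0 + cos s *: x + (r * sin s) *: nu.

Lemma arc_vjet y0 x r : vjet (arc y0 x r) (r *: nu) (- x).
Proof.
move=> i; rewrite !mxE (_ : (fun s => _) = fun s => y0 0 i + x 0 i * cos s + r * nu 0 i * sin s).
  apply: jet_eq (jetD (jetD (jet_cst (y0 0 i)) (jet_cos (x 0 i))) (jet_sin (r * nu 0 i))) _ _.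
    by rewrite !add0r.
  by rewrite add0r addr0.
by apply/funext => s; rewrite /arc !mxE; ring.
Qed.

Lemma arc0 y0 x r : arc y0 x r 0 = y0 + x.
Proof. by rewrite /arc cos0 sin0 mulr0 scale1r scale0r addr0. Qed.

Lemma arc_dotv y0 x r u s :
  dotv (arc y0 x r s) u = dotv y0 u + dotv x u * cos s + r * dotv nu u * sin s.
Proof. by rewrite !dotvL; ring. Qed.

Lemma jet_arc_dotv y0 x r u :
  jet (fun s => dotv (arc y0 x r s) u) (r * dotv nu u) (- dotv x u).
Proof.
under eq_fun do rewrite arc_dotv.
apply: jet_eq (jetD (jetD (jet_cst _) (jet_cos _)) (jet_sin _)) _ _; first by rewrite !add0r.
by rewrite add0r addr0.
Qed.

Lemma refl_arc y0 x r s : dotv y0 nu = 0 -> dotv x nu = 0 ->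
  refl nu (arc y0 x r s) = arc y0 x (- r) s.
Proof.
move=> h0 hx; rewrite /refl arc_dotv h0 hx nu1 /arc.
rewrite -addrA -scalerBl; congr (_ + _ *: _); ring.
Qed.

(* Along an arc crossing the wall [dotv y nu = 0] orthogonally the odd part of [f]
   has vanishing second derivative, so [e * b''] alone decides the sign. *)
Lemma arc_second_order y0 x r (b : 'rV[R]_n.+1 -> R) (b1 b2 e M' : R) :
  dotv y0 nu = 0 -> dotv x nu = 0 -> 0 < r -> scap (y0 + x) ->
  (\forall s \near (0 : R), 0 <= s -> scap (arc y0 x r s)) ->
  jet (fun s => b (arc y0 x r s)) b1 b2 -> b (y0 + x) = 0 -> 0 < e ->
  2 * r * dotv (grad f (y0 + x)) nu + e * b1 = M' * r ->
  (\forall y \near (y0 + x), half_cap y -> f y - f (refl nu y) + e * b y - M' * dotv y nu <= 0) ->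
  b2 <= 0.
Proof.
move=> h0 hx r0 sy ns Jb b0 e0 E1 ny.
have Uy : U (y0 + x) by exact: capU.
have J1 := jet_comp oU Cf _ (arc_vjet y0 x r); rewrite arc0 in J1.
have J2 := jet_comp oU Cf _ (arc_vjet y0 x (- r)); rewrite arc0 in J2.
have J := jetB (jetD (jetB (J1 Uy) (J2 Uy)) (jetZ e Jb)) (jetZ M' (jet_arc_dotv y0 x r nu)).
have := jet_le0 J; rewrite !arc0 subrr b0 mulr0 add0r dotvDl h0 hx addr0 mulr0 subr0.
move=> /(_ erefl) [].
  have nsin : \forall s \near (0 : R), s < pi by exact: (cvgr_lt _ (@cvg_id _ (nbhs (0 : R))) _ (pi_gt0 R)).
  have ca := vjet_continuous (arc_vjet y0 x r).
  have ny' : nbhs (arc y0 x r 0) [set y | half_cap y -> f y - f (refl nu y) + e * b y - M' * dotv y nu <= 0].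
    by rewrite arc0.
  have := ca _ ny'; rewrite /= => na.
  apply: filterS3 ns nsin na => s sa spi ha s0.
  rewrite -refl_arc //; apply: ha; split; first exact: sa.
  by rewrite /= arc_dotv h0 hx nu1 mul0r !add0r mulr1 mulr_ge0 ?(ltW r0) // sin_ge0_pi // s0 ltW.
move=> _; rewrite !quad_scale sqrrN nu1 mulr1 !dotvZr.
have -> : r * dotv (grad f (y0 + x)) nu - - r * dotv (grad f (y0 + x)) nu + e * b1 - M' * r = 0.
  by rewrite -E1; ring.
move=> /(_ erefl); by rewrite subrr add0r ?hx ?oppr0 ?mulr0 ?subr0 pmulr_rle0.
Qed.

Lemma cap_height_lt1 y : scap y -> `|tau * y 0 ord_max| < 1.
Proof.
move=> [y1 _]; rewrite normrM.
have h1 : y 0 ord_max ^+ 2 <= 1.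
  by have := dotv_cauchy_schwarz y E; rewrite !dotv_Ebasis y1 mxE !eqxx mulr1.
have h2 : `|y 0 ord_max| <= 1 by rewrite -(@ler_pXn2r _ 2) ?nnegrE // expr1n real_normK ?num_real.
have h3 : `|tau| < 1 by rewrite -(@ltr_pXn2r _ 2) ?nnegrE // expr1n real_normK ?num_real.
by apply: le_lt_trans h3; rewrite ler_piMr.
Qed.

Lemma wall_touching p M : (forall x, half_cap x -> v x <= M) ->
  half_cap p -> v p = M -> (forall x, half_cap x -> v x = M -> dotv x nu = 0) -> False.
Proof.
move=> vM Dp vp Swall; have zp := Swall p Dp vp; have sp := Dp.1; have [p1 pN] := sp.
have EE : E 0 ord_max = 1 by rewrite mxE !eqxx.
(* [ell] is the model solution, so quotients by it absorb the Robin condition.  With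
   [z = <x, nu>] and [u = 1 - <x, p>] the barrier is [z psi = z (z - u) / ell]. *)
pose ell x := 1 - tau * dotv x E.
have ell0 x : scap x -> 0 < ell x < 2.
  move=> /cap_height_lt1; rewrite /ell dotv_Ebasis => h.
  by have := ltr_normlW h; move: h; rewrite -normrN => /ltr_normlW; lra.
have ellne x : scap x -> ell x != 0 by move=> /ell0 /andP[h _]; rewrite gt_eqF.
pose Z x := dotv x nu / ell x.
pose Y x := (1 - dotv x p) / ell x.
have cell x : {for x, continuous ell}.
  exact: (cvgB (cvg_cst (1 : R)) (cvgM (cvg_cst tau) (@dotv_continuous R n E x))).
have cZ x : scap x -> {for x, continuous Z}.
  by move=> sx; exact: (cvgM (@dotv_continuous R n nu x) (cvgV (ellne x sx) (cell x))).
have cY x : scap x -> {for x, continuous Y}.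
  move=> sx; exact: (cvgM (cvgB (cvg_cst (1 : R)) (@dotv_continuous R n p x)) (cvgV (ellne x sx) (cell x))).
have Zp : Z p = 0 by rewrite /Z zp mul0r.
have Yp : Y p = 0 by rewrite /Y p1 subrr mul0r.
(* [wp + wm] and [wp - wm] are [2 ell] times the gradients of [Z] and of [Z - Y]. The mixed term of
   the barrier tensor is a product of these two, written as a difference of squares. *)
pose wp x := 2 *: nu + p + (tau * (2 * Z x - Y x)) *: E.
pose wm x := - p + (tau * Y x) *: E.
pose m x := wp x *m tproj x.
have cm : mx_cvg (nbhs p) m (m p).
  apply: mx_cvgM; last exact: tproj_cvg.
  apply: mx_cvgD; first exact: mx_cvg_cst.
  apply: mx_cvgZ; last exact: mx_cvg_cst.
  exact: (cvgM (cvg_cst tau) (cvgB (cvgM (cvg_cst (2 : R)) (cZ p sp)) (cY p sp))).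
have mp0 : m p != 0.
  apply/eqP => /(congr1 (fun w => dotv w nu)).
  rewrite dotv0l /m /wp Zp Yp mulr0 subrr mulr0 scale0r addr0 mul_tproj !dotvL nu1 zp; lra.
have [eta eta0 [e0 e00 ellip]] := cap_ellipticity capU Cf kn lk lev nu1 nuN sp cm mp0.
pose psi x := Z x - Y x.
(* Bounds what can be negative in the barrier tensor: the square of [wm], by Cauchy-Schwarz, and the
   scalar part. At [p] the vector [wm] is normal to the sphere and [Z = 0], so [kap p = 0]. *)
pose kap x := dotv (wm x *m tproj x) (wm x *m tproj x) / (2 * ell x) + `|Z x * (1 + Z x - Y x)|.
have ckap : {for p, continuous kap}.
  have cwm : mx_cvg (nbhs p) (fun x => wm x *m tproj x) (wm p *m tproj p).
    apply: mx_cvgM; last exact: tproj_cvg.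
    apply: mx_cvgD; first exact: mx_cvg_cst.
    apply: mx_cvgZ; last exact: mx_cvg_cst.
    exact: (cvgM (cvg_cst tau) (cY p sp)).
  have c1 : dotv (wm x *m tproj x) (wm x *m tproj x) @[x --> p] -->
      dotv (wm p *m tproj p) (wm p *m tproj p) by exact: (dotv_cvg cwm cwm).
  have c2 : (2 * ell x)^-1 @[x --> p] --> (2 * ell p)^-1.
    have n2 : 2 * ell p != 0 by rewrite mulf_neq0 // ellne.
    exact: (cvgV n2 (cvgM (cvg_cst (2 : R)) (cell p))).
  have c3 : (1 + Z x - Y x) @[x --> p] --> 1 + Z p - Y p.
    exact: (cvgB (cvgD (cvg_cst (1 : R)) (cZ p sp)) (cY p sp)).
  exact: (cvgD (cvgM c1 c2) (cvg_norm (cvgM (cZ p sp) c3))).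
have kapp : kap p = 0.
  rewrite /kap Zp mul0r normr0 addr0 /wm Yp mulr0 scale0r addr0 mul_tproj.
  by rewrite !dotvL p1 (_ : _ + _ = 0) ?mul0r //; ring.
pose N := [set x | kap x < eta / 4] `&` [set y | scap y -> forall e : R, 0 < e < e0 ->
    ~ (forall x, e * (dotv x (m y) ^+ 2 - eta * dotv x x) <=
        quad (reflW f nu y) x - quad (Wtensor f y) x)].
have nN : nbhs p N.
  apply: filterI; last exact: ellip.
  by apply: (cvgr_lt _ ckap); rewrite kapp divr_gt0.
(* The factor 1/4 comes from [ell < 2], which gives [1 / (2 ell) >= 1/4]; it matches the bound
   [eta / 4] on [kap]. *)
apply: (@no_touching R n tau U f tau1 oU capU Cf Rob nu nu1 nuN p M psi m eta e0 (4^-1) N) => //.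
- by rewrite /psi Zp Yp subrr.
- by move=> y [_ h] sy; exact: h.
- by move=> x [sx _] _; exact: (cvgB (cZ x sx) (cY x sx)).
- move=> x Dx Nx psi0 vx; have zx := Swall x Dx vx; have sx := Dx.1.
  apply: unit_dotv_eq1; [exact: sx.1|exact: p1|].
  move: psi0; rewrite /psi /Z zx mul0r sub0r oppr_ge0 /Y.
  have /andP[h _] := ell0 x sx.
  by rewrite pmulr_lle0 ?invr_gt0 // subr_le0.
- move=> y [sy _] Ny z0; have [y1 yN] := sy; have ey := ellne y sy.
  have /andP[ey0 ey2] := ell0 y sy.
  exists ((2 * Z y - Y y) *: nu + Z y *: p + (tau * Z y * (Z y - Y y)) *: E).
  exists ((2 * ell y)^-1 *: ((wp y)^T *m wp y + (-1) *: ((wm y)^T *m wm y)) + (- (Z y * (1 + Z y - Y y)))%:M).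
  split.
  + move=> x x1 xy.
    have Jz := jet_great_circle_dotv y x nu.
    have Ju := jetB (jet_cst (1 : R)) (jet_great_circle_dotv y x p).
    have Jl := jetB (jet_cst (1 : R)) (jetZ tau (jet_great_circle_dotv y x E)).
    have l0 : 1 - tau * dotv (great_circle y x 0) E != 0 by rewrite great_circle0.
    have JV := jetV l0 Jl.
    have J := jetM Jz (jetB (jetM Jz JV) (jetM Ju JV)).
    rewrite quadD quadZ quadD quadZ !quad_rank1 quad_scalar -!dotvE x1.
    apply: jet_eq J _ _; rewrite ?great_circle0 /psi /wp /wm !dotvL /Z /Y /ell
      ?(dotvC nu x) ?(dotvC p x) ?(dotvC E x); field; exact: ey.
  + move=> yt; rewrite /psi.
    have munu : dotv nu (tau *: y - E) = tau * dotv y nu.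
      by rewrite !dotvL dotv_Ebasis nuN (dotvC nu y) subr0.
    have mup : dotv p (tau *: y - E) = tau * dotv y p - p 0 ord_max.
      by rewrite !dotvL dotv_Ebasis (dotvC p y).
    have muE : dotv E (tau *: y - E) = - ell y.
      by rewrite !dotvL /ell (dotvC E y) !dotv_Ebasis yt EE; ring.
    rewrite 2!dotvDl !dotvZl munu mup muE -subr_ge0.
    rewrite [leRHS](_ : _ = Z y * (p 0 ord_max - tau)); last first.
      by rewrite /Z /Y; field.
    by rewrite mulr_ge0 ?subr_ge0 // divr_ge0 // ltW.
  + move=> x; rewrite quadD quadZ quadD quadZ !quad_rank1 quad_scalar -!dotvE.
    have [kapy _] := Ny.
    rewrite !dotv_tproj -/(m y).
    set d := wm y *m tproj y; set xx := dotv x (_ *m tproj y).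
    have xxE : xx = dotv (x *m tproj y) (x *m tproj y) by rewrite dotv_tproj.
    have xx0 : 0 <= xx by rewrite xxE dotv_ge0.
    have xx1 : xx <= dotv x x by rewrite xxE tproj_contract.
    have h1 : dotv x d ^+ 2 <= xx * dotv d d.
      rewrite xxE -[d](_ : d *m tproj y = d); last by rewrite tproj_id // tproj_orth.
      by rewrite -dotv_tproj; apply: le_trans (dotv_cauchy_schwarz _ _) _; rewrite [d *m _]tproj_id // tproj_orth.
    have i0 : 0 < (2 * ell y)^-1 by rewrite invr_gt0 mulr_gt0.
    have i1 : 4^-1 <= (2 * ell y)^-1 by rewrite lef_pV2 ?posrE ?mulr_gt0 //; lra.
    have h2 : 4^-1 * dotv x (m y) ^+ 2 <= (2 * ell y)^-1 * dotv x (m y) ^+ 2.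
      by rewrite ler_wpM2r ?sqr_ge0.
    have h3 : (2 * ell y)^-1 * dotv x d ^+ 2 <= (2 * ell y)^-1 * (xx * dotv d d) by rewrite ler_pM2l.
    have h4 : Z y * (1 + Z y - Y y) * xx <= `|Z y * (1 + Z y - Y y)| * xx.
      by rewrite ler_wpM2r // ler_norm.
    have h5 : kap y * xx <= eta / 4 * dotv x x.
      apply: ler_pM => //; last exact: ltW.
      by rewrite addr_ge0 // divr_ge0 ?dotv_ge0 // mulr_ge0 // ltW.
    move: h5; rewrite /kap -/d mulrDl => h5.
    have h6 : (2 * ell y)^-1 * (xx * dotv d d) = dotv d d / (2 * ell y) * xx by ring.
    rewrite h6 in h3; rewrite mulrDr mulN1r mulrN mulNr; lra.
- move=> y e M' Dy Ny z0 e_gt0 EM nM; have [sy _] := Dy; have [y1 yN] := sy.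
  have ey := ellne y sy.
  have /andP[ey0 ey2] := ell0 y sy.
  pose b x := dotv x nu * psi x.
  have vE : v y = 2 * dotv (grad f y) nu by rewrite /rquot z0 eqxx.
  have nF : \forall x \near y, half_cap x -> f x - f (refl nu x) + e * b x - M' * dotv x nu <= 0.
    apply: filterS nM => x Hx Dx; have [sx] := Dx; rewrite /= le_eqVlt => /orP[/eqP zx|zx].
      by rewrite /b /refl -zx mulr0 scale0r subr0 subrr !mul0r !mulr0 subr0 addr0.
    rewrite half_cap_quotient // /b.
    have -> : v x * dotv x nu + e * (dotv x nu * psi x) - M' * dotv x nu =
       dotv x nu * (v x + e * psi x - M') by ring.
    by rewrite pmulr_rle0 // subr_le0; exact: Hx.
  have key y0 x r : y = y0 + x -> dotv y0 nu = 0 -> dotv x nu = 0 -> 0 < r ->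
     (\forall s \near (0 : R), 0 <= s -> scap (arc y0 x r s)) -> False.
    move=> yE h0 hx r0 ns.
    have Jz := jet_arc_dotv y0 x r nu.
    have Ju := jetB (jet_cst (1 : R)) (jet_arc_dotv y0 x r p).
    have Jl := jetB (jet_cst (1 : R)) (jetZ tau (jet_arc_dotv y0 x r E)).
    have l0 : 1 - tau * dotv (arc y0 x r 0) E != 0 by rewrite arc0 -yE.
    have JV := jetV l0 Jl.
    have J := jetM Jz (jetB (jetM Jz JV) (jetM Ju JV)).
    have nup : dotv nu p = 0 by rewrite dotvC.
    have nuE : dotv nu E = 0 by rewrite dotv_Ebasis.
    rewrite !arc0 -yE z0 hx nup nuE nu1 !mulr0 in J.
    (* As [z = 0] at [y], the second derivative of [z psi] is [2 z' psi'] with [z' = r] and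
       [psi' = r / ell]; [u] and [ell] are stationary because [p] and [E] are orthogonal to [nu].
       Its positivity is the contradiction. *)
    have J' : jet (fun s => b (arc y0 x r s)) (r * psi y) (2 * r ^+ 2 / ell y).
      apply: jet_eq J _ _; rewrite /psi /Z /Y ?z0 /ell; first by field.
      by field.
    have := @arc_second_order y0 x r b _ _ e M' h0 hx r0 _ ns J'.
    rewrite -yE => /(_ sy); rewrite /b z0 mul0r => /(_ erefl e_gt0).
    have -> : 2 * r * dotv (grad f y) nu + e * (r * psi y) = M' * r.
      by rewrite -EM vE; ring.
    by move=> /(_ erefl nF); apply/negP; rewrite -ltNge divr_gt0 // mulr_gt0 // exprn_gt0.
  move: yN; rewrite le_eqVlt => /orP[/eqP yt|yt]; last first.
    apply: (key 0 y 1); rewrite ?add0r ?dotv0l //.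
    have nuy : dotv nu y = 0 by rewrite dotvC.
    have -> : arc 0 y 1 = great_circle y nu by apply/funext => s; rewrite /arc add0r mul1r.
    exact: (great_circle_feasible sy nu1 nuy (or_introl yt)).
  (* At the corner the great circle along [nu] has height [tau cos s], which leaves the cap when
     [tau > 0]. The circle of latitude through [y], of radius [r], stays on the rim. *)
  pose r := Num.sqrt (1 - tau ^+ 2).
  have r2 : r ^+ 2 = 1 - tau ^+ 2 by rewrite sqr_sqrtr // subr_ge0 ltW.
  apply: (key (tau *: E) (y - tau *: E) r).
  + by rewrite addrC subrK.
  + by rewrite dotvZl dotvC dotv_Ebasis nuN mulr0.
  + by rewrite !dotvL z0 (dotvC E) dotv_Ebasis nuN mulr0 subr0.
  + by rewrite sqrtr_gt0 subr_gt0.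
  apply: (@filterE _ (nbhs (0 : R))) => s _; split; last first.
    by rewrite -[X in _ <= X]dotv_Ebasis arc_dotv !dotvL !dotv_Ebasis nuN -yt EE; lra.
  have d1 : dotv E E = 1 by rewrite dotv_Ebasis EE.
  have d2 : dotv y E = tau by rewrite dotv_Ebasis.
  have d3 : dotv E y = tau by rewrite dotvC.
  have d4 : dotv nu E = 0 by rewrite dotv_Ebasis.
  have d5 : dotv E nu = 0 by rewrite dotvC.
  have d6 : dotv nu y = 0 by rewrite dotvC.
  rewrite /arc !dotvL d1 d2 d3 d4 d5 d6 y1 nu1 z0.
  transitivity (tau ^+ 2 + (1 - tau ^+ 2) * cos s ^+ 2 + r ^+ 2 * sin s ^+ 2); first by ring.
  by rewrite r2 -addrA -mulrDr cos2Dsin2; ring.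
Qed.

End WallTouching.

Section ReflectionIdentity.
Variables (R : realType) (n k l : nat) (tau c0 : R) (U : set 'rV[R]_n.+1) (f : 'rV[R]_n.+1 -> R).
Hypothesis tau1 : tau ^+ 2 < 1.
Hypotheses (oU : open U) (capU : @scap R n tau `<=` U) (Cf : C2_on U f).
Local Notation E := (Ebasis R (@ord_max n)).
Local Notation scap := (@scap R n tau).
Hypothesis Rob : forall y, scap y -> y 0 ord_max = tau ->
  dotv (grad f y) (tau *: y - E) = tau * f y.
Hypotheses (kn : (k < n.+1)%N) (lk : (l < k)%N).
Hypothesis lev : forall y, scap y -> level k l c0 (Wtensor f y).
Variable nu : 'rV[R]_n.+1.
Hypotheses (nu1 : dotv nu nu = 1) (nuN : nu 0 ord_max = 0).
Local Notation v := (rquot f nu).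
Local Notation half_cap := (half_cap tau nu).

Lemma pole_last : E 0 ord_max = 1.
Proof. by rewrite mxE !eqxx. Qed.

Lemma pole_unit : dotv E E = 1.
Proof. by rewrite dotv_Ebasis pole_last. Qed.

Lemma height_lt1 : tau < 1.
Proof.
by apply: ltr_normlW; rewrite -(@ltr_pXn2r _ 2) ?nnegrE // expr1n real_normK ?num_real.
Qed.

Lemma pole_scap : scap E.
Proof. by split; [exact: pole_unit|rewrite pole_last ltW // height_lt1]. Qed.

Lemma rquot_constant : exists M, forall q, scap q -> 0 < dotv q nu -> v q = M.
Proof.
have DE : half_cap E by split; [exact: pole_scap|rewrite /= dotvC dotv_Ebasis nuN].
have cv : {within half_cap, continuous v}.
  apply: continuous_in_subspaceT => x; rewrite inE.
  exact: (rquot_continuous_cap oU capU Cf nu1 nuN).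
have [p + Hp] := EVT_max_rV (ex_intro _ E DE) (@scap_compact R n tau nu) cv.
rewrite inE => Dp; exists (v p) => q sq zq.
have vM x : half_cap x -> v x <= v p by move=> Dx; apply: Hp; rewrite inE.
have [[x [Dx zx vx]]|nox] := pselect (exists x, [/\ half_cap x, 0 < dotv x nu & v x = v p]).
  exact: (no_interior_max tau1 oU capU Cf Rob kn lk lev nu1 nuN vM Dx zx vx sq zq).
exfalso; apply: (wall_touching tau1 oU capU Cf Rob kn lk lev nu1 nuN vM Dp erefl) => x Dx vx.
apply/eqP; have [_ /=] := Dx; rewrite le_eqVlt => /orP[/eqP <- //|zx].
by exfalso; apply: nox; exists x.
Qed.

(** The constant value of the quotient is identified by differentiating at the pole along [nu].
    Points with [<y, nu> < 0] follow by applying the identity to their mirror image. *)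
Lemma reflection_identity y : scap y ->
  f y - f (refl nu y) = 2 * dotv (grad f E) nu * dotv y nu.
Proof.
have [M HM] := rquot_constant.
have HMz q : scap q -> 0 <= dotv q nu -> f q - f (refl nu q) = M * dotv q nu.
  move=> sq; rewrite le_eqVlt => /orP[/eqP zq|zq].
    by rewrite -zq mulr0 /refl -zq mulr0 scale0r subr0 subrr.
  by rewrite half_cap_quotient // HM.
have sE := pole_scap; have UE := capU sE.
have nuE : dotv nu E = 0 by rewrite dotv_Ebasis.
have rE : refl nu E = E by rewrite /refl dotvC nuE mulr0 scale0r subr0.
have -> : 2 * dotv (grad f E) nu = M.
  have rnu : refl nu nu = - nu.
    by rewrite /refl nu1 mulr1 scaler_nat mulr2n opprD addrA subrr sub0r.
  have nn1 : dotv (- nu) (- nu) = 1 by rewrite !dotvL opprK.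
  have nnE : dotv (- nu) E = 0 by rewrite dotvNl nuE oppr0.
  have J1 := jet_great_circle oU Cf UE nu1 nuE.
  have J2 := jet_great_circle oU Cf UE nn1 nnE.
  have J := jetB (jetB J1 J2) (jetZ M (jet_great_circle_dotv E nu nu)).
  (* [F] is known to vanish only for [s >= 0]; the one-sided test applied to [F] and to [- F] gives
     [F'(0) = 0]. *)
  pose F s := f (great_circle E nu s) - f (great_circle E (- nu) s) - M * dotv (great_circle E nu s) nu.
  have F0 : F 0 = 0 by rewrite /F !great_circle0 subrr sub0r dotvC nuE mulr0 oppr0.
  have nF : \forall s \near (0 : R), 0 <= s -> F s = 0.
    have nsin : \forall s \near (0 : R), s < pi by exact: (cvgr_lt _ (@cvg_id _ (nbhs (0 : R))) _ (pi_gt0 R)).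
    have tE : tau < E 0 ord_max by rewrite pole_last height_lt1.
    have nf := great_circle_feasible sE nu1 nuE (or_introl tE).
    apply: filterS2 nsin nf => s spi sf s0.
    rewrite /F -[in X in _ - X - _]rE -rnu -refl_great_circle HMz ?subrr //; first exact: sf.
    by rewrite great_circle_dotv (dotvC E) nuE nu1 mul0r add0r mul1r sin_ge0_pi // s0 ltW.
  have h1 : dotv (grad f E) nu - dotv (grad f E) (- nu) - M * dotv nu nu <= 0.
    have [] := jet_le0 J F0; last by [].
    by apply: filterS nF => s H s0; rewrite -/(F s) H.
  have h2 : - (dotv (grad f E) nu - dotv (grad f E) (- nu) - M * dotv nu nu) <= 0.
    have nF0 : - F 0 = 0 by rewrite F0 oppr0.
    have [] := jet_le0 (jetN J) nF0; last by [].
    by apply: filterS nF => s H s0; rewrite -/(F s) H // oppr0.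
  by move: h1 h2; rewrite dotvNr nu1; lra.
move=> sy; have [zy|zy] := leP 0 (dotv y nu); first exact: HMz.
have := HMz _ (refl_scap nu1 nuN sy); rewrite reflK // refl_nu // => H.
by rewrite -opprB H ?mulrN ?opprK // oppr_ge0 ltW.
Qed.

End ReflectionIdentity.

(** * Rotationally symmetric solutions *)

Section ElsymNseq.
Variable R : realType.

Lemma elsym_cons_top (a : R) (s : seq R) :
  elsym (a :: s) (size s).+1 = a * elsym s (size s).
Proof.
rewrite /elsym /= !subnn big_cons mulrBl coefB coefXM coefCM /=.
by rewrite sub0r !exprS; ring.
Qed.

Lemma elsym_nseq m (p : R) j : (j <= m)%N -> elsym (nseq m p) j = 'C(m, j)%:R * p ^+ j.
Proof.
elim: m j => [|m IH] [|j] //; rewrite ?elsym0 ?bin0 ?expr0 ?mulr1 // ltnS leq_eqVlt.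
case/orP => [/eqP ->|jm].
  have := elsym_cons_top p (nseq m p); rewrite size_nseq => ->.
  by rewrite IH // !binn !mul1r exprS.
by rewrite /= elsym_cons ?size_nseq // !IH ?(ltnW jm) // binS natrD exprS; ring.
Qed.

(** Multiplying by [m + 1] turns both Pascal terms into multiples of one binomial. At [j = 0] the
    truncated exponent [j.-1] is killed by the factor [j]. *)
Lemma elsym_cons_nseq m (a p : R) j : (j <= m.+1)%N ->
  m.+1%:R * elsym (a :: nseq m p) j =
  'C(m.+1, j)%:R * ((m.+1 - j)%:R * p ^+ j + j%:R * (a * p ^+ j.-1)).
Proof.
case: j => [|j]; first by rewrite elsym0 bin0 subn0 mul0r addr0 expr0 mul1r.
rewrite ltnS leq_eqVlt => /orP[/eqP ->|jm].
  have := elsym_cons_top a (nseq m p); rewrite size_nseq => ->.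
  by rewrite elsym_nseq // !binn subnn mul0r add0r !mul1r mulrCA.
rewrite elsym_cons ?size_nseq // !elsym_nseq ?(ltnW jm) // subSS /=.
have H1 : m.+1%:R * 'C(m, j)%:R = j.+1%:R * 'C(m.+1, j.+1)%:R :> R.
  by rewrite -!natrM mul_bin_diag.
have H2 : m.+1%:R * 'C(m, j.+1)%:R = (m - j)%:R * 'C(m.+1, j.+1)%:R :> R.
  by rewrite -!natrM (mul_bin_down m.+1 j.+1) subSS.
transitivity ((m.+1%:R * 'C(m, j.+1)%:R) * p ^+ j.+1 + (m.+1%:R * 'C(m, j)%:R) * (a * p ^+ j)); first by ring.
by rewrite H1 H2; ring.
Qed.

End ElsymNseq.

Section Meridian.
Variables (R : realType) (n : nat).
Local Notation E := (Ebasis R (@ord_max n.+1)).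
Local Notation E0 := (Ebasis R (ord0 : 'I_n.+2)).

Lemma Ebasis_dotv (i j : 'I_n.+2) : dotv (Ebasis R i) (Ebasis R j) = (i == j)%:R :> R.
Proof. by rewrite dotv_Ebasis mxE eqxx eq_sym. Qed.

Lemma refl_exchange m (x y : 'rV[R]_m.+1) : dotv x x = 1 -> dotv y y = 1 -> x != y ->
  exists nu, [/\ dotv nu nu = 1, refl nu x = y & exists c, nu = c *: (x - y)].
Proof.
move=> x1 y1 xy; have d0 : 0 < dotv (x - y) (x - y) by rewrite dotv_gt0 subr_eq0.
pose c := (Num.sqrt (dotv (x - y) (x - y)))^-1.
have c2 : c ^+ 2 * dotv (x - y) (x - y) = 1.
  by rewrite /c exprVn sqr_sqrtr ?mulVf // ?gt_eqF // ltW.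
exists (c *: (x - y)); split; last by exists c.
  by rewrite dotvZl dotvZr mulrA -expr2.
rewrite /refl dotvZr scalerA.
have -> : 2 * (c * dotv x (x - y)) * c = 1.
  by rewrite -[RHS]c2 !dotvL x1 y1 (dotvC y x); ring.
by rewrite scale1r opprB addrC subrK.
Qed.

Lemma quad_sym_eq m (A B : 'M[R]_m.+1) : A^T = A -> B^T = B ->
  (forall x, quad A x = quad B x) -> A = B.
Proof.
move=> As Bs H.
have bil (C : 'M[R]_m.+1) i j : C^T = C ->
   quad C (Ebasis R i + Ebasis R j) = quad C (Ebasis R i) + quad C (Ebasis R j) + 2 * C i j.
  move=> Cs; have Cij : C j i = C i j by rewrite -{1}Cs mxE.
  have q i' j' : (Ebasis R i' *m C *m (Ebasis R j')^T) 0 0 = C i' j'.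
    by rewrite /Ebasis -rowE trmx_delta -colE !mxE.
  have T : (Ebasis R i + Ebasis R j)^T = (Ebasis R i)^T + (Ebasis R j)^T.
    by apply/colP => i'; rewrite !mxE.
  have D (a b : 'M[R]_1) : (a + b) 0 0 = a 0 0 + b 0 0 by rewrite mxE.
  by rewrite /quad T !mulmxDl !mulmxDr !D !q Cij; ring.
apply/matrixP => i j; have := bil A i j As; rewrite H (bil B i j Bs) !H.
by move: (quad B _) (quad B _) => a b h; lra.
Qed.

(* The reflection exchanging [y] and the pole diagonalises the matrix. *)
Lemma sigmaj_meridian (r t p mu : R) j : r ^+ 2 + t ^+ 2 = 1 -> 0 < r -> (j <= n.+1)%N ->
  let y := r *: E0 + t *: E in
  let e := E *m tproj y in
  n.+1%:R * sigmaj j (p *: tproj y + mu *: (e^T *m e)) =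
  'C(n.+1, j)%:R * ((n.+1 - j)%:R * p ^+ j + j%:R * ((p + mu * r ^+ 2) * p ^+ j.-1)).
Proof.
move=> rt r0 jn y e.
have EE : dotv E E = 1 by rewrite Ebasis_dotv eqxx.
have E00 : dotv E0 E0 = 1 by rewrite Ebasis_dotv eqxx.
have E0E : dotv E0 E = 0 by rewrite Ebasis_dotv.
have EE0 : dotv E E0 = 0 by rewrite dotvC.
have y1 : dotv y y = 1 by rewrite /y !dotvL E00 EE E0E EE0 -[RHS]rt; ring.
have yE : y != E.
  apply/eqP => /(congr1 (fun w => dotv w E0)); rewrite /y !dotvL E00 EE0.
  by move=> h; move: r0; rewrite mulr1 mulr0 addr0 in h; rewrite h ltxx.
have [nu [nu1 ry _]] := refl_exchange y1 EE yE.
have rE : refl nu E = y by rewrite -ry reflK.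
rewrite -(sigmaj_refl nu1).
(* The reflection swaps [y] and [E], so it sends [e = E - t y] to [y - t E = r E0]; the zero
   eigenvalue moves to the pole. *)
pose d : 'rV[R]_n.+2 := \row_i (if i == ord_max then 0 else if i == ord0 then p + mu * r ^+ 2 else p).
have dE : diag_mx d = p%:M + (- p) *: (E^T *m E) + (mu * r ^+ 2) *: (E0^T *m E0).
  apply/matrixP => i i'; rewrite /Ebasis !trmx_delta !mul_delta_mx !mxE.
  have [->|ii] := eqVneq i i'; last first.
    have F c : (i == c) && (i' == c) = false.
      by apply/negP => /andP[/eqP a /eqP b]; rewrite a b eqxx in ii.
    by rewrite !F !mulr0 !mulr0n !addr0.
  case: eqP => [->|_] /=; first by rewrite !mulr1n; ring.
  by case: eqP => _ /=; rewrite !mulr1n; ring.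
have eE : e = E - t *: y.
  by rewrite /e mul_tproj /y !dotvL EE EE0; congr (_ - _ *: _); ring.
have -> : reflmx nu *m (p *: tproj y + mu *: (e^T *m e)) *m reflmx nu = diag_mx d.
  rewrite dE; apply: quad_sym_eq.
  - have : (p *: tproj y + mu *: (e^T *m e))^T = p *: tproj y + mu *: (e^T *m e).
      by rewrite linearD !linearZ /= tproj_sym trmx_mul trmxK.
    by move: (_ + _) => A As; rewrite !trmx_mul reflmx_sym As mulmxA.
  - by rewrite !linearD !linearZ /= !trmx_mul !trmxK tr_scalar_mx.
  move=> x; rewrite quad_refl // !quadD !quadZ !quad_rank1 quad_scalar -!dotvE.
  have -> : quad (tproj y) (refl nu x) = dotv x x - dotv x E ^+ 2.
    rewrite /quad -dotvE mul_tproj dotvDl dotvNl dotvZl dotv_refl // (dotvC y).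
    by rewrite dotv_reflC // ry; ring.
  have -> : dotv (refl nu x) e = r * dotv x E0.
    rewrite dotv_reflC // eE reflD -scaleNr reflZ rE ry /y.
    by rewrite !dotvL; ring.
  by ring.
rewrite /sigmaj char_poly_trig ?diag_mx_is_trig //.
rewrite big_ord_recr /= big_ord_recl /=.
have dN : diag_mx d ord_max ord_max = 0 by rewrite !mxE eqxx.
have d0 (i : 'I_n.+2) : i = 0%N :> nat -> diag_mx d i i = p + mu * r ^+ 2.
  by move=> i0; rewrite !mxE eqxx mulr1n -!val_eqE /= i0.
have dp (i : 'I_n.+2) : (0 < i < n.+1)%N -> diag_mx d i i = p.
  move=> /andP[i0 i1]; rewrite !mxE eqxx mulr1n -!val_eqE /=.
  by rewrite (ltn_eqF i1) gtn_eqF.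
(* The zero eigenvalue contributes a factor ['X], which shifts the coefficient index by one and
   leaves [sigma_j] of the remaining eigenvalues. *)
rewrite dN d0 // subr0 subSn // coefMX /=.
rewrite -elsym_cons_nseq //; congr (_ * _).
rewrite /elsym /= size_nseq big_cons; congr (_ * (_ * _ : {poly R})`__).
rewrite big_nseq iter_mulr_1 -[n in RHS]card_ord -prodr_const.
by apply: eq_bigr => i _; rewrite dp //= ltnS.
Qed.

End Meridian.

Section MoreJets.
Variable R : realType.

Lemma jet_unique (f : R -> R) b c b' c' : jet f b c -> jet f b' c' -> b = b' /\ c = c'.
Proof.
move=> J J'; have J1 := jetB J J'; have J2 := jetB J' J.
have F0 : f 0 - f 0 = 0 by rewrite subrr.
have n0 : \forall s \near (0 : R), 0 <= s -> f s - f s <= 0.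
  by apply: (@filterE _ (nbhs (0 : R))) => s _; rewrite subrr.
have [b1 c1] := jet_le0 J1 F0 n0; have [b2 c2] := jet_le0 J2 F0 n0.
have bb : b = b' by apply/eqP; rewrite eq_le -subr_le0 b1 -subr_le0 b2.
split=> //; move: c1 c2; rewrite bb subrr => /(_ erefl) c1 /(_ erefl) c2.
by apply/eqP; rewrite eq_le -subr_le0 c1 -subr_le0 c2.
Qed.

Lemma jet_near (f g : R -> R) b c : (\forall s \near (0 : R), f s = g s) -> jet f b c -> jet g b c.
Proof.
move=> fg [f1 nf [f10 df]]; exists f1 => //.
have nfg : \forall s \near (0 : R), \forall t \near s, f t = g t by exact: (near_join fg).
apply: filterS2 nf nfg => s Hs Hfg.
exact: (near_eq_is_derive Hfg Hs).
Qed.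

Lemma jet_sqrt (f : R -> R) b c : 0 < f 0 -> jet f b c -> exists b' c', jet (fun s => Num.sqrt (f s)) b' c'.
Proof.
move=> f0 J; have cf := jet_continuous J; move: J => [f1 nf [fb df]].
have nf0 : \forall s \near (0 : R), 0 < f s by exact: (cvgr_gt _ cf _ f0).
have D s : 0 < f s -> is_derive s (1 : R) f (f1 s) ->
    is_derive s (1 : R) (fun s => Num.sqrt (f s)) ((2 * Num.sqrt (f s))^-1 * f1 s).
  by move=> fs Hs; apply: (@is_derive1_comp R (@Num.sqrt R) f); exact: is_derive1_sqrt.
have D0 := D _ f0 (nbhs_singleton nf).
exists ((2 * Num.sqrt (f 0))^-1 * f1 0).
have s0 : 2 * Num.sqrt (f 0) != 0 by rewrite mulf_neq0 // gt_eqF // sqrtr_gt0.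
have DS := is_deriveM (is_derive_cst (2 : R) (0 : R) (1 : R)) D0.
have DV := @is_deriveV R (fun s => 2 * Num.sqrt (f s)) 0 _ 1 s0 DS.
have DM := is_deriveM DV df.
eexists; exists (fun s => (2 * Num.sqrt (f s))^-1 * f1 s).
  by apply: filterS2 nf nf0 => s Hs fs; exact: D.
by split => //; exact: DM.
Qed.

Lemma jet_scalar_comp (Phi Phi1 u : R -> R) (u1 u2 c : R) :
  (\forall t \near u 0, is_derive t (1 : R) Phi (Phi1 t)) -> is_derive (u 0) (1 : R) Phi1 c ->
  jet u u1 u2 -> jet (fun s => Phi (u s)) (Phi1 (u 0) * u1) (c * u1 ^+ 2 + Phi1 (u 0) * u2).
Proof.
move=> nP dP J; have cu := jet_continuous J; move: J => [f nf [f0 df]].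
exists (fun s => Phi1 (u s) * f s).
  have nP' : \forall s \near (0 : R), is_derive (u s) (1 : R) Phi (Phi1 (u s)) by exact: (cu _ nP).
  by apply: filterS2 nP' nf => s H1 H2; exact: (@is_derive1_comp R Phi u).
split; first by rewrite f0.
have D1 := @is_derive1_comp R Phi1 u 0 _ _ dP (nbhs_singleton nf).
apply: is_derive_eq (is_deriveM D1 df) _.
by rewrite /GRing.scale /= f0; ring.
Qed.

(** Each jet brings its own local derivative; taking ['D_1] twice glues these witnesses into two
    functions on the whole interval. *)
Lemma twice_derivable (Phi : R -> R) (a b : R) :
  (forall t, a < t < b -> exists c1 c2, jet (fun s => Phi (t + s)) c1 c2) ->
  exists Phi1 Phi2 : R -> R, forall t, a < t < b ->
    is_derive t (1 : R) Phi (Phi1 t) /\ is_derive t (1 : R) Phi1 (Phi2 t).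
Proof.
move=> H; pose P1 t := 'D_1 Phi t; pose P2 t := 'D_1 P1 t.
exists P1, P2 => t tab; have [c1 [c2 [f1 nf [f10 df]]]] := H t tab.
have sh (g : R -> R) (d x : R) : is_derive (x - t) (1 : R) g d -> is_derive x (1 : R) (fun y => g (y - t)) d.
  move=> Dg; have Ds : is_derive x (1 : R) (fun y : R => y - t) 1.
    by apply: is_derive_eq (is_deriveB (is_derive_id x 1) (is_derive_cst t x 1)) _; rewrite subr0.
  by have := @is_derive1_comp R g (fun y => y - t) x _ _ Dg Ds; rewrite mulr1.
have E1 : (fun y => Phi (t + (y - t))) = Phi by apply/funext => y; rewrite addrC subrK.
have nP : \forall s \near (0 : R), P1 (t + s) = f1 s.
  apply: filterS nf => s Hs.
  have Hs' : is_derive (t + s - t) (1 : R) (fun s => Phi (t + s)) (f1 s) by rewrite addrAC subrr add0r.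
  by have [_ <-] := sh _ _ _ Hs'; rewrite E1.
have nP' : \forall y \near t, f1 (y - t) = P1 y.
  have cs : (fun y : R => y - t) @ t --> (0 : R).
    rewrite -[X in _ --> X](subrr t); exact: (cvgB (@cvg_id _ (nbhs t)) (cvg_cst t)).
  have nP2 : \forall y \near t, P1 (t + (y - t)) = f1 (y - t) by exact: (cs _ nP).
  by apply: filterS nP2 => y <-; rewrite addrC subrK.
split.
  have H0 : is_derive (t - t) (1 : R) (fun s => Phi (t + s)) (f1 0) by rewrite subrr; exact: nbhs_singleton nf.
  have := sh _ _ _ H0; rewrite E1 => D; have [_ D2] := D.
  by rewrite /P1 D2.
have H0 : is_derive (t - t) (1 : R) f1 c2 by rewrite subrr.
have D := sh _ _ _ H0.
have D1 : is_derive t (1 : R) P1 c2 by exact: (near_eq_is_derive nP' D).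
by have [_ D2] := D1; rewrite /P2 D2.
Qed.

(** Since [p' = - t Phi''], the balance equation becomes [(1 - t^2) X' = n t X] for [X = p^k - p^l],
    so [(1 - t^2)^(n/2) X] is constant. Squaring removes the half-integer exponent. *)
Lemma first_integral (n k l : nat) (Phi Phi1 Phi2 : R -> R) (a : R) :
  (0 < n)%N -> (k <= n)%N -> (l <= n)%N ->
  (forall t, a < t < 1 -> is_derive t (1 : R) Phi (Phi1 t) /\ is_derive t (1 : R) Phi1 (Phi2 t)) ->
  let p t := Phi t - t * Phi1 t in
  let lam t := p t + Phi2 t * (1 - t ^+ 2) in
  (forall t, a < t < 1 -> (n - k)%:R * p t ^+ k + k%:R * (lam t * p t ^+ k.-1) =
     (n - l)%:R * p t ^+ l + l%:R * (lam t * p t ^+ l.-1)) ->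
  forall t, a < t < 1 ->
    is_derive t (1 : R) (fun t => (1 - t ^+ 2) ^+ n * (p t ^+ k - p t ^+ l) ^+ 2) 0.
Proof.
move=> n0 kn ln HD p lam HS t tab.
have [D0 D1] := HD t tab.
have Dp : is_derive t (1 : R) p (- t * Phi2 t).
  apply: is_derive_eq (is_deriveB D0 (is_deriveM (is_derive_id t (1 : R)) D1)) _.
  by rewrite /GRing.scale /=; ring.
have Dq : is_derive t (1 : R) (fun t => 1 - t ^+ 2) (- 2 * t).
  apply: is_derive_eq (is_deriveB (is_derive_cst (1 : R) t (1 : R)) (is_deriveX 2 (is_derive_id t (1 : R)))) _.
  by rewrite /GRing.scale /=; ring.
rewrite (_ : (fun t => _) = (fun t : R => 1 - t ^+ 2) ^+ n * (p ^+ k - p ^+ l) ^+ 2); last first.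
  by apply/funext => x; rewrite !fctE.
apply: is_derive_eq (is_deriveM (is_deriveX n Dq) (is_deriveX 2 (is_deriveB (is_deriveX k Dp) (is_deriveX l Dp)))) _.
have E := HS t tab.
have pk j : j%:R * (lam t * p t ^+ j.-1) = j%:R * p t ^+ j + j%:R * (Phi2 t * (1 - t ^+ 2)) * p t ^+ j.-1.
  case: j => [|j]; first by rewrite !mul0r add0r.
  by rewrite /lam -[j.+1.-1]/j (exprS (p t) j); move: (p t ^+ j) (p t) => Q P; ring.
rewrite !pk !natrB // in E.
rewrite /GRing.scale /= !fctE /= expr1.
case: n n0 {kn ln HS} E => [//|n] _ E /=.
rewrite exprS.
move: (p t ^+ k) (p t ^+ l) (p t ^+ k.-1) (p t ^+ l.-1) (k%:R) (l%:R) E => a1 a2 a3 a4 K L E.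
move: ((1 - t ^+ 2) ^+ n) => W.
have E2 : (1 - t ^+ 2) * ((K * a3 - L * a4) * (- t * Phi2 t)) = n.+1%:R * t * (a1 - a2).
  move: E; move: (n.+1%:R) => N E; nra.
transitivity (2 * W * (a1 - a2) * ((1 - t ^+ 2) * ((K * a3 - L * a4) * (- t * Phi2 t)) - n.+1%:R * t * (a1 - a2))).
  by ring.
by rewrite E2 subrr mulr0.
Qed.

End MoreJets.

(** * Reduction to a function of the height *)

Section Radial.
Variables (R : realType) (n k l : nat) (tau : R) (U : set 'rV[R]_n.+3) (f : 'rV[R]_n.+3 -> R).
Local Notation E := (Ebasis R (@ord_max n.+2)).
Local Notation E0 := (Ebasis R (ord0 : 'I_n.+3)).
Local Notation scap := (@scap R n.+2 tau).
Hypothesis tau1 : tau ^+ 2 < 1.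
Hypotheses (oU : open U) (capU : scap `<=` U) (Cf : C2_on U f).
Hypotheses (kn : (k <= n.+2)%N) (lk : (l < k)%N).
Hypothesis lev : forall y, scap y ->
  level k l ('C(n.+2, k)%:R / 'C(n.+2, l)%:R) (Wtensor f y).
Hypothesis reflf : forall nu y, dotv nu nu = 1 -> nu 0 ord_max = 0 -> scap y ->
  f y - f (refl nu y) = 2 * dotv (grad f E) nu * dotv y nu.

Definition hgrad : 'rV[R]_n.+3 := grad f E - (grad f E 0 ord_max) *: E.
Definition radial y : R := f y - dotv y hgrad.
Definition meridian (t : R) : 'rV[R]_n.+3 := Num.sqrt (1 - t ^+ 2) *: E0 + t *: E.
Definition profile (t : R) : R := radial (meridian t).

Let EE : dotv E E = 1. Proof. by rewrite Ebasis_dotv eqxx. Qed.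
Let E00 : dotv E0 E0 = 1. Proof. by rewrite Ebasis_dotv eqxx. Qed.
Let E0E : dotv E0 E = 0. Proof. by rewrite Ebasis_dotv. Qed.
Let EE0 : dotv E E0 = 0. Proof. by rewrite Ebasis_dotv. Qed.
Let tauN : -1 < tau < 1. Proof. by rewrite -ltr_norml -(@ltr_pXn2r _ 2) ?nnegrE // expr1n real_normK ?num_real. Qed.

Lemma hgrad_last : hgrad 0 ord_max = 0.
Proof. by rewrite -dotv_Ebasis /hgrad !dotvL EE dotv_Ebasis; ring. Qed.

Lemma meridian_last t : meridian t 0 ord_max = t.
Proof. by rewrite -dotv_Ebasis /meridian !dotvL EE E0E; ring. Qed.

Lemma meridian_scap t : tau <= t <= 1 -> scap (meridian t).
Proof.
move=> /andP[t0 t1]; split; last by rewrite meridian_last.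
have t2 : 0 <= 1 - t ^+ 2 by have /andP[h _] := tauN; nra.
rewrite /meridian !dotvL E00 EE EE0 E0E !mulr0 !mulr1 addr0 add0r -expr2 sqr_sqrtr //; ring.
Qed.

Lemma height_le1 y : scap y -> tau <= y 0 ord_max <= 1.
Proof.
move=> [y1 yt]; rewrite yt /= -dotv_Ebasis; exact: unit_dotv_le1.
Qed.

(** Two points of equal height are exchanged by a reflection with horizontal normal, and the
    reflection identity says that [f] changes under it exactly as the linear function [hgrad]
    does. *)
Lemma radial_profile y : scap y -> radial y = profile (y 0 ord_max).
Proof.
move=> sy; have [y1 yt] := sy.
have sC := meridian_scap (height_le1 sy); have [C1 _] := sC.
rewrite /profile; have [{1}->//|yC] := eqVneq y (meridian (y 0 ord_max)).
have [nu [nu1 ry [c nuE]]] := refl_exchange y1 C1 yC.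
have nuN : nu 0 ord_max = 0 by rewrite -dotv_Ebasis nuE dotvZl dotvDl dotvNl !dotv_Ebasis meridian_last subrr mulr0.
have := reflf nu1 nuN sy; rewrite ry => H.
have hg : dotv hgrad nu = dotv (grad f E) nu.
  by rewrite /hgrad !dotvL (dotvC E) dotv_Ebasis nuN mulr0 oppr0 addr0.
rewrite /radial; apply/eqP; rewrite -subr_eq0; apply/eqP.
have -> : f y - dotv y hgrad - (f (meridian (y 0 ord_max)) - dotv (meridian (y 0 ord_max)) hgrad) =
  (f y - f (meridian (y 0 ord_max))) - (dotv y hgrad - dotv (meridian (y 0 ord_max)) hgrad) by ring.
rewrite H -ry /refl dotvDl dotvNl dotvZl (dotvC nu hgrad) hg; ring.
Qed.

Lemma profile_jet t : tau < t < 1 -> exists c1 c2, jet (fun s => profile (t + s)) c1 c2.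
Proof.
move=> /andP[t0 t1]; have [N0 _] := andP tauN.
have t2 : 0 < 1 - (t + 0) ^+ 2 by rewrite addr0; nra.
have Ji : jet (fun s : R => s) 1 0.
  by exists (fun=> 1); [apply: (@filterE _ (nbhs (0 : R))) => s; exact: is_derive_id|split=> //; exact: is_derive_cst].
have Jt := jetD (jet_cst t) Ji.
have [b [c Js]] := jet_sqrt t2 (jetB (jet_cst 1) (jetM Jt Jt)).
have Jm : vjet (fun s => meridian (t + s)) (b *: E0 + E) (c *: E0).
  move=> i; rewrite (_ : (fun s => _) = fun s => E0 0 i * Num.sqrt (1 - (t + s) * (t + s)) + E 0 i * (t + s)).
    apply: jet_eq (jetD (jetZ _ Js) (jetZ _ Jt)) _ _; rewrite !mxE; ring.
  by apply/funext => s; rewrite /meridian !mxE expr2; ring.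
have Um : U (meridian (t + 0)) by apply/capU/meridian_scap; rewrite addr0 !ltW.
have J := jet_comp oU Cf Um Jm.
have Jd : jet (fun s => dotv (meridian (t + s)) hgrad) (b * dotv E0 hgrad + 1 * dotv E hgrad) (c * dotv E0 hgrad).
  rewrite (_ : (fun s => _) = fun s => dotv E0 hgrad * Num.sqrt (1 - (t + s) * (t + s)) + dotv E hgrad * (t + s)).
    apply: jet_eq (jetD (jetZ _ Js) (jetZ _ Jt)) _ _; ring.
  by apply/funext => s; rewrite /meridian !dotvL expr2; ring.
eexists; eexists; exact: jetB J Jd.
Qed.

Variables (Phi1 Phi2 : R -> R).
Hypothesis dPhi : forall t, tau < t < 1 ->
  is_derive t (1 : R) profile (Phi1 t) /\ is_derive t (1 : R) Phi1 (Phi2 t).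

Let p t := profile t - t * Phi1 t.

(** Two computations of the second derivative of [f] along one great circle: through the tensor, and
    through [profile] of the height plus a linear term. The heights 1 and [tau] are excluded because
    [profile] is differentiated only in between. *)
Lemma radial_quad y v : scap y -> tau < y 0 ord_max < 1 -> dotv v v = 1 -> dotv v y = 0 ->
  quad (Wtensor f y) v = p (y 0 ord_max) + Phi2 (y 0 ord_max) * (v 0 ord_max) ^+ 2.
Proof.
move=> sy yt v1 vy; have [y1 _] := sy.
have J1 := jet_great_circle oU Cf (capU sy) v1 vy.
have Ju := jet_great_circle_dotv y v E.
have cu := jet_continuous Ju.
have u0 : dotv (great_circle y v 0) E = y 0 ord_max by rewrite great_circle0 dotv_Ebasis.
have [t0 t1] := andP yt.
have nt : \forall t \near dotv (great_circle y v 0) E, tau < t < 1.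
  rewrite u0; near=> t; apply/andP; split; near: t.
    exact: (cvgr_gt _ (@cvg_id _ (nbhs (y 0 ord_max : R))) _ t0).
  exact: (cvgr_lt _ (@cvg_id _ (nbhs (y 0 ord_max : R))) _ t1).
have nP : \forall t \near dotv (great_circle y v 0) E, is_derive t (1 : R) profile (Phi1 t).
  by apply: filterS nt => t ht; have [] := dPhi ht.
have dP : is_derive (dotv (great_circle y v 0) E) (1 : R) Phi1 (Phi2 (y 0 ord_max)).
  by rewrite u0; have [] := dPhi yt.
have J2 := jetD (jet_scalar_comp nP dP Ju) (jet_great_circle_dotv y v hgrad).
have nE : \forall s \near (0 : R), profile (dotv (great_circle y v s) E) + dotv (great_circle y v s) hgrad
    = f (great_circle y v s).
  have nt' : \forall s \near (0 : R), tau < dotv (great_circle y v s) E < 1 by exact: (cu _ nt).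
  apply: filterS nt' => s /andP[/ltW hs _]; rewrite dotv_Ebasis in hs.
  have sg : scap (great_circle y v s) by split => //; rewrite great_circle_unit // dotvC.
  by rewrite dotv_Ebasis -radial_profile // /radial subrK.
have [_] := jet_unique J1 (jet_near nE J2).
rewrite u0 !dotv_Ebasis /p -(radial_profile sy) /radial => h.
have -> : quad (Wtensor f y) v = quad (Wtensor f y) v - f y + f y by rewrite subrK.
by rewrite h; ring.
Unshelve. all: by end_near. Qed.

Lemma radial_Wtensor t : tau < t < 1 ->
  let y := meridian t in let e := E *m tproj y in
  Wtensor f y = p t *: tproj y + Phi2 t *: (e^T *m e).
Proof.
move=> tt y e; have [t0 t1] := andP tt.
have sy : scap y by apply: meridian_scap; rewrite !ltW.
have [y1 _] := sy; have yN : y 0 ord_max = t by exact: meridian_last.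
have H v : dotv v y = 0 -> quad (Wtensor f y) v = p t * dotv v v + Phi2 t * (v 0 ord_max) ^+ 2.
  move=> vy; have [->|v0] := eqVneq v 0.
    by rewrite /quad !mul0mx !mxE dotv0l; ring.
  pose r := Num.sqrt (dotv v v).
  have r0 : 0 < r by rewrite sqrtr_gt0 dotv_gt0.
  have r2 : r ^+ 2 = dotv v v by rewrite sqr_sqrtr // dotv_ge0.
  pose w := r^-1 *: v.
  have vE : v = r *: w by rewrite scalerA divff ?scale1r // gt_eqF.
  have w1 : dotv w w = 1 by rewrite dotvZl dotvZr -r2; field; rewrite gt_eqF.
  have wy : dotv w y = 0 by rewrite dotvZl vy mulr0.
  have := radial_quad sy _ w1 wy; rewrite yN => /(_ tt) h.
  rewrite vE quad_scale h dotvZl dotvZr w1 [(r *: w) 0 _]mxE; ring.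
apply: quad_sym_eq.
- by apply: (Wtensor_sym oU Cf); exact: capU.
- by rewrite linearD !linearZ /= tproj_sym trmx_mul trmxK.
move=> x; rewrite -quad_Wtensor_tproj // H ?tproj_orth // quadD !quadZ quad_rank1 -dotvE.
congr (_ * _ + _ * _ ^+ 2).
  by rewrite /quad -dotvE dotv_tproj [X in dotv x X]tproj_id ?tproj_orth // dotvC.
by rewrite -dotv_Ebasis dotv_tproj.
Qed.

Lemma radial_sigmaj t j : tau < t < 1 -> (j <= n.+2)%N ->
  n.+2%:R * sigmaj j (Wtensor f (meridian t)) = 'C(n.+2, j)%:R *
   ((n.+2 - j)%:R * p t ^+ j + j%:R * ((p t + Phi2 t * (1 - t ^+ 2)) * p t ^+ j.-1)).
Proof.
move=> tt jn; rewrite radial_Wtensor //.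
have [t0 t1] := andP tt; have [N0 _] := andP tauN.
have t2 : 0 < 1 - t ^+ 2 by nra.
have r0 : 0 < Num.sqrt (1 - t ^+ 2) by rewrite sqrtr_gt0.
have r2 : Num.sqrt (1 - t ^+ 2) ^+ 2 = 1 - t ^+ 2 by rewrite sqr_sqrtr // ltW.
have := @sigmaj_meridian R n.+1 _ t (p t) (Phi2 t) j _ r0 jn.
by rewrite r2 => -> //; ring.
Qed.

Lemma radial_balance t : tau < t < 1 ->
  (n.+2 - k)%:R * p t ^+ k + k%:R * ((p t + Phi2 t * (1 - t ^+ 2)) * p t ^+ k.-1) =
  (n.+2 - l)%:R * p t ^+ l + l%:R * ((p t + Phi2 t * (1 - t ^+ 2)) * p t ^+ l.-1).
Proof.
move=> tt; have [t0 t1] := andP tt.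
have sy : scap (meridian t) by apply: meridian_scap; rewrite !ltW.
have [_ _ E] := lev sy.
have Hk := radial_sigmaj tt kn; have Hl := radial_sigmaj tt (leq_trans (ltnW lk) kn).
have bk : 0 < 'C(n.+2, k)%:R :> R by rewrite ltr0n bin_gt0.
have bl : 0 < 'C(n.+2, l)%:R :> R by rewrite ltr0n bin_gt0 (leq_trans (ltnW lk) kn).
apply: (mulfI (lt0r_neq0 bk)); rewrite -Hk E.
have -> : n.+2%:R * ('C(n.+2, k)%:R / 'C(n.+2, l)%:R * sigmaj l (Wtensor f (meridian t))) =
  'C(n.+2, k)%:R / 'C(n.+2, l)%:R * (n.+2%:R * sigmaj l (Wtensor f (meridian t))) by ring.
by rewrite Hl [LHS]mulrA divfK // gt_eqF.
Qed.

(** If [p <= 0], then [sigma_1 > 0] forces the other eigenvalue to be so large that [sigma_2 <= 0].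
    Positivity is what later turns [p^k = p^l] into [p = 1]. *)
Lemma radial_curvature_gt0 t : tau < t < 1 -> (1 < k)%N -> 0 < p t.
Proof.
move=> tt k1; have [t0 t1] := andP tt.
have sy : scap (meridian t) by apply: meridian_scap; rewrite !ltW.
have [_ gW _] := lev sy.
have s1 : 0 < sigmaj 1 (Wtensor f (meridian t)) by apply: gW; rewrite /= (ltnW k1).
have s2 : 0 < sigmaj 2 (Wtensor f (meridian t)) by apply: gW.
have n2 : (2 <= n.+2)%N by [].
have := mulr_gt0 (ltr0Sn R n.+1) s1; have := mulr_gt0 (ltr0Sn R n.+1) s2.
rewrite !radial_sigmaj // !pmulr_rgt0 ?ltr0n ?bin_gt0 //= !subSS !subn0 expr1 expr0.
move: (p t) (Phi2 t * (1 - t ^+ 2)) => P Q.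
have -> : n.+1%:R = n%:R + 1 :> R by rewrite -natr1.
have : 0 <= n%:R :> R by rewrite ler0n.
move: (n%:R) => N N0 h2 h1.
rewrite ltNge; apply/negP => P0.
have h3 : 0 <= (- P) * (N * P + 2 * (P + Q)) by apply: mulr_ge0; nra.
nra.
Qed.

End Radial.

Section OpenInterval.
Variables (R : realType) (g : R -> R) (a b : R).

Lemma derive_zero_constant : (forall t, a < t < b -> is_derive t (1 : R) g 0) ->
  forall s t, a < s < b -> a < t < b -> g s = g t.
Proof.
move=> H; have L s t : a < s -> s <= t -> t < b -> g s = g t.
  move=> as_ st tb.
  have D x : x \in `[s, t] -> is_derive x (1 : R) g 0.
    rewrite in_itv /= => /andP[sx xt]; apply: H.
    by rewrite (lt_le_trans as_ sx) (le_lt_trans xt tb).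
  have cg : {within `[s, t], continuous g}.
    by apply: derivable_within_continuous => x /D [].
  have dg x : x \in `]s, t[ -> is_derive x (1 : R) g ((fun=> 0 : R) x).
    by move=> xst; apply: D; apply: subset_itv_oo_cc.
  have [x _] := MVT_segment st dg cg.
  by rewrite mul0r => /eqP; rewrite subr_eq0 => /eqP.
move=> s t /andP[s0 s1] /andP[t0 t1].
by have [st|/ltW ts] := leP s t; [exact: L|symmetry; exact: L].
Qed.

Lemma closed_interval_constant (m c : R) : a < b -> a <= c <= b -> g x @[x --> c] --> g c ->
  (forall t, a < t < b -> g t = m) -> g c = m.
Proof.
move=> ab /andP[ac cb] cg H; apply/eqP/negP => /negP gm.
have e0 : 0 < `|g c - m| by rewrite normr_gt0 subr_eq0.
have n1 : \forall x \near c, `|g c - g x| < `|g c - m| by exact: (@cvgrPdist_lt _ _ _ (nbhs c) _ g (g c)).1 cg _ e0.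
have /nbhs_ballP[e /= e1 He] := n1.
pose d := (a + b) / 2 - c.
have d0 : 0 <= `|d| by [].
pose s := e / (e + `|d|).
have s0 : 0 < s by rewrite divr_gt0 // ltr_wpDr.
have s1 : s <= 1 by rewrite ler_pdivrMr ?mul1r ?lerDl // ltr_wpDr.
have sd : s * `|d| < e.
  by rewrite /s mulrAC ltr_pdivrMr ?ltr_wpDr //; nra.
have tab : a < c + s * d < b by rewrite /d; apply/andP; split; nra.
have : ball c e (c + s * d) by rewrite /ball /= opprD addrA subrr sub0r normrN normrM (gtr0_norm s0).
by move=> /He; rewrite (H _ tab) ltxx.
Qed.

End OpenInterval.

Section RadialRigidity.
Variables (R : realType) (n k l : nat) (tau : R) (U : set 'rV[R]_n.+3) (f : 'rV[R]_n.+3 -> R).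
Local Notation E := (Ebasis R (@ord_max n.+2)).
Local Notation E0 := (Ebasis R (ord0 : 'I_n.+3)).
Local Notation E1 := (Ebasis R (lift ord0 ord0 : 'I_n.+3)).
Local Notation scap := (@scap R n.+2 tau).
Hypothesis tau1 : tau ^+ 2 < 1.
Hypotheses (oU : open U) (capU : scap `<=` U) (Cf : C2_on U f).
Hypothesis Rob : forall y, scap y -> y 0 ord_max = tau ->
  dotv (grad f y) (tau *: y - E) = tau * f y.
Hypotheses (kn : (k <= n.+2)%N) (lk : (l < k)%N).
Hypothesis lev : forall y, scap y ->
  level k l ('C(n.+2, k)%:R / 'C(n.+2, l)%:R) (Wtensor f y).
Hypothesis reflf : forall nu y, dotv nu nu = 1 -> nu 0 ord_max = 0 -> scap y ->
  f y - f (refl nu y) = 2 * dotv (grad f E) nu * dotv y nu.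

Let EE : dotv E E = 1. Proof. by rewrite Ebasis_dotv eqxx. Qed.
Let E11 : dotv E1 E1 = 1. Proof. by rewrite Ebasis_dotv eqxx. Qed.
Let E1E : dotv E1 E = 0. Proof. by rewrite Ebasis_dotv. Qed.
Let E1E0 : dotv E1 E0 = 0. Proof. by rewrite Ebasis_dotv. Qed.
Let tauN : -1 < tau < 1. Proof. by rewrite -ltr_norml -(@ltr_pXn2r _ 2) ?nnegrE // expr1n real_normK ?num_real. Qed.

Local Notation hgrad := (hgrad f).
Local Notation profile := (profile f).
Local Notation meridian := (@meridian R n).

Lemma meridian_continuous t : meridian s @[s --> t] --> meridian t.
Proof.
have c1 : (1 - s ^+ 2 : R) @[s --> t] --> 1 - t ^+ 2.
  have i : (s : R) @[s --> t] --> t by exact: cvg_id.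
  rewrite expr2; under eq_fun do rewrite expr2.
  exact: (cvgB (cvg_cst (1 : R)) (cvgM i i)).
have c2 : Num.sqrt (1 - s ^+ 2 : R) @[s --> t] --> Num.sqrt (1 - t ^+ 2).
  exact: (continuous_cvg _ (@sqrt_continuous R _) c1).
exact: (cvgD (cvgZr_tmp (a := E0) c2) (cvgZr_tmp (a := E) (@cvg_id _ (nbhs t)))).
Qed.

Lemma profile_continuous t : tau <= t <= 1 -> profile s @[s --> t] --> profile t.
Proof.
move=> tt; have Um : U (meridian t) by apply: capU; apply: meridian_scap.
have c1 : f (meridian s) @[s --> t] --> f (meridian t).
  exact: (continuous_cvg _ (C2_continuous Cf Um) (@meridian_continuous t)).
have c2 : dotv (meridian s) hgrad @[s --> t] --> dotv (meridian t) hgrad.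
  exact: (continuous_cvg _ (@dotv_continuous R _ _ _) (@meridian_continuous t)).
exact: (cvgB c1 c2).
Qed.

Lemma transverse_curvature_continuous t : tau <= t <= 1 ->
  quad (Wtensor f (meridian s)) E1 @[s --> t] --> quad (Wtensor f (meridian t)) E1.
Proof.
move=> tt; have Um : U (meridian t) by apply: capU; apply: meridian_scap.
have W : mx_cvg (nbhs t) (Wtensor f \o meridian) (Wtensor f (meridian t)).
  exact: mx_cvg_comp (@meridian_continuous t) (Wtensor_cvg Cf Um).
have H : mx_cvg (nbhs t) (fun s => E1 *m (Wtensor f \o meridian) s *m E1^T) (E1 *m Wtensor f (meridian t) *m E1^T).
  apply: mx_cvgM; last exact: mx_cvg_cst.
  by apply: mx_cvgM => //; exact: mx_cvg_cst.
exact: (H 0 0).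
Qed.

Lemma profile_affine : exists c, forall t, tau <= t <= 1 -> profile t = 1 + c * t.
Proof.
have [Phi1 [Phi2 dPhi]] := twice_derivable (profile_jet tau1 oU capU Cf).
have [tauN1 tau_1] := andP tauN.
pose p t := profile t - t * Phi1 t.
have quadp t : tau < t < 1 -> p t = quad (Wtensor f (meridian t)) E1.
  move=> tt; have [t0 t1] := andP tt.
  have sy : scap (meridian t) by apply: (meridian_scap n tau1); rewrite !ltW.
  rewrite (radial_quad tau1 oU capU Cf reflf dPhi sy) ?meridian_last //.
  by rewrite -dotv_Ebasis E1E /p; ring.
by rewrite /meridian dotvDr !dotvZr E1E0 E1E !mulr0 addr0.
have D := first_integral (isT : (0 < n.+2)%N) kn (leq_trans (ltnW lk) kn) dPhi
  (radial_balance tau1 oU capU Cf kn lk lev reflf dPhi).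
have Hc := derive_zero_constant D.
have pkl t : tau < t < 1 -> p t ^+ k = p t ^+ l.
  move=> tt; have [t0 t1] := andP tt.
  (* The direction [E1] is orthogonal to the meridian plane, so [q = p] below the pole. Unlike [p],
     which contains the derivative of a function of [sqrt (1 - t^2)], the tensor is continuous up to
     [t = 1]. *)
  pose q s := quad (Wtensor f (meridian s)) E1.
  pose G s := (1 - s ^+ 2) ^+ n.+2 * (q s ^+ k - q s ^+ l) ^+ 2.
  have G1 : G 1 = 0 by rewrite /G expr1n subrr expr0n mul0r.
  have cG : G s @[s --> (1 : R)] --> G 1.
    have i : (s : R) @[s --> (1 : R)] --> (1 : R) by exact: cvg_id.
    have cq : q s @[s --> (1 : R)] --> q 1 by apply: transverse_curvature_continuous; rewrite lexx ltW.
    have cX (u : R -> R) (L : R) j : u s @[s --> (1 : R)] --> L -> u s ^+ j @[s --> (1 : R)] --> L ^+ j.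
      by move=> cu; exact: (continuous_cvg _ (@exprn_continuous R j _) cu).
    apply: cvgM; apply: (cX); last exact: cvgB (cX _ _ _ cq) (cX _ _ _ cq).
    exact: (cvgB (cvg_cst (1 : R)) (cX _ _ _ i)).
  have GE s : tau < s < 1 -> G s = (1 - t ^+ 2) ^+ n.+2 * (p t ^+ k - p t ^+ l) ^+ 2.
    by move=> ss; rewrite /G /q -(quadp _ ss); exact: (Hc _ _ ss tt).
  have := closed_interval_constant tau_1 _ cG GE; rewrite G1 lexx ltW //= => /(_ isT) h; move/eqP: (esym h).
  rewrite mulf_eq0 expf_eq0 /= subr_eq0 eq_sym expf_eq0 /= subr_eq0.
  have /negbTE -> : t ^+ 2 != 1 by rewrite lt_eqF //; nra.
  by move=> /eqP.
have p1 t : tau < t < 1 -> p t = 1.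
  move=> tt; have E := pkl t tt.
  have [k1|k1] := ltnP 1 k.
    have p0 : 0 < p t by exact: (radial_curvature_gt0 tau1 oU capU Cf lev reflf dPhi tt k1).
    have : p t ^+ (k - l) = 1.
      by apply: (mulfI (expf_neq0 l (lt0r_neq0 p0))); rewrite mulr1 -exprD subnKC ?E // ltnW.
    by move=> /eqP; rewrite pexpr_eq1 ?subn_gt0 // ?ltW // => /eqP.
  have k_1 : k = 1%N by case: k lk k1 => [|[|]].
  have l_0 : l = 0%N by move: lk; rewrite k_1; case: l.
  by move: E; rewrite k_1 l_0.
have P2 t : tau < t < 1 -> Phi2 t = 0.
  move=> tt; have [t0 t1] := andP tt.
  have := radial_balance tau1 oU capU Cf kn lk lev reflf dPhi tt.
  rewrite -/(p t) p1 // !expr1n !mulr1 !natrB // ?(leq_trans (ltnW lk)) // => h.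
  have t2 : 0 < 1 - t ^+ 2 by nra.
  have kl : 0 < k%:R - l%:R :> R by rewrite subr_gt0 ltr_nat.
  apply/eqP; have : (k%:R - l%:R) * (Phi2 t * (1 - t ^+ 2)) = 0 by move: h; lra.
  by move/eqP; rewrite !mulf_eq0 (gt_eqF kl) (gt_eqF t2) orbF.
have DP1 t : tau < t < 1 -> is_derive t (1 : R) Phi1 0.
  by move=> tt; rewrite -(P2 t tt); have [] := dPhi t tt.
have mt : tau < (tau + 1) / 2 < 1 by apply/andP; split; lra.
exists (Phi1 ((tau + 1) / 2)) => t tt.
pose g s := profile s - Phi1 ((tau + 1) / 2) * s.
have cg : g s @[s --> t] --> g t.
  exact: (cvgB (profile_continuous tt) (cvgM (cvg_cst _) (@cvg_id _ (nbhs t)))).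
have g1 s : tau < s < 1 -> g s = 1.
  move=> ss; have := p1 s ss; rewrite /p /g (derive_zero_constant DP1 ss mt) => h; rewrite -[RHS]h; ring.
have := closed_interval_constant tau_1 tt cg g1; rewrite /g => h.
by move: h; lra.
Qed.

(** The slope of the affine profile is read off at one rim point. The formula for [f] holds only on
    the cap, so its gradient is tested along a single inward great circle, with one-sided
    derivatives of both signs. *)
Lemma radial_rigidity y : scap y -> f y = 1 - tau * y 0 ord_max + dotv y hgrad.
Proof.
have [c Hc] := profile_affine; have [tauN1 tau_1] := andP tauN.
have F x : scap x -> f x = 1 + c * x 0 ord_max + dotv x hgrad.
  move=> sx; have := radial_profile tau1 reflf sx; rewrite Hc; last exact: height_le1.
  by move=> <-; rewrite /radial subrK.
suff ct : c = - tau by move=> sy; rewrite F // ct mulNr.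
pose r := Num.sqrt (1 - tau ^+ 2).
have r0 : 0 < r by rewrite sqrtr_gt0 subr_gt0.
have r2 : r ^+ 2 = 1 - tau ^+ 2 by rewrite sqr_sqrtr // ltW // subr_gt0.
have rt : tau <= tau <= 1 by rewrite lexx ltW.
have sx := meridian_scap n tau1 rt; have xN := @meridian_last R n tau.
move: (meridian tau) sx xN => x sx xN; have [x1 _] := sx.
have xE : dotv x E = tau by rewrite dotv_Ebasis.
have Ex : dotv E x = tau by rewrite dotvC.
pose w := r^-1 *: (E - tau *: x).
have rw : r *: w = E - tau *: x by rewrite scalerA divff ?scale1r // gt_eqF.
have wx : dotv w x = 0.
  by rewrite /w dotvZl dotvDl dotvNl dotvZl x1 Ex; ring.
have w1 : dotv w w = 1.
  rewrite /w dotvZl dotvZr dotvDl dotvNl dotvZl !dotvDr !dotvNr !dotvZr x1 Ex xE EE.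
  by move: r2; rewrite -/r => r2; have -> : 1 + - (tau * tau) + - (tau * (tau + - (tau * 1))) = r ^+ 2 :> R;
    [rewrite r2; ring|field; rewrite gt_eqF].
have wE : dotv w E = r.
  rewrite /w dotvZl dotvDl dotvNl dotvZl EE xE.
  by have -> : 1 - tau * tau = r ^+ 2 :> R; [rewrite r2; ring|field; rewrite gt_eqF].
have wN : 0 < w 0 ord_max by rewrite -dotv_Ebasis wE.
have J1 := jet_great_circle oU Cf (capU sx) w1 wx.
have J2 := jetD (jetZ c (jet_great_circle_dotv x w E)) (jet_great_circle_dotv x w hgrad).
have J := jetB J1 (jetD (jet_cst 1) J2).
have n0 := great_circle_feasible sx w1 wx (or_intror wN).
have Fs s : scap (great_circle x w s) ->
    f (great_circle x w s) - (1 + (c * dotv (great_circle x w s) E + dotv (great_circle x w s) hgrad)) = 0.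
  by move=> ss; rewrite F // dotv_Ebasis; ring.
have F0 : f (great_circle x w 0) - (1 + (c * dotv (great_circle x w 0) E + dotv (great_circle x w 0) hgrad)) = 0.
  by apply: Fs; rewrite great_circle0.
have nF0 : - (f (great_circle x w 0) - (1 + (c * dotv (great_circle x w 0) E + dotv (great_circle x w 0) hgrad))) = 0.
  by rewrite F0 oppr0.
have le_eq (a b : R) : a = b -> a <= b by move=> ->.
have n1 := filterS (fun s h s0 => le_eq _ _ (Fs s (h s0))) n0.
have n2 := filterS (fun s h s0 => le_eq _ _ (etrans (congr1 -%R (Fs s (h s0))) (oppr0 R))) n0.
have [b1 _] := jet_le0 J F0 (n1 _); have [b2 _] := jet_le0 (jetN J) nF0 (n2 _).
have gw : dotv (grad f x) w = c * r + dotv w hgrad by rewrite -wE; lra.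
have := Rob sx xN; rewrite F // xN -opprB -rw dotvNr dotvZr gw.
have -> : r * (c * r + dotv w hgrad) = c * r ^+ 2 + dotv (r *: w) hgrad by rewrite [in RHS]dotvZl; ring.
rewrite rw dotvDl dotvNl dotvZl (dotvC E) dotv_Ebasis hgrad_last r2; lra.
Qed.

End RadialRigidity.

(** * The capillary cap *)

Section Translation.
Variables (R : realType) (n : nat) (h : 'rV[R]_n.+1 -> R) (c : 'rV[R]_n.+1).
Local Notation f := (fun y => h (y + c)).

Lemma pd_translate (g : 'rV[R]_n.+1 -> R) i :
  pd i (fun y => g (y + c)) = fun y => pd i g (y + c).
Proof.
apply/funext => y; rewrite /pd /derive.
suff -> : (fun s : R => s^-1 *: (((fun y => g (y + c)) \o shift y) (s *: Ebasis R i) - g (y + c))) =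
  (fun s => s^-1 *: ((g \o shift (y + c)) (s *: Ebasis R i) - g (y + c))) by [].
by apply/funext => s /=; rewrite addrA.
Qed.

Lemma grad_translate y : grad f y = grad h (y + c).
Proof. by apply/rowP => i; rewrite !mxE pd_translate. Qed.

Lemma hess_translate y : hess f y = hess h (y + c).
Proof.
have E (g : 'rV[R]_n.+1 -> R) x i j : hess g x i j = pd i (pd j g) x by exact: mxE.
apply/matrixP => i j.
have H1 : pd i (pd j f) y = pd i (fun x => pd j h (x + c)) y by rewrite (pd_translate h j).
have H2 : pd i (fun x => pd j h (x + c)) y = pd i (pd j h) (y + c).
  exact: (f_equal (fun g : 'rV[R]_n.+1 -> R => g y) (pd_translate (pd j h) i)).
exact: etrans (E f y i j) (etrans H1 (etrans H2 (esym (E h (y + c) i j)))).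
Qed.

Lemma translate_continuous (y : 'rV[R]_n.+1) : x + c @[x --> y] --> y + c.
Proof. exact: (cvgD (@cvg_id _ (nbhs y)) (cvg_cst c)). Qed.

Lemma C2_translate (U : set 'rV[R]_n.+1) : C2_on U h -> C2_on [set y | U (y + c)] f.
Proof.
have D (g : 'rV[R]_n.+1 -> R) y : differentiable g (y + c) -> differentiable (fun y => g (y + c)) y.
  by move=> Dg; apply: (@differentiable_comp _ _ _ _ (fun x => x + c) g).
move=> [d0 [d1 d2]]; split; [|split].
- by move=> y /= Uy; apply: D; exact: d0.
- by move=> i y /= Uy; rewrite pd_translate; apply: (D (pd i h)); exact: d1.
move=> i j y /= Uy; rewrite (pd_translate h j) (pd_translate (pd j h) i).
exact: (continuous_cvg _ (d2 i j _ Uy) (@translate_continuous y)).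
Qed.

End Translation.

Theorem theorem5p3 (R : realType) (n k l : nat) (theta : R)
  (U : set 'rV[R]_n.+1) (h : 'rV[R]_n.+1 -> R) :
  (2 <= n)%N -> (l < k)%N -> (k <= n)%N -> 0 < theta < pi ->
  open U -> cap n theta `<=` U -> C2_on U h ->
  admissible k theta h ->
  (forall xi, cap n theta xi ->
     sigmaj k (Wmat theta h xi) / sigmaj l (Wmat theta h xi)
     = ('C(n, k))%:R / ('C(n, l))%:R) ->
  (forall xi, cap_bd n theta xi ->
     dotv (grad h xi) (conormal theta xi) = cos theta / sin theta * h xi) ->
  exists a : 'I_n -> R, forall xi, cap n theta xi ->
    h xi = ell theta xi
           + \sum_(alpha < n) a alpha * xi 0 (widen_ord (leqnSn n) alpha).
Proof.
(* The bound [n >= 2] provides two horizontal axes, one for the meridian plane and one transverse to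
   it. *)
case: n U h => [|[|n]] // U h _ lk kn /andP[th0 thpi] oU capU Ch adm eqn bdy.
set c := cos theta *: edir R n.+2.
pose f y := h (y + c); pose V := [set y | U (y + c)].
have sin0 : 0 < sin theta by apply: sin_gt0_pi; rewrite th0.
have cs : cos theta ^+ 2 + sin theta ^+ 2 = 1 by exact: cos2Dsin2.
have tau1 : cos theta ^+ 2 < 1 by nra.
have cN : c 0 ord_max = - cos theta by rewrite /c /edir !mxE !eqxx mulrN1.
have capE y : scap (cos theta) y -> cap n.+2 theta (y + c).
  move=> [y1 yN]; split; last by rewrite /relpos -/c addrK.
  by rewrite mxE cN subr_ge0.
have scapE x : cap n.+2 theta x -> scap (cos theta) (x - c).
  move=> [xN x1]; split; first exact: x1.
  by rewrite [(x - c) 0 _]mxE [(- c) 0 _]mxE cN opprK lerDr.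
have oV : open V by apply: open_comp oU => y _; exact: translate_continuous.
have capV : @scap R n.+2 (cos theta) `<=` V by move=> y /capE; exact: capU.
have Cf : C2_on V f by exact: C2_translate.
have WE y : Wmat theta h (y + c) = Wtensor f y.
  by rewrite /Wmat /Wtensor /relpos -/c addrK /f hess_translate grad_translate.
have Rob y : scap (cos theta) y -> y 0 ord_max = cos theta ->
    dotv (grad f y) (cos theta *: y - Ebasis R ord_max) = cos theta * f y.
  move=> sy yN; have [y1 _] := sy.
  have bd : cap_bd n.+2 theta (y + c).
    by split; [exact: capE|rewrite mxE cN yN subrr].
  have := bdy _ bd; rewrite /conormal /relpos -/c addrK.
  (* On the rim this projection of [e] has length [sin theta]; clearing it turns the factor
     [cot theta] into [cos theta]. *)
  have -> : edir R n.+2 - dotv (edir R n.+2) y *: y = cos theta *: y - Ebasis R ord_max.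
    by rewrite /edir dotvNl dotvC dotv_Ebasis yN scaleNr opprK addrC.
  have -> : dotv (cos theta *: y - Ebasis R ord_max) (cos theta *: y - Ebasis R ord_max) = sin theta ^+ 2.
    rewrite dotvDl dotvNl dotvZl !dotvDr !dotvNr !dotvZr (dotvC _ y) y1 dotv_Ebasis yN Ebasis_dotv eqxx.
    by rewrite mulr1n; move: cs; lra.
  rewrite sqrtr_sqr gtr0_norm // dotvZr /f grad_translate => H.
  apply: (mulfI (lt0r_neq0 (_ : 0 < (sin theta)^-1))); first by rewrite invr_gt0.
  by rewrite H mulrCA mulrA.
have lev y : scap (cos theta) y ->
    level k l ('C(n.+2, k)%:R / 'C(n.+2, l)%:R) (Wtensor f y).
  move=> sy; have g : garding k (Wtensor f y) by rewrite -WE; exact: adm (capE _ sy).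
  split=> //; first by apply: Wtensor_sym Cf _ => //; exact: capV.
  have sl := garding_gt0 g (ltnW lk).
  by rewrite -(eqn _ (capE _ sy)) WE divfK // gt_eqF.
have reflf nu y (nu1 : dotv nu nu = 1) (nuN : nu 0 ord_max = 0) :=
  @reflection_identity _ _ _ _ _ _ _ _ tau1 oV capV Cf Rob kn lk lev nu nu1 nuN y.
have rigid := radial_rigidity tau1 oV capV Cf Rob kn lk lev reflf.
(* The constants are the horizontal gradient at the pole. The remaining term [1 - cos theta y_N] is
   [ell], because [y_N = x_N + cos theta]. *)
exists (fun alpha => hgrad f 0 (widen_ord (leqnSn n.+2) alpha)) => x sx.
have := rigid _ (scapE _ sx); rewrite {1}/f subrK => ->.
congr (_ + _).
  rewrite /ell dotvC /edir dotvNl dotvC dotv_Ebasis [(x - c) 0 _]mxE [(- c) 0 _]mxE cN.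
  by move: cs; lra.
rewrite dotvC /dotv big_ord_recr /= hgrad_last mul0r addr0; apply: eq_bigr => i _.
congr (_ * _); rewrite [LHS]mxE [(- c) 0 _]mxE /c /edir !mxE.
suff -> : (widen_ord (leqnSn n.+2) i == ord_max) = false by rewrite andbF mulr0n oppr0 mulr0 subr0.
by apply/negbTE; rewrite -val_eqE /= neq_ltn ltn_ord.
Qed.
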